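(* As $r\to\infty$, $$\log q(r)=-\frac{r^4}{4}-r^2\log r+a_2r^2+a_1r+\frac23\log r+a_0+O(r^{-1/6}).$$
   Context: For $r\ge0$, $$q(r)=\prod_{k=2}^\infty\frac{\Gamma(k,r^2)}{\Gamma(k)},\qquad \Gamma(k,x)=\int_x^\infty t^{k-1}e^{-t}\,dt$$ (this is the probability that the reduced Palm process at the origin of the infinite Ginibre process of intensity $1/\pi$ has no points in $\{|z|<r\}$). Let $\operatorname{erfc}y=\frac{2}{\sqrt\pi}\int_y^\infty e^{-t^2}\,dt$ and let $\zeta$ be the Riemann zeta function. The constants are $$a_2=2-\tfrac12\log(2\pi),$$ $$a_1=\sqrt2\left\{\int_{-\infty}^{0}\log\Bigl(\frac{\operatorname{erfc}y}{2}\Bigr)dy+\int_0^\infty\left[\log\Bigl(\frac{\operatorname{erfc}y}{2}\Bigr)+y^2+\log y+\log(2\sqrt\pi)\right]dy\right\},$$ $$J_-=\int_{-\infty}^{0}\left[2y\log\Bigl(\frac{\operatorname{erfc}y}{2}\Bigr)+\frac{e^{-y^2}(1-5y^2)}{3\sqrt\pi\,\operatorname{erfc}y}\right]dy,$$ $$J_+=\int_0^\infty\left[2y\log\Bigl(\frac{\operatorname{erfc}y}{2}\Bigr)+\frac{e^{-y^2}(1-5y^2)}{3\sqrt\pi\,\operatorname{erfc}y}+\frac{11}{3}y^3+2y\log y+\Bigl(\frac12+2\log(2\sqrt\pi)\Bigr)y\right]dy,$$ $$a_0=\tfrac14\log(2\pi)-\zeta'(-1)-2J_--2J_+ .$$ All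 four integrals converge absolutely. *)

(* Defs.v *)
From HB Require Import structures.
From mathcomp Require Import all_boot all_order all_algebra.
From mathcomp Require Import complex.
From mathcomp Require Import all_classical all_reals all_analysis.

Set Implicit Arguments.
Unset Strict Implicit.
Unset Printing Implicit Defensive.

Import Order.TTheory GRing.Theory Num.Theory.
Import numFieldNormedType.Exports.

Local Open Scope classical_set_scope.
Local Open Scope ring_scope.

(* The packaging of the filter at +oo that the Landau notations look for. *)
Canonical pinfty_filter_on (R : numFieldType) : filter_on R :=
  FilterType (pinfty_nbhs R) _.

Definition upper_gamma (R : realType) (k : nat) (x : R) : R :=
  \int[lebesgue_measure]_(t in `[x, +oo[) (t ^+ k.-1 * expR (- t)).

Definition gamma (R : realType) (k : nat) : R := upper_gamma k 0.

Definition q (R : realType) (r : R) : R :=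
  limn (fun n => \prod_(2 <= k < n) (upper_gamma k (r ^+ 2) / gamma R k)).

Definition erfc (R : realType) (y : R) : R :=
  2 / Num.sqrt pi *
  \int[lebesgue_measure]_(t in `[y, +oo[) expR (- t ^+ 2).

(* The complex numbers over R; naming them as a [numFieldType] is what gives
   them the topology induced by the modulus. *)
Definition Cplx (R : realType) : numFieldType := R[i].

(* n^(-s) = e^(-s log n), with e^(x + iy) = e^x (cos y + i sin y). *)
Definition natpowN (R : realType) (n : nat) (s : Cplx R) : Cplx R :=
  let a := expR (- complex.Re s * ln n%:R) in
  let b := - complex.Im s * ln n%:R in
  Complex (a * cos b) (a * sin b).

Definition analytic_on (K : numFieldType) (D : set K) (f : K -> K) : Prop :=
  forall z0, D z0 -> exists c : nat -> K,
    \forall z \near z0, series (fun n => c n * (z - z0) ^+ n) @ \oo --> f z.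

(* The analytic continuation to the connected domain C \ {1} of the Dirichlet
   series; by the identity theorem this determines zeta on C \ {1}, and the
   value at the pole 1 is irrelevant. *)
Definition is_riemann_zeta (R : realType) (zeta : Cplx R -> Cplx R) : Prop :=
  (forall s : Cplx R, 1 < complex.Re s ->
     series (fun n => natpowN n.+1 s) @ \oo --> zeta s) /\
  analytic_on [set s | s <> 1] zeta.

Definition a2 (R : realType) : R := 2 - 2^-1 * ln (2 * pi).

Definition a1 (R : realType) : R :=
  Num.sqrt 2 *
  (\int[lebesgue_measure]_(y in `]-oo, 0]) ln (erfc y / 2) +
   \int[lebesgue_measure]_(y in `]0, +oo[)
     (ln (erfc y / 2) + y ^+ 2 + ln y + ln (2 * Num.sqrt pi))).

Definition Jminus (R : realType) : R :=
  \int[lebesgue_measure]_(y in `]-oo, 0])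
    (2 * y * ln (erfc y / 2) +
     expR (- y ^+ 2) * (1 - 5 * y ^+ 2) / (3 * Num.sqrt pi * erfc y)).

Definition Jplus (R : realType) : R :=
  \int[lebesgue_measure]_(y in `]0, +oo[)
    (2 * y * ln (erfc y / 2) +
     expR (- y ^+ 2) * (1 - 5 * y ^+ 2) / (3 * Num.sqrt pi * erfc y) +
     11 / 3 * y ^+ 3 + 2 * y * ln y +
     (2^-1 + 2 * ln (2 * Num.sqrt pi)) * y).

(* zeta'(-1) is the complex derivative; it is a real number, and [complex.Re]
   only transports it to R. *)
Definition a0 (R : realType) (zeta : Cplx R -> Cplx R) : R :=
  4^-1 * ln (2 * pi) - complex.Re (derive1 zeta (-1)) -
  2 * Jminus R - 2 * Jplus R.

(* Main.v *)
From HB Require Import structures.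
From mathcomp Require Import all_boot all_order all_algebra.
From mathcomp Require Import complex ring lra zify.
From mathcomp Require Import all_classical all_reals all_analysis.
From mathcomp Require Import measurable_realfun.
Require Import Defs.
Set Implicit Arguments.
Unset Strict Implicit.
Unset Printing Implicit Defensive.
Import Order.TTheory GRing.Theory Num.Theory.
Import numFieldNormedType.Exports.
Local Open Scope classical_set_scope.
Local Open Scope ring_scope.
(** Put [x = r^2] and choose [h > 0] with [2 h^2 x = 1].  The ratio
[Gamma(k, x) / Gamma(k)] is [pois x k], the probability that a Poisson variable
of mean [x] is smaller than [k], and the factor missing from the product, at
[k = 1], is [e^-x]; hence [ln q(r) = x + sum_(k >= 1) ln (pois x k)] ([ln_q]).
On the grid [y_k = (x - k) h] the summand is close to a smooth function of
[y_k], so that the sum becomes [1/h] times an integral plus a correction of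
order one.  No single approximation is good on the whole line, and the sum is
cut at an index [N] at distance two to three from [x].

For [k <= N] the distribution function is its last mass times a Mills ratio,
which solves a first order recurrence in [k].  That recurrence is stable and
forgets its initial value, and its solution is
[E y - h A3 y / 12] up to [O(h^2)], where [E y = sqrt pi e^(y^2) erfc y]
([left_comparison]).  The masses are summed exactly, through [ln n!] and
[sum i ln i].

For [k > N] the function [k -> pois x k] solves a second order difference
equation.  A discrete maximum principle, with [1 / (1 + y^2)] as barrier,
shows that it stays within [O(h^2)] of the two-term Edgeworth approximation
[erfc y / 2 (1 + h corrR y)] as soon as it does so at [N]
([right_comparison]).  At [N] Stirling's formula turns the Mills ratio into
the value itself ([pois_at_split]).

After taking logarithms the midpoint rule replaces both sums by differences of
antiderivatives with a summable error ([left_sum], [right_sum]).  The integrals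
that appear are those of [a1], of [J-] and of [J+] in disguise: the integrands
of [J-] and [J+] are [- corrR / 2] and [- corrL / 2] plus the derivatives of
explicit functions, whose total increments are [0] and [- 1/2]
([neg_constants], [pos_constants]).

Stirling's constant is found from Wallis' integrals.  The constant [kappa] in
the expansion of [sum i ln i] is [1/12 - zeta'(-1)] ([zeta_prime]): the
Euler-Maclaurin truncations of [(1 - s) zeta(s)] converge coefficient by
coefficient in their expansions along a straight path from [-1] into the
half-plane of absolute convergence, the identity principle carries the value of
the limit along that path back to [-1], and the coefficient of order one there
contains [sum n ln n].

Everything else in the difference with the stated expansion cancels up to [O(h)]
([log_sum]).  As [h] is of order [1/r],
the error term obtained is [O(1/r)], which is smaller than [r^(-1/6)]. *)

(** * Derivatives and Taylor estimates *)

Section Calculus.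
Variable R : realType.
Implicit Types (f g : R -> R) (x y a b : R).

(** A synonym of the derivative in direction 1 that is not a type class: derivatives
are built by explicit application of the rules below. *)
Definition dv f x a := is_derive x 1 f a.

Lemma dvC x (c : R) : dv (fun _ : R => c) x 0.
Proof. exact: is_derive_cst. Qed.

Lemma dvI x : dv (fun y : R => y) x 1.
Proof. exact: is_derive_id. Qed.

Lemma dvD f g x a b : dv f x a -> dv g x b ->
  dv (fun y => f y + g y) x (a + b).
Proof. by move=> ? ?; exact: is_deriveD. Qed.

Lemma dvN f x a : dv f x a -> dv (fun y => - f y) x (- a).
Proof. by move=> ?; exact: is_deriveN. Qed.

Lemma dv_eq f x a b : dv f x a -> a = b -> dv f x b.
Proof. by move=> h <-. Qed.

Lemma dvM f g x a b : dv f x a -> dv g x b ->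
  dv (fun y => f y * g y) x (a * g x + f x * b).
Proof.
move=> hf hg; have h := is_deriveM hf hg; apply: dv_eq; first exact: h.
by rewrite /GRing.scale /= addrC mulrC.
Qed.

Lemma dvX f (n : nat) x a : dv f x a ->
  dv (fun y => f y ^+ n) x (n%:R * f x ^+ n.-1 * a).
Proof.
move=> hf; apply: dv_eq; last exact: erefl.
rewrite /dv; have -> : (fun y => f y ^+ n) = f ^+ n.
  by elim: n => [|n IH]; apply/funext => y; rewrite ?expr0 // !exprS -IH.
exact: (is_deriveX n hf).
Qed.

Lemma dvcomp f g x a b : dv f (g x) a -> dv g x b ->
  dv (fun y => f (g y)) x (a * b).
Proof. by move=> hf hg; exact: (is_derive1_comp hf hg). Qed.

Lemma dvE f x a : dv f x a ->
  dv (fun y => expR (f y)) x (expR (f x) * a).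
Proof. by move=> hf; apply: (dvcomp _ hf); exact: is_derive_expR. Qed.

Lemma dvL f x a : 0 < f x -> dv f x a ->
  dv (fun y => ln (f y)) x ((f x)^-1 * a).
Proof. by move=> fx hf; apply: (dvcomp _ hf); exact: is_derive1_ln. Qed.

Lemma dvV f x a : f x != 0 -> dv f x a ->
  dv (fun y => (f y)^-1) x (- a * (f x)^-1 ^+ 2).
Proof.
move=> fx hf; apply: dv_eq; first exact: is_deriveV fx hf.
by rewrite /GRing.scale /= exprVn mulrC mulrN mulNr.
Qed.

Lemma dvsin f x a : dv f x a ->
  dv (fun y => sin (f y)) x (cos (f x) * a).
Proof. by move=> hf; apply: (dvcomp _ hf); exact: is_derive_sin. Qed.

Lemma dvcos f x a : dv f x a ->
  dv (fun y => cos (f y)) x (- sin (f x) * a).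
Proof. by move=> hf; apply: (dvcomp _ hf); exact: is_derive_cos. Qed.

Lemma dv_cont f x a : dv f x a -> {for x, continuous f}.
Proof.
move=> h; apply: differentiable_continuous; apply/derivable1_diffP.
exact: (@ex_derive _ _ _ _ _ _ _ h).
Qed.

Lemma dv_derivable f x a : dv f x a -> derivable f x 1.
Proof. by move=> h; exact: (@ex_derive _ _ _ _ _ _ _ h). Qed.

Lemma dv_derive1 f x a : dv f x a -> derive1 f x = a.
Proof. by move=> h; rewrite derive1E; exact: (@derive_val _ _ _ _ _ _ _ h). Qed.

Lemma dv_within f f' a b : (forall x, a <= x <= b -> dv f x (f' x)) ->
  {within `[a, b], continuous f}.
Proof.
move=> h; apply: derivable_within_continuous => x; rewrite in_itv /= => xab.
exact: dv_derivable (h x xab).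
Qed.

Lemma mvt f f' a b : a <= b ->
  (forall x, a <= x <= b -> dv f x (f' x)) ->
  exists2 c, a <= c <= b & f b - f a = f' c * (b - a).
Proof.
move=> ab h; have [||c cab ->] := @MVT_segment R f f' a b ab.
- move=> x; rewrite in_itv /= => /andP[ax xb]; apply: h.
  by rewrite (ltW ax) (ltW xb).
- exact: dv_within h.
by exists c => //; rewrite in_itv /= in cab.
Qed.

Lemma dv_nondecr f f' a b : a <= b ->
  (forall x, a <= x <= b -> dv f x (f' x)) ->
  (forall x, a <= x <= b -> 0 <= f' x) -> f a <= f b.
Proof.
move=> ab h f'0; have [c cab e] := mvt ab h.
by rewrite -subr_ge0 e mulr_ge0 ?subr_ge0 ?f'0.
Qed.

Lemma dv_le f f' g g' a b : a <= b ->
  (forall x, a <= x <= b -> dv f x (f' x)) ->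
  (forall x, a <= x <= b -> dv g x (g' x)) ->
  (forall x, a <= x <= b -> f' x <= g' x) -> f b - f a <= g b - g a.
Proof.
move=> ab hf hg fg.
suff : g a - f a <= g b - f b by lra.
apply: (@dv_nondecr (fun x => g x - f x) (fun x => g' x - f' x)) => // x xab.
  by apply: dvD (hg x xab) (dvN (hf x xab)).
by rewrite subr_ge0 fg.
Qed.

(** Induction on the order: the derivative of a Taylor remainder is the remainder of
the derivative one order lower, and an estimate of derivatives integrates. *)
Lemma taylor_pos (F : nat -> R -> R) (n : nat) a (M h : R) : 0 <= h ->
  (forall i x, (i < n)%N -> a <= x <= a + h -> dv (F i) x (F i.+1 x)) ->
  (forall x, a <= x <= a + h -> `|F n x| <= M) ->
  `|F 0%N (a + h) - \sum_(i < n) F i a * h ^+ i / i`!%:R| <= M * h ^+ n / n`!%:R.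
Proof.
elim: n F h => [|n IH] F h h0 dF bF.
  rewrite big_ord0 subr0 expr0 mulr1 fact0 divr1; apply: bF; lra.
pose G (t : R) := F 0%N (a + t) - \sum_(i < n.+1) F i a * t ^+ i / i`!%:R.
pose G' (t : R) := F 1%N (a + t) - \sum_(i < n) F i.+1 a * t ^+ i / i`!%:R.
have dG t : 0 <= t <= h -> dv G t (G' t).
  move=> th; apply: dvD.
    apply: dv_eq.
      apply: (@dvcomp (F 0%N) (fun y => a + y)).
        by apply: dF => //; lra.
      by apply: dvD; [exact: dvC|exact: dvI].
    by rewrite add0r mulr1.
  apply: (@dvN (fun t => \sum_(i < n.+1) F i a * t ^+ i / i`!%:R)).
  have -> : (fun y : R => \sum_(i < n.+1) F i a * y ^+ i / i`!%:R) =
     \sum_(i < n.+1) (fun y : R => F i a * y ^+ i / i`!%:R).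
    by apply/funext => y; rewrite fct_sumE.
  have -> : \sum_(i < n) F i.+1 a * t ^+ i / i`!%:R =
     \sum_(i < n.+1) (F i a * (i%:R * t ^+ i.-1) / i`!%:R).
    rewrite big_ord_recl /= mul0r mulr0 mul0r add0r; apply: eq_bigr => i _.
    rewrite /bump /= add1n factS natrM invfM.
    have i0 : i.+1%:R != 0 :> R by rewrite pnatr_eq0.
    have i1 : i`!%:R != 0 :> R by rewrite pnatr_eq0 -lt0n fact_gt0.
    rewrite add0n; move: (i.+1%:R : R) (i`!%:R : R) i0 i1 => u v u0 v0.
    by field; rewrite u0 v0.
  apply: is_derive_sum => i.
  apply: dv_eq.
    apply: dvM; last exact: dvC.
    by apply: dvM; [exact: dvC | apply: dvX; exact: dvI].
  by rewrite mul0r add0r mulr0 addr0 mulr1.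
have bG' t : 0 <= t <= h -> `|G' t| <= M * t ^+ n / n`!%:R.
  move=> th; have := IH (fun i => F i.+1) t; apply.
  - by lra.
  - by move=> i x ni xat; apply: dF => //; lra.
  - by move=> x xat; apply: bF; lra.
pose B (t : R) := M * t ^+ n.+1 / n.+1`!%:R.
have dB t : dv B t (M * t ^+ n / n`!%:R).
  apply: dv_eq.
    apply: dvM; last exact: dvC.
    by apply: dvM; [exact: dvC | apply: dvX; exact: dvI].
  rewrite mul0r add0r mulr0 addr0 mulr1 /= factS natrM invfM.
  have i0 : n.+1%:R != 0 :> R by rewrite pnatr_eq0.
  have i1 : n`!%:R != 0 :> R by rewrite pnatr_eq0 -lt0n fact_gt0.
  move: (n.+1%:R : R) (n`!%:R : R) i0 i1 => u v u0 v0.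
  by field; rewrite u0 v0.
have G0 : G 0 = 0.
  rewrite /G addr0 big_ord_recl /= expr0 fact0 divr1 mulr1 big1 ?addr0 ?subrr //.
  by move=> i _; rewrite /bump /= add1n expr0n /= mulr0 mul0r.
have B0 : B 0 = 0 by rewrite /B expr0n /= mulr0 mul0r.
rewrite -[X in `|X|]/(G h) -[leRHS]/(B h).
rewrite ler_norml; apply/andP; split.
  have := @dv_le (fun t => - B t) (fun t => - (M * t ^+ n / n`!%:R)) G G' 0 h.
  move=> /(_ h0 (fun x _ => dvN (dB x)) dG) H.
  suff : - B h - - B 0 <= G h - G 0 by move: G0 B0 => /= -> ->; lra.
  by apply: H => x xh; have := bG' x xh; rewrite ler_norml => /andP[].
suff : G h - G 0 <= B h - B 0 by move: G0 B0 => /= -> ->; lra.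
apply: (dv_le h0 dG (fun x _ => dB x)) => x xh.
by have := bG' x xh; rewrite ler_norml => /andP[].
Qed.

Lemma taylor (F : nat -> R -> R) (n : nat) a (M h : R) :
  (forall i x, (i < n)%N -> `|x - a| <= `|h| -> dv (F i) x (F i.+1 x)) ->
  (forall x, `|x - a| <= `|h| -> `|F n x| <= M) ->
  `|F 0%N (a + h) - \sum_(i < n) F i a * h ^+ i / i`!%:R| <= M * `|h| ^+ n / n`!%:R.
Proof.
move=> dF bF; have [h0|h0] := leP 0 h.
  rewrite ger0_norm // in dF bF *.
  apply: taylor_pos => // [i x ni xah|x xah]; [apply: dF => //|apply: bF].
    by rewrite ger0_norm; lra.
  by rewrite ger0_norm; lra.
pose G i (x : R) := (-1) ^+ i * F i (- x).
have := @taylor_pos G n (- a) M (- h).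
rewrite /G expr0 mul1r opprD !opprK.
rewrite (_ : \sum_(i < n) _ = \sum_(i < n) F i a * h ^+ i / i`!%:R); last first.
  apply: eq_bigr => i _; congr (_ / _).
  by rewrite [(-1) ^+ i * _]mulrC -mulrA -exprMn mulrNN mul1r.
rewrite (ltr0_norm h0); apply.
- lra.
- move=> i x ni xah; apply: dv_eq.
    apply: dvM; first exact: dvC.
    apply: (@dvcomp (F i) (fun y => - y)).
      by apply: dF => //; rewrite ler0_norm ?ltr0_norm //; lra.
    by apply: dvN; exact: dvI.
  by rewrite mul0r add0r exprS; ring.
- move=> x xah; rewrite normrM normrX normrN1 expr1n mul1r; apply: bF.
  by rewrite ler0_norm ?ltr0_norm //; lra.
Qed.

End Calculus.

(** * Improper integrals and antiderivatives *)

Section ImproperIntegral.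
Variable R : realType.
Let mu := @lebesgue_measure R.
Implicit Types (f g F G : R -> R).

(** The intervals [[u n, v n]] exhaust [D]; on each of them the fundamental theorem
of calculus applies, and monotone convergence passes to the union. *)
Lemma ge0_integral_exhaust (D : set R) (u v : nat -> R) f F (l : R) :
  measurable D ->
  (forall n, u n < v n) ->
  (forall m n, (m <= n)%N -> u n <= u m /\ v m <= v n) ->
  (forall x, D x <-> exists n, u n <= x <= v n) ->
  (forall x, D x -> dv F x (f x)) ->
  (forall x, D x -> {for x, continuous f}) ->
  (forall x, D x -> 0 <= f x) ->
  F (v n) - F (u n) @[n --> \oo] --> l ->
  (\int[mu]_(x in D) (f x)%:E)%E = l%:E.
Proof.
move=> mD uv nest DE dF cf f0 Fl.
have Dn n x : u n <= x <= v n -> D x by move=> h; apply/DE; exists n.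
have mf : measurable_fun D f.
  apply: subspace_continuous_measurable_fun => //.
  by apply: continuous_in_subspaceT => x; rewrite inE => Dx; exact: cf.
pose I n : set R := [set` `[u n, v n]].
have ID n : I n `<=` D by move=> x; rewrite /I /= in_itv /=; exact: Dn.
pose gn n := (fun x => (f x)%:E) \_ (I n).
have h1 n : (\int[mu]_(x in D) gn n x = (F (v n) - F (u n))%:E)%E.
  rewrite /gn -integral_mkcondr setIidr // EFinB.
  apply: continuous_FTC2 => //.
  - apply: continuous_in_subspaceT => x; rewrite inE => Ix; apply: cf.
    exact: ID Ix.
  - have cF x : u n <= x <= v n -> {for x, continuous F}.
      by move=> h; apply: dv_cont (dF x (Dn n x h)).
    split.
    + move=> x; rewrite in_itv /= => /andP[h1 h2]; apply: dv_derivable.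
      by apply: dF; apply: (Dn n); rewrite (ltW h1) (ltW h2).
    + by apply: cvg_at_right_filter; apply: cF; rewrite lexx ltW.
    + by apply: cvg_at_left_filter; apply: cF; rewrite lexx ltW.
  - move=> x; rewrite in_itv /= => /andP[h1 h2]; apply: dv_derive1.
    by apply: dF; apply: (Dn n); rewrite (ltW h1) (ltW h2).
have lim_gn x : D x -> limn (gn ^~ x) = (f x)%:E.
  move=> Dx; apply: cvg_lim => //.
  move/DE : (Dx) => [N hN]; apply: cvg_near_cst.
  exists N => // n /= Nn; rewrite /gn patchE.
  rewrite ifT // inE /I /= in_itv /=.
  by have [h2 h3] := nest _ _ Nn; move: hN; lra.
have -> : (\int[mu]_(x in D) (f x)%:E = \int[mu]_(x in D) limn (gn ^~ x))%E.
  by apply: eq_integral => x; rewrite inE => Dx; rewrite lim_gn.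
rewrite monotone_convergence //.
- apply: cvg_lim => //; under eq_fun do rewrite h1.
  by apply: cvg_EFin => //; exact: nearW.
- move=> n; rewrite /gn.
  apply/(measurable_restrict _ _ mD) => //; first exact: measurable_itv.
  by apply: measurable_funS mD _ _ => //; exact/measurable_EFinP.
- move=> n x Dx; rewrite /gn patchE; case: ifP => // _.
  by rewrite lee_fin f0.
- move=> x Dx m n mn; rewrite /gn !patchE.
  case: ifPn => hm.
    rewrite ifT //; move: hm; rewrite !inE /I /= !in_itv /=.
    by have [h2 h3] := nest _ _ mn; lra.
  by case: ifPn => // _; rewrite lee_fin f0.
Qed.

Lemma ge0_integrable_exhaust (D : set R) (u v : nat -> R) f F (l : R) :
  measurable D ->
  (forall n, u n < v n) ->
  (forall m n, (m <= n)%N -> u n <= u m /\ v m <= v n) ->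
  (forall x, D x <-> exists n, u n <= x <= v n) ->
  (forall x, D x -> dv F x (f x)) ->
  (forall x, D x -> {for x, continuous f}) ->
  (forall x, D x -> 0 <= f x) ->
  F (v n) - F (u n) @[n --> \oo] --> l ->
  mu.-integrable D (EFin \o f).
Proof.
move=> mD uv nest DE dF cf f0 Fl; apply/integrableP; split.
  apply/measurable_EFinP; apply: subspace_continuous_measurable_fun => //.
  by apply: continuous_in_subspaceT => x; rewrite inE => Dx; exact: cf.
have -> : (\int[mu]_(x in D) `|(EFin \o f) x| = \int[mu]_(x in D) (f x)%:E)%E.
  apply: eq_integral => x; rewrite inE => Dx /=.
  by rewrite ger0_norm // f0.
by rewrite (ge0_integral_exhaust mD uv nest DE dF cf f0 Fl) ltry.
Qed.

(** The Lebesgue integral of a function of variable sign: [f + g] and [g] are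
nonnegative, and the integral of [f] is the difference of theirs. *)
Lemma Rintegral_exhaust (D : set R) (u v : nat -> R) f F g G (l l' : R) :
  measurable D ->
  (forall n, u n < v n) ->
  (forall m n, (m <= n)%N -> u n <= u m /\ v m <= v n) ->
  (forall x, D x <-> exists n, u n <= x <= v n) ->
  (forall x, D x -> dv F x (f x)) ->
  (forall x, D x -> {for x, continuous f}) ->
  (forall x, D x -> dv G x (g x)) ->
  (forall x, D x -> {for x, continuous g}) ->
  (forall x, D x -> `|f x| <= g x) ->
  F (v n) - F (u n) @[n --> \oo] --> l ->
  G (v n) - G (u n) @[n --> \oo] --> l' ->
  \int[mu]_(x in D) f x = l.
Proof.
move=> mD uv nest DE dF cf dG cg fg Fl Gl.
have g0 x : D x -> 0 <= g x by move=> /fg; apply: le_trans.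
have fg0 x : D x -> 0 <= f x + g x.
  by move=> /fg; rewrite ler_norml => /andP[]; lra.
have dFG x : D x -> dv (fun x => F x + G x) x (f x + g x).
  by move=> Dx; apply: dvD; [exact: dF|exact: dG].
have cfg x : D x -> {for x, continuous (fun x => f x + g x)}.
  by move=> Dx; apply: cvgD; [exact: cf|exact: cg].
have Fl' : (F (v n) + G (v n)) - (F (u n) + G (u n)) @[n --> \oo] --> l + l'.
  have -> : (fun n => (F (v n) + G (v n)) - (F (u n) + G (u n))) =
    (fun n => (F (v n) - F (u n)) + (G (v n) - G (u n))).
    by apply/funext => n; ring.
  exact: cvgD.
have i1 := ge0_integrable_exhaust mD uv nest DE dFG cfg fg0 Fl'.
have i2 := ge0_integrable_exhaust mD uv nest DE dG cg g0 Gl.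
have -> : \int[mu]_(x in D) f x = \int[mu]_(x in D) ((f x + g x) - g x).
  by apply: eq_Rintegral => x _; rewrite addrK.
rewrite RintegralB // /Rintegral.
rewrite (ge0_integral_exhaust mD uv nest DE dFG cfg fg0 Fl').
by rewrite (ge0_integral_exhaust mD uv nest DE dG cg g0 Gl) /= addrK.
Qed.

End ImproperIntegral.

Section Antiderivative.
Variable R : realType.
Implicit Types (f F G : R -> R).

Lemma dv_unique f F G (a b : R) : a <= b ->
  (forall x, a <= x <= b -> dv F x (f x)) ->
  (forall x, a <= x <= b -> dv G x (f x)) -> F b - F a = G b - G a.
Proof.
move=> ab hF hG; apply/eqP; rewrite eq_le; apply/andP; split.
  by apply: (dv_le ab hF hG).
by apply: (dv_le ab hG hF).
Qed.

(** The integral from a fixed [- N] is an antiderivative only to the right of [- N];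
normalized at the origin, these functions agree and glue together. *)
Lemma antiderivative f : continuous f ->
  exists2 F : R -> R, F 0 = 0 & forall x, dv F x (f x).
Proof.
move=> cf.
pose A (N x : R) := \int[lebesgue_measure]_(t in `[- N, x]) f t.
have dA N x : - N < x -> dv (A N) x (f x).
  move=> Nx.
  have xx : x < x + 1 by lra.
  have [||d1 d2] := @continuous_FTC1_closed R f (- N) x (x + 1) xx _ Nx.
  - apply: continuous_compact_integrable; first exact: segment_compact.
    by apply: continuous_in_subspaceT => t _; exact: cf.
  - exact: cf.
  rewrite /dv -d2 derive1E; exact: derivableP.
have cons N M x : `|x| < N -> `|x| < M -> A N x - A N 0 = A M x - A M 0.
  move=> xN xM; have [x0|x0] := leP 0 x.
    rewrite ger0_norm // in xN xM.
    by apply: (@dv_unique f) => // t tx; apply: dA; lra.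
  rewrite ltr0_norm // in xN xM.
  suff : A N 0 - A N x = A M 0 - A M x by lra.
  by apply: (@dv_unique f) => [|t tx|t tx]; [lra|apply: dA; lra|apply: dA; lra].
exists (fun x => A (`|x| + 1) x - A (`|x| + 1) 0); first by rewrite subrr.
move=> x.
have h : dv (fun y => A (`|x| + 2) y - A (`|x| + 2) 0) x (f x).
  have nx : - (`|x| + 2) < x by have := ler_norm (- x); rewrite normrN; lra.
  apply: dv_eq; first by apply: dvD (dA _ _ nx) (dvC _ _).
  by rewrite addr0.
rewrite /dv; apply: near_eq_is_derive h.
near=> y.
apply: cons; last by rewrite ltrDl.
have : `|y - x| < 1.
  by near: y; apply/nbhs_ballP; exists 1 => //= z; rewrite /ball /= distrC.
have := ler_normD (y - x) x; rewrite subrK; lra.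
Unshelve. all: by end_near. Qed.
End Antiderivative.

(** * Limits at infinity *)

Section Tends.
Variable R : realType.
Implicit Types (f g F G : R -> R).

Definition tends f (l : R) :=
  forall e : R, 0 < e -> exists A : R, forall x, A <= x -> `|f x - l| <= e.

Lemma tends_seq f l (v : nat -> R) (c : R) : tends f l ->
  (forall n, n%:R + c <= v n) -> f (v n) @[n --> \oo] --> l.
Proof.
move=> fl vn; apply/cvgrPdist_le => e e0.
have [A hA] := fl e e0.
near=> n; rewrite distrC; apply: hA.
apply: le_trans (vn n); rewrite -lerBlDr.
near: n; exact: nbhs_infty_ger.
Unshelve. all: by end_near. Qed.

Lemma tendsD f g l m : tends f l -> tends g m -> tends (fun x => f x + g x) (l + m).
Proof.
move=> fl gm e e0; have e2 : 0 < e / 2 by lra.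
have [A hA] := fl _ e2; have [B hB] := gm _ e2.
exists (Num.max A B) => x; rewrite ge_max => /andP[/hA h1 /hB h2].
have -> : f x + g x - (l + m) = (f x - l) + (g x - m) by ring.
by apply: le_trans (ler_normD _ _) _; lra.
Qed.

Lemma tendsZ f l (c : R) : tends f l -> tends (fun x => c * f x) (c * l).
Proof.
move=> fl e e0; have e2 : 0 < e / (`|c| + 1).
  by apply: divr_gt0 => //; rewrite ltr_wpDl.
have [A hA] := fl _ e2; exists A => x /hA h.
rewrite -mulrBr normrM; apply: le_trans (_ : (`|c| + 1) * (e / (`|c| + 1)) <= e).
  by apply: ler_pM => //; lra.
by rewrite mulrC divfK // gt_eqF // ltr_wpDl.
Qed.

Lemma tends_inv f l (K : R) : (forall x, 1 <= x -> `|f x - l| <= K / x) -> tends f l.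
Proof.
move=> h e e0; exists (Num.max 1 (K / e)) => x; rewrite ge_max => /andP[x1 xK].
apply: le_trans (h x x1) _.
by rewrite ler_pdivrMr; [rewrite ler_pdivrMr // mulrC in xK; lra|lra].
Qed.

Lemma tends_le f l (b A : R) : tends f l -> (forall x, A <= x -> f x <= b) -> l <= b.
Proof.
move=> fl fb; rewrite leNgt; apply/negP => bl.
have e0 : 0 < (l - b) / 2 by lra.
have [B hB] := fl _ e0.
have h1 := hB (Num.max A B); have h2 := fb (Num.max A B).
have {h2} := h2 (ltac:(by rewrite le_max lexx)).
have {h1} := h1 (ltac:(by rewrite le_max lexx orbT)).
by rewrite ler_norml => /andP[]; lra.
Qed.

Lemma tends_ge f l (b A : R) : tends f l -> (forall x, A <= x -> b <= f x) -> b <= l.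
Proof.
move=> fl fb.
have := @tends_le (fun x => -1 * f x) (-1 * l) (- b) A (tendsZ _ fl).
move=> h; suff : -1 * l <= - b by lra.
by apply: h => x /fb; lra.
Qed.

Lemma tends_monotone F (a C : R) :
  (forall x y, a <= x -> x <= y -> F x <= F y) -> (forall x, a <= x -> F x <= C) ->
  exists2 l, tends F l & forall x, a <= x -> F x <= l <= C.
Proof.
move=> mF bF; pose S : set R := [set F x | x in [set x | a <= x]].
have S0 : S !=set0 by exists (F a); exists a => //=.
have ubS : has_ubound S by exists C => _ [x /= ax <-]; exact: bF.
exists (sup S).
  move=> e e0.
  have [_ [x /= ax <-] hx] := sup_adherent e0 (conj S0 ubS).
  exists x => y xy.
  have h1 : F y <= sup S.
    by apply: ub_le_sup => //; exists y => //=; exact: le_trans xy.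
  have h2 := mF _ _ ax xy.
  by rewrite ler_norml; apply/andP; split; lra.
move=> x ax; apply/andP; split.
  by apply: ub_le_sup => //; exists x.
by apply: ge_sup => // _ [y /= ay <-]; exact: bF.
Qed.

(** Both [G + F] and [G - F] are nondecreasing and the increments of [F] are bounded
by those of [G], hence the limit exists and [G] also controls the tail. *)
Lemma tends_dominated F f G g (a C : R) :
  (forall x, a <= x -> dv F x (f x)) -> (forall x, a <= x -> dv G x (g x)) ->
  (forall x, a <= x -> `|f x| <= g x) -> (forall x, a <= x -> G x <= C) ->
  exists2 l, tends F l & forall x, a <= x -> `|l - F x| <= C - G x.
Proof.
move=> dF dG fg GC.
have mG x y : a <= x -> x <= y -> `|F y - F x| <= G y - G x.
  move=> ax xy; rewrite ler_norml opprB; apply/andP; split.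
    have := @dv_le _ (fun x => - G x) (fun x => - g x) F f x y xy.
    suff h : - G y - - G x <= F y - F x by lra.
    apply: (@dv_le _ (fun x => - G x) (fun x => - g x) F f) => // z /andP[xz zy].
    - by apply: dvN; apply: dG; lra.
    - by apply: dF; lra.
    - by have := fg z (le_trans ax xz); rewrite ler_norml => /andP[].
  apply: (@dv_le _ F f G g) => // z /andP[xz zy].
  - by apply: dF; lra.
  - by apply: dG; lra.
  - by have := fg z (le_trans ax xz); rewrite ler_norml => /andP[].
have [m hm hmb] : exists2 l, tends G l & forall x, a <= x -> G x <= l <= C.
  apply: tends_monotone => // x y ax xy.
  by have := mG x y ax xy; have := normr_ge0 (F y - F x); lra.
have [l hl hlb] : exists2 l, tends (fun x => F x + G x) l &
    forall x, a <= x -> F x + G x <= l <= F a - G a + 2 * C.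
  apply: tends_monotone => [x y ax xy|x ax].
    by have := mG x y ax xy; rewrite ler_norml => /andP[]; lra.
  have := mG a x (lexx a) ax; have := GC x ax; rewrite ler_norml => + /andP[]; lra.
have tF : tends F (l - m).
  have := tendsD hl (tendsZ (-1) hm).
  have -> : (fun x => F x + G x + -1 * G x) = F by apply/funext => x; ring.
  by have -> : l + -1 * m = l - m by ring.
exists (l - m) => // x ax.
rewrite ler_norml; apply/andP; split.
  suff : F x - (C - G x) <= l - m by lra.
  apply: (@tends_ge F _ _ x) tF _ => y xy.
  have := mG x y ax xy; have := GC y (le_trans ax xy); rewrite ler_norml => + /andP[]; lra.
suff : l - m <= F x + (C - G x) by lra.
apply: (@tends_le F _ _ x) tF _ => y xy.
have := mG x y ax xy; have := GC y (le_trans ax xy); rewrite ler_norml => + /andP[]; lra.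
Qed.

Lemma expR_ge_pow (n : nat) (x : R) : 0 <= x -> x ^+ n / n`!%:R <= expR x.
Proof.
elim: n x => [|n IH] x x0; first by rewrite expr0 fact0 divr1 -expR0 ler_expR.
pose f (t : R) := t ^+ n.+1 / n.+1`!%:R.
have df t : dv f t (t ^+ n / n`!%:R).
  apply: dv_eq.
    by apply: dvM; [apply: dvX; exact: dvI | exact: dvC].
  rewrite mulr0 addr0 mulr1 /= factS natrM invfM.
  have i0 : n.+1%:R != 0 :> R by rewrite pnatr_eq0.
  have i1 : n`!%:R != 0 :> R by rewrite pnatr_eq0 -lt0n fact_gt0.
  move: (n.+1%:R : R) (n`!%:R : R) i0 i1 => u v u0 v0.
  by field; rewrite u0 v0.
have h : f x - f 0 <= expR x - expR 0.
  apply: (@dv_le _ f (fun t => t ^+ n / n`!%:R) expR expR) => // t /andP[t0 _].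
    exact: is_derive_expR.
  exact: IH.
move: h; rewrite {2}/f expr0n /= mul0r expR0 => h.
by apply: le_trans (_ : f x <= _) => //; lra.
Qed.

End Tends.

(** * The complementary error function *)

Section Erfc.
Variable R : realType.
Implicit Types (y : R).

Definition gauss y : R := expR (- y ^+ 2).

Lemma gauss_gt0 y : 0 < gauss y. Proof. exact: expR_gt0. Qed.

Lemma dv_gauss y : dv gauss y (- (2 * y) * gauss y).
Proof.
apply: dv_eq; first by apply: dvE; apply: dvN; apply: dvX; exact: dvI.
by rewrite /gauss /= expr1; ring.
Qed.

Lemma gauss_mul (n : nat) y : y ^+ (2 * n) * gauss y <= n`!%:R.
Proof.
have f0 : 0 < n`!%:R :> R by rewrite ltr0n fact_gt0.
have := @expR_ge_pow R n (y ^+ 2) (sqr_ge0 _).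
rewrite -exprM ler_pdivrMr // mulrC => h.
apply: le_trans (_ : n`!%:R * expR (y ^+ 2) * gauss y <= _).
  by rewrite ler_pM2r ?gauss_gt0.
by rewrite -mulrA /gauss -expRD subrr expR0 mulr1.
Qed.

(** Provides the derivative, the reflection formula and the limit of [erfc] at once:
[erfc] is [1 - 2 G / sqrt pi].  Boundedness of [G] comes from comparison with the
arc tangent. *)
Lemma gauss_antiderivative : exists G : R -> R,
  [/\ forall y, dv G y (gauss y), forall y, G (- y) = - G y,
      tends G (Num.sqrt pi / 2) &
      forall y, \int[lebesgue_measure]_(t in `[y, +oo[) gauss t = Num.sqrt pi / 2 - G y].
Proof.
have cg : continuous gauss by move=> y; exact: dv_cont (dv_gauss y).
have [G G0 dG] := antiderivative cg.
have odd y : G (- y) = - G y.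
  have dH x : dv (fun y => - G (- y)) x (gauss x).
    apply: dv_eq; first by apply: dvN; apply: (@dvcomp _ G); [exact: dG | apply: dvN; exact: dvI].
    by rewrite /gauss sqrrN; ring.
  have [y0|y0] := leP 0 y.
    have := dv_unique y0 (fun x _ => dH x) (fun x _ => dG x).
    by rewrite oppr0 G0; lra.
  have := dv_unique (ltW y0) (fun x _ => dH x) (fun x _ => dG x).
  by rewrite oppr0 G0; lra.
have bG x : 0 <= x -> G x <= pi / 2.
  move=> x0.
  have := @dv_le _ G gauss atan (fun x => (1 + x ^+ 2)^-1) 0 x x0 (fun x _ => dG x).
  rewrite G0 atan0 !subr0 => h; apply: le_trans (_ : atan x <= _); last exact/ltW/atan_ltpi2.
  apply: h => t _; first exact: is_derive1_atan.
  rewrite /gauss expRN lef_pV2 ?posrE ?expR_gt0 ?ltr_pwDl ?sqr_ge0 //.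
  exact: expR_ge1Dx.
have gg x : 0 <= x -> `|gauss x| <= gauss x by rewrite ger0_norm // ltW // gauss_gt0.
have [l Gl _] := tends_dominated (fun x _ => dG x) (fun x _ => dG x) gg bG.
have intG y : (\int[lebesgue_measure]_(t in `[y, +oo[) (gauss t)%:E)%E = (l - G y)%:E.
  apply: (@ge0_integral_exhaust _ _ (fun=> y) (fun n => y + n.+1%:R) gauss G).
  - exact: measurable_itv.
  - by move=> n; rewrite ltrDl ltr0n.
  - by move=> m n mn; split=> //; rewrite lerD2l ler_nat ltnS.
  - move=> x; rewrite /= in_itv /= andbT; split.
      move=> yx; exists (Num.truncn (x - y)); rewrite yx /=.
      by rewrite -lerBlDl ltW // truncnS_gt // subr_ge0.
    by move=> [n /andP[]].
  - by move=> x _; exact: dG.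
  - by move=> x _; exact: cg.
  - by move=> x _; exact/ltW/gauss_gt0.
  - apply: cvgB; last exact: cvg_cst.
    by apply: (tends_seq Gl (c := y)) => n; rewrite addrC lerD2l ler_nat.
have le : l = Num.sqrt pi / 2.
  have := intG 0; rewrite G0 subr0.
  have := @integral0y_gauss R; rewrite /gauss_fun => ->.
  by move=> [].
exists G; split => //; first by rewrite -le.
by move=> y; rewrite /Rintegral intG le.
Qed.

Lemma sqrtpi_gt0 : 0 < Num.sqrt pi :> R. Proof. by rewrite sqrtr_gt0 pi_gt0. Qed.

Lemma dv_erfc y : dv (@erfc R) y (- (2 / Num.sqrt pi) * gauss y).
Proof.
have [G [dG _ _ iG]] := gauss_antiderivative.
have -> : @erfc R = fun y => 2 / Num.sqrt pi * (Num.sqrt pi / 2 - G y).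
  by apply/funext => t; rewrite /erfc -iG.
apply: dv_eq; first by apply: dvM (dvC _ _) (dvD (dvC _ _) (dvN (dG y))).
by rewrite mul0r; ring.
Qed.

Lemma erfcN y : erfc (- y) = 2 - erfc y.
Proof.
have [G [_ odd _ iG]] := gauss_antiderivative.
rewrite /erfc -/(gauss) !iG odd.
by have := lt0r_neq0 sqrtpi_gt0 => h; field.
Qed.

Lemma erfc0 : erfc (0 : R) = 1.
Proof. by have := erfcN 0; rewrite oppr0; lra. Qed.

Lemma tends_erfc : tends (@erfc R) 0.
Proof.
have [G [_ _ tG iG]] := gauss_antiderivative.
have := tendsZ (2 / Num.sqrt pi) (tendsD (tendsZ (-1) tG) (_ : tends (fun=> Num.sqrt pi / 2) (Num.sqrt pi / 2))).
have -> : 2 / Num.sqrt pi * (-1 * (Num.sqrt pi / 2) + Num.sqrt pi / 2) = 0 :> R by ring.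
have -> : (fun x => 2 / Num.sqrt pi * (-1 * G x + Num.sqrt pi / 2)) = @erfc R.
  by apply/funext => t; rewrite /erfc -/(gauss) iG; ring.
apply; move=> e e0; exists 0 => x _; rewrite subrr normr0; exact: ltW.
Qed.

Lemma erfc_decr x y : x < y -> erfc y < erfc x.
Proof.
move=> xy; have [c _ e] := mvt (ltW xy) (fun t _ => dv_erfc t).
have := gauss_gt0 c; have := divr_gt0 (ltr0n R 2) sqrtpi_gt0 => a b.
suff : 0 < (2 / Num.sqrt pi) * gauss c * (y - x) by lra.
by apply: mulr_gt0; [exact: mulr_gt0|rewrite subr_gt0].
Qed.

Lemma erfc_gt0 y : 0 < erfc y.
Proof.
apply: le_lt_trans (erfc_decr (_ : y < y + 1)); last by lra.
apply: (tends_le tends_erfc (A := y + 2)) => x yx.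
by apply/ltW/erfc_decr; lra.
Qed.

Lemma erfc_lt2 y : erfc y < 2.
Proof. by have := erfc_gt0 (- y); rewrite erfcN; lra. Qed.

End Erfc.

(** * The scaled function E and its derivatives *)

Section ScaledErfc.
Variable R : realType.
Implicit Types (y : R).

(** Equal to the integral of [2 e^(- s^2 - 2 y s)] over [s > 0]; it is the continuous
counterpart of the Mills ratio of the Poisson distribution. *)
Definition E y : R := Num.sqrt pi * expR (y ^+ 2) * erfc y.

(** The successive derivatives of [E].  The recurrence is [E' = 2 y E - 2]
differentiated by the Leibniz rule. *)
Fixpoint Ed (n : nat) y : R :=
  match n with
  | 0 => E y
  | 1 => 2 * y * E y - 2
  | (m.+1 as k).+1 => 2 * y * Ed k y + 2 * m.+1%:R * Ed m y
  end.

Lemma EdSS n y : Ed n.+2 y = 2 * y * Ed n.+1 y + 2 * n.+1%:R * Ed n y.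
Proof. by []. Qed.

Lemma dv_E y : dv E y (2 * y * E y - 2).
Proof.
apply: dv_eq.
  apply: dvM (dv_erfc y); apply: dvM; first exact: dvC.
  by apply: dvE; apply: dvX; exact: dvI.
rewrite /E /= expr1.
have e : expR (y ^+ 2) * gauss y = 1 by rewrite /gauss -expRD subrr expR0.
have h := lt0r_neq0 (sqrtpi_gt0 R).
have -> : Num.sqrt pi * expR (y ^+ 2) * (- (2 / Num.sqrt pi) * gauss y) =
   - 2 * (expR (y ^+ 2) * gauss y) by field.
by rewrite e; ring.
Qed.

Lemma dv_Ed n y : dv (Ed n) y (Ed n.+1 y).
Proof.
suff : dv (Ed n) y (Ed n.+1 y) /\ dv (Ed n.+1) y (Ed n.+2 y) by case.
elim: n => [|n [IH1 IH2]].
  split; first exact: dv_E.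
  apply: dv_eq.
    apply: dvD; last exact: dvC.
    by apply: dvM (dv_E y); apply: dvM (dvI _); exact: dvC.
  by rewrite /=; ring.
split=> //.
have -> : Ed n.+2 = fun y => 2 * y * Ed n.+1 y + 2 * n.+1%:R * Ed n y by [].
apply: dv_eq.
  apply: dvD; last by apply: dvM IH1; exact: dvC.
  by apply: dvM IH2; apply: dvM (dvI _); exact: dvC.
by rewrite (EdSS n.+1) -!natr1; ring.
Qed.

Lemma E_gt0 y : 0 < E y.
Proof. exact: mulr_gt0 (mulr_gt0 (sqrtpi_gt0 R) (expR_gt0 _)) (erfc_gt0 y). Qed.

Lemma E0 : E 0 = Num.sqrt pi.
Proof. by rewrite /E expr0n /= expR0 erfc0 !mulr1. Qed.

Lemma gaussV y : expR (y ^+ 2) * gauss y = 1.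
Proof. by rewrite /gauss -expRD subrr expR0. Qed.

Lemma erfcE y : erfc y = gauss y * E y / Num.sqrt pi.
Proof.
have h := lt0r_neq0 (sqrtpi_gt0 R).
have -> : gauss y * E y / Num.sqrt pi = (expR (y ^+ 2) * gauss y) * erfc y.
  by rewrite /E; field.
by rewrite gaussV mul1r.
Qed.

(** [erfc - gauss / sqrt pi] has derivative [2 gauss (y - 1) / sqrt pi], nonnegative
from 1 on, and it vanishes at infinity. *)
Lemma E_le1 y : 1 <= y -> E y <= 1.
Proof.
move=> y1; have sp := sqrtpi_gt0 R.
suff : erfc y - gauss y / Num.sqrt pi <= 0.
  rewrite erfcE -mulrBl pmulr_lle0 ?invr_gt0 // -[X in _ - X]mulr1 -mulrBr.
  by rewrite pmulr_rle0 ?gauss_gt0 // subr_le0.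
suff h : tends (fun y => erfc y - gauss y / Num.sqrt pi) 0.
  apply: (tends_ge h (A := y)) => x yx.
  have := @dv_nondecr _ (fun y => erfc y - gauss y / Num.sqrt pi)
    (fun y => 2 / Num.sqrt pi * gauss y * (y - 1)) y x yx; apply => t ht.
    apply: dv_eq; first by apply: dvD (dv_erfc t) (dvN (dvM (dv_gauss t) (dvC _ _))).
    by have sp0 := lt0r_neq0 sp; field.
  apply: mulr_ge0; last by lra.
  by apply/mulr_ge0; [apply: divr_ge0 => //; exact: ltW|exact/ltW/gauss_gt0].
have -> : 0 = 0 + - (Num.sqrt pi)^-1 * 0 :> R by ring.
have -> : (fun y => erfc y - gauss y / Num.sqrt pi) =
  (fun y : R => erfc y + - (Num.sqrt pi)^-1 * gauss y).
  by apply/funext => x; ring.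
apply: tendsD; first exact: tends_erfc.
apply: tendsZ; apply: (@tends_inv _ _ _ 1) => x x1.
rewrite subr0 ger0_norm; last exact/ltW/gauss_gt0.
rewrite ler_pdivlMr; last by lra.
have : x ^+ 2 * gauss x <= 1 by exact: gauss_mul 1 x.
have := gauss_gt0 x; nra.
Qed.

Lemma Ed_bound n : exists2 C, 0 <= C & forall y, 1 <= y -> `|Ed n y| <= C * y ^+ n.
Proof.
suff : (exists2 C, 0 <= C & forall y, 1 <= y -> `|Ed n y| <= C * y ^+ n) /\
       (exists2 C, 0 <= C & forall y, 1 <= y -> `|Ed n.+1 y| <= C * y ^+ n.+1) by case.
elim: n => [|n [[C C0 hC] [D D0 hD]]].
  split; [exists 1 => // y y1|exists 4 => // y y1].
    by rewrite expr0 mulr1 ger0_norm ?E_le1 // ltW // E_gt0.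
  have := E_le1 y1; have := E_gt0 y => a b.
  by rewrite /= expr1 ler_norml; apply/andP; split; nra.
split; first by exists D.
exists (2 * D + 2 * n.+1%:R * C).
  by rewrite addr_ge0 // !mulr_ge0.
move=> y y1; rewrite EdSS.
apply: le_trans (ler_normD _ _) _; rewrite !normrM !(@ger0_norm _ 2) //.
rewrite (@ger0_norm _ y); last by lra.
rewrite !normr_nat [leRHS]mulrDl; apply: lerD.
  have := hD y y1; rewrite [y ^+ n.+2]exprS => h.
  have -> : 2 * D * (y * y ^+ n.+1) = 2 * y * (D * y ^+ n.+1) by ring.
  by apply: ler_wpM2l => //; lra.
rewrite -!mulrA ler_wpM2l // ler_wpM2l //.
apply: le_trans (hC y y1) _; apply: ler_wpM2l => //.
by apply: ler_weXn2l => //; exact: leq_trans (leqnSn _) (leqnSn _).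
Qed.

Lemma tends_Ed_gauss n : tends (fun y => Ed n y * gauss y) 0.
Proof.
have [C C0 hC] := Ed_bound n.
apply: (@tends_inv _ _ _ (C * n.+1`!%:R)) => y y1; rewrite subr0.
rewrite normrM (@ger0_norm _ (gauss y)); last exact/ltW/gauss_gt0.
rewrite ler_pdivlMr; last by lra.
have g0 := gauss_gt0 y.
apply: le_trans (_ : (C * y ^+ n) * gauss y * y <= _).
  by rewrite !ler_wpM2r ?hC //; [lra|exact: ltW].
have -> : C * y ^+ n * gauss y * y = C * (y ^+ n.+1 * gauss y) by rewrite exprS; ring.
apply: ler_wpM2l => //; apply: le_trans (gauss_mul n.+1 y).
rewrite ler_wpM2r ?(ltW g0) //; apply: ler_weXn2l => //.
by rewrite leq_pmull.
Qed.

(** The derivative of [Ed n.+1 * gauss] is [2 (n + 1) Ed n * gauss]: if [Ed n] has a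
constant sign, [Ed n.+1 * gauss] is monotone, and it tends to 0, so it has the
opposite sign. *)
Lemma Ed_sign n y : 0 < (-1) ^+ n * Ed n y.
Proof.
elim: n y => [|n IH] y; first by rewrite mul1r E_gt0.
pose f t := (-1) ^+ n.+1 * (Ed n.+1 t * gauss t).
have df t : dv f t (- (2 * n.+1%:R) * ((-1) ^+ n * Ed n t) * gauss t).
  apply: dv_eq.
    apply: dvM (dvC _ _) _; exact: (dvM (dv_Ed n.+1 t) (dv_gauss t)).
  by rewrite EdSS exprS; ring.
have tf : tends f 0.
  have -> : 0 = (-1) ^+ n.+1 * 0 :> R by rewrite mulr0.
  exact: tendsZ (tends_Ed_gauss _).
have decr a b : a < b -> f b < f a.
  move=> ab; have [c _ e] := mvt (ltW ab) (fun t _ => df t).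
  suff : 0 < (2 * n.+1%:R) * ((-1) ^+ n * Ed n c) * gauss c * (b - a) by lra.
  apply: mulr_gt0; last by rewrite subr_gt0.
  apply: mulr_gt0 (gauss_gt0 c); apply: mulr_gt0 (IH c).
  by rewrite -natrM ltr0n.
suff : 0 < f y by rewrite /f mulrA pmulr_lgt0 // gauss_gt0.
apply: le_lt_trans (decr y (y + 1) _); last by lra.
by apply: (tends_le tf (A := y + 2)) => x yx; apply/ltW/decr; lra.
Qed.

(** The alternating signs of the derivatives make all [A n] positive and decreasing,
and the recurrence [ASS] turns positivity of one of them into an inequality
between the two previous ones. *)
Definition A n y : R := `|Ed n y|.

Lemma AE n y : A n y = (-1) ^+ n * Ed n y.
Proof.
by rewrite /A -(ger0_norm (ltW (Ed_sign n y))) normrM normrX normrN1 expr1n mul1r.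
Qed.

Lemma A_gt0 n y : 0 < A n y. Proof. by rewrite AE Ed_sign. Qed.

Lemma ASS n y : A n.+2 y = 2 * n.+1%:R * A n y - 2 * y * A n.+1 y.
Proof. by rewrite !AE EdSS !exprS; ring. Qed.

Lemma A_decr n x y : x <= y -> A n y <= A n x.
Proof.
move=> xy; rewrite !AE.
have := @dv_le _ (fun t => (-1) ^+ n * Ed n t) (fun t => - ((-1) ^+ n.+1 * Ed n.+1 t))
   (fun=> 0) (fun=> 0) x y xy.
suff h : (-1) ^+ n * Ed n y - (-1) ^+ n * Ed n x <= 0 - 0 by move=> _; lra.
apply: (@dv_le _ (fun t => (-1) ^+ n * Ed n t) (fun t => - ((-1) ^+ n.+1 * Ed n.+1 t))
   (fun=> 0) (fun=> 0)) => // t _.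
- by apply: dv_eq; [apply: dvM (dvC _ _) (dv_Ed n t) | rewrite exprS; ring].
- exact: dvC.
- by have := Ed_sign n.+1 t; lra.
Qed.

End ScaledErfc.

(** * Inequalities between E and its derivatives *)

Section MillsBounds.
Variable R : realType.
Implicit Types (y h : R).

Lemma A0E y : A 0 y = E y. Proof. by rewrite AE mul1r. Qed.
Lemma A1E y : A 1 y = 2 - 2 * y * E y. Proof. by rewrite AE /=; ring. Qed.
Lemma A2E y : A 2 y = 2 * E y - 2 * y * A 1 y. Proof. by rewrite ASS A0E; ring. Qed.
Lemma A3E y : A 3 y = 4 * A 1 y - 2 * y * A 2 y. Proof. by rewrite ASS; ring. Qed.
Lemma A4E y : A 4 y = 6 * A 2 y - 2 * y * A 3 y. Proof. by rewrite ASS; ring. Qed.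
Lemma A5E y : A 5 y = 8 * A 3 y - 2 * y * A 4 y. Proof. by rewrite ASS; ring. Qed.

Lemma yE_lt1 y : y * E y < 1.
Proof. by have := A_gt0 1 y; rewrite A1E; lra. Qed.

Lemma E_decr x y : x <= y -> E y <= E x.
Proof. by move=> xy; have := A_decr 0 xy; rewrite !A0E. Qed.

Lemma E_le2 y : 0 <= y -> E y <= 2.
Proof.
move=> y0; apply: le_trans (E_decr y0) _; rewrite E0.
have -> : 2 = Num.sqrt (4 : R).
  by rewrite (_ : 4 = 2 ^+ 2) ?sqrtr_sqr ?ger0_norm //; ring.
by rewrite ler_sqrt //; have := @pihalf_lt2 R; lra.
Qed.

(** Like most bounds below this is the positivity of some [A n], here [A 2], rewritten
through [A0E]-[A5E]. *)
Lemma E_lower y : 0 <= y -> 2 <= (3 + 2 * y) * E y.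
Proof.
have key (z : R) : 2 * z <= (1 + 2 * z ^+ 2) * E z.
  by have := A_gt0 2 z; rewrite A2E A1E; nra.
move=> y0; have e0 := E_gt0 y; have [yh|yh] := leP (1/2) y.
  have k := key y.
  suff : (1 + 2 * y ^+ 2) * 2 <= (1 + 2 * y ^+ 2) * ((3 + 2 * y) * E y).
    by rewrite ler_pM2l //; nra.
  nra.
have k := key (1/2); have d := E_decr (ltW yh).
by have : 2/3 <= E y; [nra | nra].
Qed.

Lemma A1_le y : 0 <= y -> A 1 y <= 9 * E y ^+ 2.
Proof.
move=> y0; have k := E_lower y0; have e0 := E_gt0 y.
have a1 : (1 + 2 * y ^+ 2) * A 1 y <= 2.
  by have := A_gt0 2 y; rewrite A2E A1E; nra.
have k2 : 4 <= (3 + 2 * y) ^+ 2 * E y ^+ 2 by rewrite -exprMn; nra.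
have k3 : (3 + 2 * y) ^+ 2 * E y ^+ 2 <= 18 * (1 + 2 * y ^+ 2) * E y ^+ 2.
  apply: ler_wpM2r; first exact: sqr_ge0.
  have := sqr_ge0 (4 * y - 3 / 2); nra.
suff : (1 + 2 * y ^+ 2) * A 1 y <= (1 + 2 * y ^+ 2) * (9 * E y ^+ 2).
  by rewrite ler_pM2l //; nra.
lra.
Qed.

Lemma A1_lower y : 0 <= y -> 2 < (3 + 2 * y ^+ 2) * A 1 y.
Proof. by move=> y0; have := A_gt0 3 y; rewrite A3E A2E A1E; nra. Qed.

(** The squares of [E] are bounded by a multiple of [A 1 = - E'], so they can be summed
over a grid by telescoping. *)
Lemma A1_ge y : 0 <= y -> E y ^+ 2 <= 7 * A 1 y.
Proof.
move=> y0; have e0 := E_gt0 y; have e2 := E_le2 y0; have ye := yE_lt1 y.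
have k := A1_lower y0.
have k2 : (3 + 2 * y ^+ 2) * E y ^+ 2 <= 14.
  have a : (y * E y) ^+ 2 <= 1.
    by rewrite expr_le1 //; [exact: ltW|apply: mulr_ge0 => //; exact: ltW].
  have b : E y ^+ 2 <= 4 by nra.
  by rewrite exprMn in a; lra.
suff : (3 + 2 * y ^+ 2) * E y ^+ 2 <= (3 + 2 * y ^+ 2) * (7 * A 1 y).
  by rewrite ler_pM2l //; nra.
lra.
Qed.

Lemma E_ge25 y : 0 <= y -> y <= 1 -> 2/5 <= E y.
Proof. by move=> y0 y1; have := E_lower y0; have := E_gt0 y; nra. Qed.

Lemma yE_ge y : 1 <= y -> 2/5 <= y * E y.
Proof. by move=> y1; have := @E_lower y; have := E_gt0 y; nra. Qed.

Lemma A2_le y : 0 <= y -> A 2 y <= 45 * E y ^+ 3.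
Proof.
move=> y0; have e0 := E_gt0 y; have [y1|y1] := leP y 1.
  have := E_ge25 y0 y1; have := A_gt0 1 y; rewrite A2E => a b.
  apply: le_trans (_ : 2 * E y <= _); first nra.
  rewrite exprS expr2.
  have : 4/25 <= E y * E y by nra.
  nra.
have k := A_gt0 3 y; rewrite A3E in k.
have k1 := A1_le y0; have k2 := yE_ge (ltW y1); have k3 := A_gt0 2 y.
have : A 2 y <= A 2 y * (y * E y * (5/2)) by nra.
move=> /le_trans; apply.
have -> : A 2 y * (y * E y * (5/2)) = (5/4) * E y * (2 * y * A 2 y) by field.
apply: le_trans (_ : 5/4 * E y * (36 * E y ^+ 2) <= _).
  by apply: ler_wpM2l; [lra|lra].
by rewrite [E y ^+ 3]exprS; lra.
Qed.

Lemma A3_le y : 0 <= y -> A 3 y <= 135 * E y ^+ 3.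
Proof.
move=> y0; have e0 := E_gt0 y; have [y1|y1] := leP y 1.
  have := E_ge25 y0 y1; have := A_gt0 2 y; have := A1_le y0; rewrite A3E => a b c.
  apply: le_trans (_ : 36 * E y ^+ 2 <= _); first nra.
  rewrite [E y ^+ 3]exprS.
  have := sqr_ge0 (E y); nra.
have := A_gt0 4 y; rewrite A4E; have := A2_le y0; have := A_gt0 3 y; nra.
Qed.

Lemma A3_le4 y : 0 <= y -> A 3 y <= 4 * A 1 y.
Proof. by move=> y0; rewrite A3E; have := A_gt0 2 y; nra. Qed.

Lemma A4_le y : 0 <= y -> A 4 y <= 6 * A 2 y.
Proof. by move=> y0; rewrite A4E; have := A_gt0 3 y; nra. Qed.

Lemma A5_le y : 0 <= y -> A 5 y <= 8 * A 3 y.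
Proof. by move=> y0; rewrite A5E; have := A_gt0 4 y; nra. Qed.

Lemma yA2_le y : y * A 2 y <= 2 * A 1 y.
Proof. by have := A_gt0 3 y; rewrite A3E; lra. Qed.

Lemma yA4_le y : y * A 4 y <= 4 * A 3 y.
Proof. by have := A_gt0 5 y; rewrite A5E; lra. Qed.

Lemma E_step y h : 0 <= h -> h * A 1 (y + h) <= E y - E (y + h) <= h * A 1 y.
Proof.
move=> h0; have yh : y <= y + h by lra.
have [c /andP[yc cy] e] := mvt yh (fun t _ => @dv_E R t).
have d1 := A_decr 1 yc; have d2 := A_decr 1 cy.
have {}e : E y - E (y + h) = A 1 c * h by rewrite A1E; lra.
by rewrite e; apply/andP; split; nra.
Qed.

Lemma EdA n y : Ed n y = (-1) ^+ n * A n y.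
Proof. by rewrite AE mulrA -exprMn mulrNN mulr1 expr1n mul1r. Qed.

Arguments Ed : simpl never.

Lemma taylor_A (m n : nat) y h : 0 <= h ->
  `|Ed m (y + h) - \sum_(i < n) Ed (m + i) y * h ^+ i / i`!%:R|
    <= A (m + n) y * h ^+ n / n`!%:R.
Proof.
move=> h0; have := @taylor_pos R (fun i => Ed (m + i)) n y (A (m + n) y) h h0.
rewrite addn0; apply => [i x _ _|x /andP[yx _]]; first by rewrite addnS; exact: dv_Ed.
exact: A_decr.
Qed.

(** [E y - h A3 y / 12] is chosen to satisfy the recurrence
[M y = 2 h + (1 - 2 h (y + h)) M (y + h)] up to [h^3]: the terms in [h] cancel by
[E' = 2 y E - 2], and those in [h^2] by [E'''' = 2 y E''' + 6 E''], which is what the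
correction [A3 / 12] is for. *)
Lemma residual y h : 0 <= y -> 0 <= h -> h <= 1 -> 0 <= 1 - 2 * h * (y + h) ->
  `|(E y - h * A 3 y / 12) - 2 * h -
    (1 - 2 * h * (y + h)) * (E (y + h) - h * A 3 (y + h) / 12)|
  <= 300 * h ^+ 3 * E y ^+ 2.
Proof.
move=> y0 h0 h1 c0; have e0 := E_gt0 y.
have := taylor_A 0 3 y h0; rewrite !big_ord_recr big_ord0 /= !EdA !add0n A0E.
have -> : 3`!%:R = 6 :> R by [].
set r3 := (X in `|X|) => hr3.
have := taylor_A 3 2 y h0; rewrite !big_ord_recr big_ord0 /= !EdA addn0.
have -> : (3 + 1 = 4)%N by [].
have -> : (3 + 2 = 5)%N by [].
have -> : 2`!%:R = 2 :> R by [].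
set q := (X in `|X|) => hq.
have eE : E (y + h) = E y - h * A 1 y + h ^+ 2 * A 2 y / 2 + r3.
  rewrite /r3 -[E (y + h)]/(Ed 0 (y + h)) EdA !A0E.
  have -> : 2`!%:R = 2 :> R by [].
  have -> : 1`!%:R = 1 :> R by [].
  by field.
have eA : A 3 (y + h) = A 3 y - h * A 4 y - q.
  rewrite /q; have -> : 1`!%:R = 1 :> R by [].
  by field.
rewrite eE eA.
set c := 1 - _ in c0 *.
have c1 : c <= 1 by rewrite /c; nra.
(* The powers [1], [h] and [h^2] have disappeared on the right. *)
have -> : E y - h * A 3 y / 12 - 2 * h -
   c * (E y - h * A 1 y + h ^+ 2 * A 2 y / 2 + r3 - h * (A 3 y - h * A 4 y - q) / 12)
  = - (c * (r3 + h * q / 12)) + h ^+ 3 * (y * A 2 y + y * A 4 y / 6 - 2 * A 1 y - A 3 y / 6)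
    + h ^+ 4 * (A 2 y + A 4 y / 6).
  by rewrite /c !A4E !A3E !A2E !A1E; field.
clear eE eA; clearbody r3 q c.
have a1 := A1_le y0; have a1p := A_gt0 1 y; have a3p := A_gt0 3 y.
have a2 : A 2 y <= 90 * E y ^+ 2.
  by have := A2_le y0; have := E_le2 y0; rewrite [E y ^+ 3]exprS; have := sqr_ge0 (E y); nra.
have a3 := A3_le4 y0; have a4 := A4_le y0; have a5 := A5_le y0.
have ya2 := yA2_le y; have ya4 := yA4_le y.
have a2p := A_gt0 2 y; have a4p := A_gt0 4 y.
have ya2p : 0 <= y * A 2 y by apply: mulr_ge0 => //; exact: ltW.
have ya4p : 0 <= y * A 4 y by apply: mulr_ge0 => //; exact: ltW.
have h3 : 0 <= h ^+ 3 by exact: exprn_ge0.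
have n1 : `|c * (r3 + h * q / 12)| <= h ^+ 3 * (A 3 y / 6 + A 5 y / 24).
  rewrite normrM (ger0_norm c0).
  apply: le_trans (_ : `|r3 + h * q / 12| <= _).
    by rewrite ler_piMl.
  apply: le_trans (ler_normD _ _) _.
  rewrite 2!normrM (ger0_norm h0) (@ger0_norm _ 12^-1) //.
  have : h * `|q| <= h * (A 5 y * h ^+ 2 / 2) by apply: ler_wpM2l.
  by move=> b; apply: le_trans (lerD hr3 (ler_wpM2r _ b)) _; rewrite ?invr_ge0 //; lra.
have n2 : `|y * A 2 y + y * A 4 y / 6 - 2 * A 1 y - A 3 y / 6| <= 10 * A 1 y.
  by rewrite ler_norml; apply/andP; split; lra.
have n3 : h ^+ 4 * (A 2 y + A 4 y / 6) <= h ^+ 3 * (180 * E y ^+ 2).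
  rewrite exprSr -mulrA; apply: ler_wpM2l => //.
  apply: le_trans (_ : 1 * (A 2 y + A 4 y / 6) <= _); last by lra.
  by apply: ler_wpM2r => //; lra.
apply: le_trans (ler_normD _ _) _; apply: le_trans (lerD (ler_normD _ _) (lexx _)) _.
rewrite normrN [`|h ^+ 3 * _|]normrM (ger0_norm h3).
rewrite (@ger0_norm _ (h ^+ 4 * _)); last by rewrite mulr_ge0 ?exprn_ge0 //; lra.
have n4 : h ^+ 3 * `|y * A 2 y + y * A 4 y / 6 - 2 * A 1 y - A 3 y / 6|
  <= h ^+ 3 * (10 * A 1 y) by apply: ler_wpM2l.
have n5 : h ^+ 3 * (A 3 y / 6 + A 5 y / 24) <= h ^+ 3 * (2 * A 1 y).
  by apply: ler_wpM2l => //; lra.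
have n6 : h ^+ 3 * A 1 y <= h ^+ 3 * (9 * E y ^+ 2) by apply: ler_wpM2l.
have n7 : 0 <= h ^+ 3 * E y ^+ 2 by rewrite mulr_ge0 ?sqr_ge0.
by lra.
Qed.

(** [E^3] is a strict supersolution of the homogeneous recurrence, with a gain that
can absorb [residual]. *)
Lemma cube_step y h : 0 <= y -> 0 <= h -> h <= 1/36 ->
  h * E y ^+ 2 / 2 <= E y ^+ 3 - (1 - 2 * h * (y + h)) * E (y + h) ^+ 3.
Proof.
move=> y0 h0 h36; have /andP[s1 s2] := E_step y h0.
set e := E (y + h) in s1 s2 *.
have e0 : 0 < e by exact: E_gt0.
have ye : (y + h) * e < 1 by exact: yE_lt1.
have a1 := A1_le y0; have E2 := E_le2 y0; have Ep := E_gt0 y.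
have a1p : 0 <= A 1 (y + h) by exact/ltW/A_gt0.
have he : E y / 2 <= e.
  have : h * A 1 y <= 1/36 * (9 * E y ^+ 2).
    by apply: ler_pM => //; exact/ltW/A_gt0.
  nra.
have h1 : e ^+ 3 + 3 * e ^+ 2 * (h * A 1 (y + h)) <= E y ^+ 3.
  apply: le_trans (_ : (e + h * A 1 (y + h)) ^+ 3 <= _).
    have d0 : 0 <= h * A 1 (y + h) by exact: mulr_ge0.
    rewrite -subr_ge0; set d := h * _ in d0 *.
    have -> : (e + d) ^+ 3 - (e ^+ 3 + 3 * e ^+ 2 * d) = 3 * e * d ^+ 2 + d ^+ 3 by ring.
    by rewrite addr_ge0 ?exprn_ge0 // mulr_ge0 ?exprn_ge0 //; lra.
  by apply: lerXn2r; rewrite ?nnegrE; [apply: addr_ge0; [exact: ltW|exact: mulr_ge0]|exact: ltW|lra].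
have h2 : h * e ^+ 2 * 2 <= E y ^+ 3 - (1 - 2 * h * (y + h)) * e ^+ 3.
  apply: le_trans (_ : h * e ^+ 2 * (6 - 4 * ((y + h) * e)) <= _).
    by apply: ler_wpM2l; [rewrite mulr_ge0 ?sqr_ge0 | lra].
  by move: h1; rewrite A1E -/e; lra.
apply: le_trans h2; rewrite -mulrA -[leRHS]mulrA; apply: ler_wpM2l => //.
by nra.
Qed.
End MillsBounds.

(** * The recurrence for Mills ratios *)

Section LeftComparison.
Variable R : realType.
Implicit Types (y h x : R).

Lemma ln1D_approx (u : R) : `|u| <= 1/2 -> `|ln (1 + u) - u| <= u ^+ 2.
Proof.
move=> hu.
have dln t : - (1/2) <= t -> dv (fun t => ln (1 + t)) t (1 + t)^-1.
  move=> ht; apply: dv_eq; first by apply: dvL; [lra|apply: dvD (dvC _ _) (dvI _)].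
  by rewrite add0r mulr1.
move: hu; rewrite ler_norml => /andP[u1 u2]; have [u0|u0] := leP 0 u.
  rewrite ler_norml; apply/andP; split.
    have := @dv_le _ (fun t => t - t ^+ 2) (fun t => 1 - 2 * t) (fun t => ln (1 + t))
       (fun t => (1 + t)^-1) 0 u u0.
    suff h : u - u ^+ 2 - (0 - 0 ^+ 2) <= ln (1 + u) - ln (1 + 0).
      by move: h; rewrite addr0 ln1 expr0n /=; lra.
    apply: (@dv_le _ (fun t => t - t ^+ 2) (fun t => 1 - 2 * t) (fun t => ln (1 + t))
       (fun t => (1 + t)^-1)) => // t /andP[t0 tu].
    - apply: dv_eq; first by apply: dvD (dvI _) (dvN (dvX 2 (dvI _))).
      by rewrite /= expr1; ring.
    - by apply: dln; lra.
    - rewrite -[leRHS]mul1r ler_pdivlMr; last by lra.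
      by have := sqr_ge0 t; nra.
  suff h : ln (1 + u) - ln (1 + 0) <= u - 0.
    by move: h; rewrite addr0 ln1; have := sqr_ge0 u; lra.
  apply: (@dv_le _ (fun t => ln (1 + t)) (fun t => (1 + t)^-1) (fun t => t) (fun=> 1))
     => // t /andP[t0 tu].
  - by apply: dln; lra.
  - exact: dvI.
  - by rewrite invf_le1; lra.
have u0' := ltW u0.
rewrite ler_norml; apply/andP; split.
  suff h : ln (1 + 0) - ln (1 + u) <= (0 - 0 ^+ 2) - (u - u ^+ 2).
    by move: h; rewrite addr0 ln1 expr0n /=; lra.
  apply: (@dv_le _ (fun t => ln (1 + t)) (fun t => (1 + t)^-1) (fun t => t - t ^+ 2) (fun t => 1 - 2 * t))
     => // t /andP[t0 tu].
  - by apply: dln; lra.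
  - apply: dv_eq; first by apply: dvD (dvI _) (dvN (dvX 2 (dvI _))).
    by rewrite /= expr1; ring.
  - rewrite -[leLHS]mul1r ler_pdivrMr; last by lra.
    by nra.
suff h : 0 - u <= ln (1 + 0) - ln (1 + u).
  by move: h; rewrite addr0 ln1; have := sqr_ge0 u; lra.
apply: (@dv_le _ (fun t => t) (fun=> 1) (fun t => ln (1 + t)) (fun t => (1 + t)^-1))
   => // t /andP[t0 tu].
- exact: dvI.
- by apply: dln; lra.
- by rewrite -[leRHS]mul1r ler_pdivlMr; lra.
Qed.

(** The error satisfies the same recurrence with [residual] as source term, and
[600 h^2 E^3] dominates it: by [cube_step] it loses [300 h^3 E^2] at every step.
The factor [2 k h^2] vanishes at [k = 0], hence no initial condition on [M]. *)
Lemma left_comparison h (M : nat -> R) : 0 < h -> h <= 1/36 ->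
  (forall k, M k.+1 = 2 * h + 2 * k%:R * h ^+ 2 * M k) ->
  forall k, k%:R * h + h <= 1 / (2 * h) ->
  let y := 1 / (2 * h) - k.+1%:R * h in
  `|M k.+1 - (E y - h * A 3 y / 12)| <= 600 * h ^+ 2 * E y ^+ 3.
Proof.
move=> h0 h36 rec.
have nat_ge0 n : (0 : R) <= n%:R by exact: ler0n.
have step k a b : k%:R * h + h <= 1 / (2 * h) ->
    let y := 1 / (2 * h) - k.+1%:R * h in
    2 * k%:R * h ^+ 2 * `|a - (E (y + h) - h * A 3 (y + h) / 12)|
      <= 2 * k%:R * h ^+ 2 * (600 * h ^+ 2 * E (y + h) ^+ 3) ->
    b = 2 * h + 2 * k%:R * h ^+ 2 * a ->
    `|b - (E y - h * A 3 y / 12)| <= 600 * h ^+ 2 * E y ^+ 3.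
  move=> kh y; have y0 : 0 <= y by rewrite /y -[k.+1%:R]natr1; move: (1 / (2 * h)) kh => X kh; lra.
  (* [y + h] is the grid point [(x - k) h], where [x = 1 / (2 h^2)]. *)
  have c : 2 * k%:R * h ^+ 2 = 1 - 2 * h * (y + h).
    by rewrite /y -[k.+1%:R]natr1; field; exact: lt0r_neq0.
  have c0 : 0 <= 2 * k%:R * h ^+ 2 by rewrite mulr_ge0 ?sqr_ge0 // mulr_ge0.
  have h1 : h <= 1 by lra.
  have hh := ltW h0.
  rewrite c in c0 *; clear c.
  have r := residual y0 hh h1 c0; have q := cube_step y0 hh h36.
  set c := 1 - _ in c0 r q *.
  set U := E y - h * A 3 y / 12 in r *.
  set V := E (y + h) - _ in r *.
  move=> hb ->.
  have -> : 2 * h + c * a - U = c * (a - V) - (U - 2 * h - c * V) by ring.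
  apply: le_trans (ler_normB _ _) _; rewrite normrM (ger0_norm c0).
  have q2 : 600 * h ^+ 2 * (h * E y ^+ 2 / 2) <=
      600 * h ^+ 2 * (E y ^+ 3 - c * E (y + h) ^+ 3).
    by apply: ler_wpM2l q; apply: mulr_ge0; [lra|exact: sqr_ge0].
  by lra.
elim=> [|k IH] kh.
  have := step 0%N (M 0%N) (M 1%N) kh; rewrite /=; apply; last exact: rec.
  by rewrite !mulr0 !mul0r.
apply: (step k.+1 (M k.+1)) (rec _) => //.
apply: ler_wpM2l; first by rewrite mulr_ge0 ?sqr_ge0 // mulr_ge0.
have -> : 1 / (2 * h) - k.+2%:R * h + h = 1 / (2 * h) - k.+1%:R * h by rewrite -[k.+2%:R]natr1; ring.
by apply: IH; move: kh; rewrite -[k.+1%:R]natr1; move: (1 / (2 * h)) => X; lra.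
Qed.

(** Relative to [E] the deviation is [- h A3 / (12 E)] up to [O(h^2 E^2)], because
[A3] is [O(E^2)] and the cubic bound of [left_comparison] leaves [E^2] after the
division. *)
Lemma ln_left_approx h y M : 0 < h -> h <= 1/2400 -> 0 <= y ->
  `|M - (E y - h * A 3 y / 12)| <= 600 * h ^+ 2 * E y ^+ 3 ->
  0 < M /\ `|ln M - (ln (E y) - h * A 3 y / (12 * E y))| <= 616 * h ^+ 2 * E y ^+ 2.
Proof.
move=> h0 hs y0 hM; have e0 := E_gt0 y; have e2 := E_le2 y0.
have a1 := A1_le y0; have a3 := A3_le4 y0; have a3p := A_gt0 3 y.
pose rho := (M - (E y - h * A 3 y / 12)) / E y.
pose v := h * A 3 y / (12 * E y).
pose u := rho - v.
have ME : M = E y * (1 + u).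
  by rewrite /u /rho /v; field; exact: lt0r_neq0.
have hr : `|rho| <= 600 * h ^+ 2 * E y ^+ 2.
  rewrite /rho normrM [`|(E y)^-1|]ger0_norm ?invr_ge0 ?(ltW e0) //.
  by rewrite ler_pdivrMr // -[leRHS]mulrA -exprSr.
have hv : 0 <= v <= 3 * h * E y.
  rewrite /v; apply/andP; split.
    by rewrite divr_ge0 // mulr_ge0 //; exact: ltW.
  rewrite ler_pdivrMr; last by lra.
  have : h * A 3 y <= h * (36 * E y ^+ 2) by apply: ler_wpM2l; [exact: ltW|lra].
  by rewrite expr2; lra.
have hru : `|rho| <= h * E y.
  apply: le_trans hr _.
  have : 600 * h ^+ 2 * E y ^+ 2 = (h * E y) * (600 * h * E y) by ring.
  move=> ->; rewrite -[leRHS]mulr1; apply: ler_wpM2l.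
    by rewrite mulr_ge0 ?ltW.
  have : h * E y <= 1/2400 * 2 by apply: ler_pM => //; exact: ltW.
  lra.
have hu : `|u| <= 4 * (h * E y).
  apply: le_trans (ler_normB _ _) _; rewrite [`|v|]ger0_norm; case/andP: hv => //; lra.
have hu2 : `|u| <= 1/2.
  apply: le_trans hu _.
  have : h * E y <= 1/2400 * 2 by apply: ler_pM => //; exact: ltW.
  lra.
have u1 : 0 < 1 + u by move: hu2; clear; rewrite ler_norml => /andP[]; lra.
split; first by rewrite ME mulr_gt0.
rewrite ME lnM ?posrE //.
have -> : ln (E y) + ln (1 + u) - (ln (E y) - h * A 3 y / (12 * E y)) =
  (ln (1 + u) - u) + rho by rewrite /u -/v; ring.
apply: le_trans (ler_normD _ _) _.
have l := ln1D_approx hu2.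
have : u ^+ 2 <= (4 * (h * E y)) ^+ 2.
  by rewrite -[u ^+ 2]real_normK ?num_real // lerXn2r ?nnegrE //; apply: le_trans hu.
have -> : (4 * (h * E y)) ^+ 2 = 16 * h ^+ 2 * E y ^+ 2 by ring.
by clear -l hr; lra.
Qed.

End LeftComparison.

(** * Summation of the logarithms of Mills ratios *)

Section LeftSum.
Variable R : realType.
Implicit Types (y h x : R).

(** Taylor expansions of the antiderivative to both sides of the centre: the terms of
even order cancel. *)
Lemma midpoint (F f f1 f2 : R -> R) y d B : 0 <= d ->
  (forall t, y - d <= t <= y + d -> dv F t (f t)) ->
  (forall t, y - d <= t <= y + d -> dv f t (f1 t)) ->
  (forall t, y - d <= t <= y + d -> dv f1 t (f2 t)) ->
  (forall t, y - d <= t <= y + d -> `|f2 t| <= B) ->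
  `|F (y + d) - F (y - d) - 2 * d * f y| <= B * d ^+ 3 / 3.
Proof.
move=> d0 dF df df1 bf2.
pose G i := match i with 0 => F | 1 => f | 2 => f1 | _ => f2 end.
have near (t e : R) : `|e| <= d -> `|t - y| <= `|e| -> y - d <= t <= y + d.
  by move=> h1; rewrite !ler_norml => h2; lra.
have T e : `|e| <= d -> `|F (y + e) - (F y + f y * e + f1 y * e ^+ 2 / 2)|
    <= B * `|e| ^+ 3 / 6.
  move=> ed; have := @taylor R G 3 y B e.
  rewrite !big_ord_recr big_ord0 /= add0r !expr0 expr1.
  have -> : 3`!%:R = 6 :> R by [].
  have -> : 2`!%:R = 2 :> R by [].
  have -> : 1`!%:R = 1 :> R by [].
  rewrite mulr1 !divr1; apply.
    move=> i x i3 xy; have xn := near _ _ ed xy.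
    by case: i i3 => [|[|[|]]] //= _; [exact: dF|exact: df|exact: df1].
  by move=> x xy; apply: bf2; exact: near ed xy.
have t1 := T d; have t2 := T (- d).
rewrite normrN in t2; rewrite ger0_norm // in t1 t2.
have {}t1 := t1 (lexx d); have {}t2 := t2 (lexx d).
rewrite sqrrN in t2.
have -> : F (y + d) - F (y - d) - 2 * d * f y =
  (F (y + d) - (F y + f y * d + f1 y * d ^+ 2 / 2)) -
  (F (y - d) - (F y + f y * - d + f1 y * d ^+ 2 / 2)) by ring.
by apply: le_trans (ler_normB _ _) _; lra.
Qed.

Lemma midpoint1 (F f f1 : R -> R) y d B : 0 <= d ->
  (forall t, y - d <= t <= y + d -> dv F t (f t)) ->
  (forall t, y - d <= t <= y + d -> dv f t (f1 t)) ->
  (forall t, y - d <= t <= y + d -> `|f1 t| <= B) ->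
  `|F (y + d) - F (y - d) - 2 * d * f y| <= B * d ^+ 2.
Proof.
move=> d0 dF df bf1.
pose G i := match i with 0 => F | 1 => f | _ => f1 end.
have near (t e : R) : `|e| <= d -> `|t - y| <= `|e| -> y - d <= t <= y + d.
  by move=> h1; rewrite !ler_norml => h2; lra.
have T e : `|e| <= d -> `|F (y + e) - (F y + f y * e)| <= B * `|e| ^+ 2 / 2.
  move=> ed; have := @taylor R G 2 y B e.
  rewrite !big_ord_recr big_ord0 /= add0r !expr0 expr1.
  have -> : 2`!%:R = 2 :> R by [].
  have -> : 1`!%:R = 1 :> R by [].
  rewrite mulr1 !divr1; apply.
    move=> i x i3 xy; have xn := near _ _ ed xy.
    by case: i i3 => [|[|[|]]] //= _; [exact: dF|exact: df].
  by move=> x xy; apply: bf1; exact: near ed xy.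
have t1 := T d; have t2 := T (- d).
rewrite normrN in t2; rewrite ger0_norm // in t1 t2.
have {}t1 := t1 (lexx d); have {}t2 := t2 (lexx d).
have -> : F (y + d) - F (y - d) - 2 * d * f y =
  (F (y + d) - (F y + f y * d)) - (F (y - d) - (F y + f y * - d)) by ring.
by apply: le_trans (ler_normB _ _) _; lra.
Qed.

Lemma dv_A n y : dv (@A R n) y (- A n.+1 y).
Proof.
have -> : @A R n = fun y : R => (-1) ^+ n * Ed n y by apply/funext => t; rewrite AE.
apply: dv_eq; first by apply: dvM (dvC _ _) (dv_Ed n y).
by rewrite AE exprS; ring.
Qed.

Lemma dv_E' y : dv (@E R) y (- A 1 y).
Proof. by apply: dv_eq; first exact: dv_E; rewrite A1E; ring. Qed.

(** With its derivatives [lnE1], [lnE2], the leading term of the logarithm of the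
Mills ratio. *)
Definition lnE y := ln (E y).
Definition lnE1 y := - (A 1 y / E y).
Definition lnE2 y := A 2 y / E y - (A 1 y / E y) ^+ 2.
(** The coefficient of [h] in the logarithm of the Mills ratio. *)
Definition corrL y := - (A 3 y / (12 * E y)).
Definition corrL1 y := A 4 y / (12 * E y) - A 3 y * A 1 y / (12 * E y ^+ 2).

Lemma dv_lnE y : dv lnE y (lnE1 y).
Proof.
apply: dv_eq; first exact: (dvL (E_gt0 y) (dv_E' y)).
by rewrite /lnE1; ring.
Qed.

Lemma dv_lnE1 y : dv lnE1 y (lnE2 y).
Proof.
have e := lt0r_neq0 (E_gt0 y).
apply: dv_eq; first exact: (dvN (dvM (dv_A 1 y) (dvV e (dv_E' y)))).
by rewrite /lnE2; field.
Qed.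

Lemma dv_corrL y : dv corrL y (corrL1 y).
Proof.
have e := lt0r_neq0 (E_gt0 y).
have e' : 12 * E y != 0 by apply: lt0r_neq0; have := E_gt0 y; lra.
apply: dv_eq.
  apply: dvN; apply: dvM (dv_A 3 y) _.
  exact: (@dvV _ (fun y => 12 * E y) _ _ e' (dvM (dvC _ _) (dv_E' y))).
by rewrite /corrL1; field.
Qed.

Lemma lnE2_bound y : 0 <= y -> `|lnE2 y| <= 126 * E y ^+ 2.
Proof.
move=> y0; have e0 := E_gt0 y.
have h1 : 0 <= A 2 y / E y <= 45 * E y ^+ 2.
  apply/andP; split; first by apply: divr_ge0; apply/ltW; [exact: A_gt0|exact: e0].
  by rewrite ler_pdivrMr // -mulrA -exprSr A2_le.
have h2 : 0 <= A 1 y / E y <= 9 * E y.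
  apply/andP; split; first by apply: divr_ge0; apply/ltW; [exact: A_gt0|exact: e0].
  by rewrite ler_pdivrMr // -mulrA -expr2 A1_le.
have h3 : (A 1 y / E y) ^+ 2 <= 81 * E y ^+ 2.
  have -> : 81 * E y ^+ 2 = (9 * E y) ^+ 2 by ring.
  by case/andP: h2 => a b; rewrite lerXn2r ?nnegrE //; lra.
by rewrite /lnE2 ler_norml; have := sqr_ge0 (A 1 y / E y); lra.
Qed.

Lemma corrL_bound y : 0 <= y -> `|corrL y| <= 12 * E y ^+ 2.
Proof.
move=> y0; have e0 := E_gt0 y.
rewrite /corrL normrN ger0_norm; last first.
  by apply: divr_ge0; [exact/ltW/A_gt0|lra].
rewrite ler_pdivrMr; last by lra.
by have := A3_le y0; rewrite [E y ^+ 3]exprS; have := sqr_ge0 (E y); nra.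
Qed.

Lemma corrL1_bound y : 0 <= y -> `|corrL1 y| <= 225 * E y ^+ 2.
Proof.
move=> y0; have e0 := E_gt0 y; have e2 := E_le2 y0.
have a4 := A_gt0 4 y; have a3 := A_gt0 3 y; have a1 := A_gt0 1 y.
have h1 : 0 <= A 4 y / (12 * E y) <= 45/2 * E y ^+ 2.
  apply/andP; split; first by apply: divr_ge0; lra.
  rewrite ler_pdivrMr; last by lra.
  have := A4_le y0; have := A2_le y0; rewrite exprS; lra.
have h2 : 0 <= A 3 y * A 1 y / (12 * E y ^+ 2) <= 405/2 * E y ^+ 2.
  have e20 : 0 < E y ^+ 2 by exact: exprn_gt0.
  apply/andP; split.
    by apply: divr_ge0; [apply: mulr_ge0; exact: ltW|lra].
  rewrite ler_pdivrMr; last by lra.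
  apply: le_trans (_ : (135 * E y ^+ 3) * (9 * E y ^+ 2) <= _).
    by apply: ler_pM; rewrite ?A3_le ?A1_le //; lra.
  have -> : (135 * E y ^+ 3) * (9 * E y ^+ 2) = 1215 * E y * (E y ^+ 2 * E y ^+ 2) by ring.
  have -> : 405/2 * E y ^+ 2 * (12 * E y ^+ 2) = 2430 * (E y ^+ 2 * E y ^+ 2) by field.
  by apply: ler_wpM2r; [rewrite mulr_ge0 // ltW|lra].
by rewrite /corrL1 ler_norml; lra.
Qed.

Lemma left_log : exists C hs : R, [/\ 0 <= C, 0 < hs, hs <= 1 &
  forall h (M : nat -> R), 0 < h -> h <= hs ->
  (forall k, M k.+1 = 2 * h + 2 * k%:R * h ^+ 2 * M k) ->
  forall k, k%:R * h + h <= 1 / (2 * h) ->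
  let y := 1 / (2 * h) - k.+1%:R * h in
  0 < M k.+1 /\ `|ln (M k.+1) - (lnE y + h * corrL y)| <= C * h ^+ 2 * E y ^+ 2].
Proof.
exists 616, (1/2400); split; [lra|lra|lra|].
move=> h M h0 hs rec k hk y.
have h36 : h <= 1/36 by lra.
have y0 : 0 <= y.
  by rewrite /y -[k.+1%:R]natr1; move: (1 / (2 * h)) hk => X hk; clear -hk; lra.
have [-> lM] := ln_left_approx h0 hs y0 (left_comparison h0 h36 rec hk).
split=> //; rewrite /lnE /corrL.
have -> : h * - (A 3 y / (12 * E y)) = - (h * A 3 y / (12 * E y)).
  by field; rewrite lt0r_neq0 // E_gt0.
exact: lM.
Qed.

(** The error of each step, from [ln_left_approx] and from the midpoint rule, is
[O(h^2 E^2)], hence by [A1_ge] at most a multiple of [h] times the decrease of [E]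
over a neighbouring step: the errors telescope to [O(h)].  The distance [2 h] kept from the
origin leaves room for evaluating [E] one and two steps further left. *)
Lemma left_sum : exists C hs : R, [/\ 0 <= C, 0 < hs, hs <= 1 &
  forall h (M : nat -> R) (IL IQ : R -> R), 0 < h -> h <= hs ->
  (forall y, dv IL y (lnE y)) -> (forall y, dv IQ y (corrL y)) ->
  (forall k, M k.+1 = 2 * h + 2 * k%:R * h ^+ 2 * M k) ->
  forall N, N%:R * h + 2 * h <= 1 / (2 * h) ->
  let Y := 1 / (2 * h) - h / 2 in let y := Y - N%:R * h in
  (forall k, (k < N)%N -> 0 < M k.+1) /\
  `|\sum_(k < N) ln (M k.+1) - ((IL Y - IL y) / h + (IQ Y - IQ y))| <= C * h].
Proof.
have [C [hs [C0 hs0 hs1 left]]] := left_log.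
exists (14 * (C + 64)), hs; split => //; first by lra.
move=> h M IL IQ h0 hhs dIL dIQ rec N hN Y y.
have {}left := left h M h0 hhs rec.
have {hhs hs0 hs1} h1 : h <= 1 by lra.
have hn := lt0r_neq0 h0; have h0' := ltW h0.
set X := 1 / (2 * h) in hN Y y left *.
(* The telescoped form of the bound, suited to induction on [N]. *)
suff [H1 H2] : (forall k, (k < N)%N -> 0 < M k.+1) /\
  `|\sum_(k < N) ln (M k.+1) - ((IL Y - IL y) / h + (IQ Y - IQ y))|
    <= 7 * (C + 64) * h * (E (X - N%:R * h - 2 * h) - E (X - 2 * h)).
  split=> //; apply: le_trans H2 _.
  have z0 : 0 <= X - N%:R * h - 2 * h by lra.
  have e2 := E_le2 z0; have e0 := E_gt0 (X - 2 * h).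
  have -> : 14 * (C + 64) * h = 7 * (C + 64) * h * 2 by ring.
  by apply: ler_wpM2l; [apply: mulr_ge0 => //; lra|lra].
rewrite {}/y; elim: N hN => [|N IH] hN.
  split=> //; rewrite big_ord0 mul0r !subr0 !subrr mul0r addr0 subrr normr0.
  by rewrite mulr0.
have hN' : N%:R * h + 2 * h <= X by move: hN; rewrite -[N.+1%:R]natr1; lra.
have [IH1 IH2] := IH hN'.
have hk : N%:R * h + h <= X by lra.
have [M0 lM] := left N hk.
split.
  by move=> k; rewrite ltnS leq_eqVlt => /orP[/eqP ->//|/IH1].
pose z := X - N.+1%:R * h; rewrite -/z in lM.
have z2 : 0 <= z - 2 * h by rewrite /z; lra.
have zN : z = X - N%:R * h - h by rewrite /z -[N.+1%:R]natr1; ring.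
have zY : z + h / 2 = Y - N%:R * h by rewrite zN /Y; field.
have zY' : z - h / 2 = Y - N.+1%:R * h by rewrite /z /Y; field.
have ze : X - N.+1%:R * h - 2 * h = z - 2 * h by rewrite /z.
have ze' : X - N%:R * h - 2 * h = z - h by rewrite zN; ring.
rewrite ze' -zY in IH2; rewrite ze -zY' big_ord_recr /=.
clear IH IH1 zY zY' ze ze' hN hN' hk left rec.
clearbody z Y X; clear zN.
have z0 : 0 <= z by lra.
have e1 := E_gt0 (z - h).
have int t : z - h / 2 <= t <= z + h / 2 -> 0 <= t /\ E t ^+ 2 <= E (z - h) ^+ 2.
  move=> tz; split; first by lra.
  by rewrite lerXn2r ?nnegrE ?(ltW (E_gt0 _)) // E_decr //; lra.
have hd : 0 <= h / 2 by lra.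
have mL : `|IL (z + h / 2) - IL (z - h / 2) - 2 * (h / 2) * lnE z| <=
   126 * E (z - h) ^+ 2 * (h / 2) ^+ 3 / 3.
  apply: (midpoint hd (fun t _ => dIL t) (fun t _ => dv_lnE t) (fun t _ => dv_lnE1 t)).
  move=> t tz; have [t0 te] := int t tz.
  by apply: le_trans (lnE2_bound t0) _; apply: ler_wpM2l te; lra.
have mQ : `|IQ (z + h / 2) - IQ (z - h / 2) - 2 * (h / 2) * corrL z| <=
   225 * E (z - h) ^+ 2 * (h / 2) ^+ 2.
  apply: (midpoint1 hd (fun t _ => dIQ t) (fun t _ => dv_corrL t)).
  move=> t tz; have [t0 te] := int t tz.
  by apply: le_trans (corrL1_bound t0) _; apply: ler_wpM2l te; lra.
have ez : E z ^+ 2 <= E (z - h) ^+ 2.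
  by rewrite lerXn2r ?nnegrE ?(ltW (E_gt0 _)) // E_decr //; lra.
set W := h ^+ 2 * E (z - h) ^+ 2.
have W0 : 0 <= W by apply: mulr_ge0; exact: sqr_ge0.
have {}lM : `|ln (M N.+1) - (lnE z + h * corrL z)| <= C * W.
  apply: le_trans lM _; rewrite -mulrA; apply: ler_wpM2l => //.
  by apply: ler_wpM2l => //; exact: sqr_ge0.
have {}mL : `|(IL (z + h / 2) - IL (z - h / 2)) / h - lnE z| <= 6 * W.
  have -> : (IL (z + h / 2) - IL (z - h / 2)) / h - lnE z =
    (IL (z + h / 2) - IL (z - h / 2) - 2 * (h / 2) * lnE z) / h by field.
  rewrite normrM [`|h^-1|]ger0_norm ?invr_ge0 // ler_pdivrMr //.
  apply: le_trans mL _.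
  have hW : 0 <= h * W by exact: mulr_ge0.
  have -> : 126 * E (z - h) ^+ 2 * (h / 2) ^+ 3 / 3 = 21/4 * (h * W) by rewrite /W; field.
  by clear -hW; lra.
have {}mQ : `|IQ (z + h / 2) - IQ (z - h / 2) - 2 * (h / 2) * corrL z| <= 58 * W.
  apply: le_trans mQ _.
  have -> : 225 * E (z - h) ^+ 2 * (h / 2) ^+ 2 = 225/4 * W by rewrite /W; field.
  by clear -W0; lra.
have tot : `|ln (M N.+1) - ((IL (z + h / 2) - IL (z - h / 2)) / h +
    (IQ (z + h / 2) - IQ (z - h / 2)))| <= (C + 64) * W.
  have -> : ln (M N.+1) - ((IL (z + h / 2) - IL (z - h / 2)) / h +
    (IQ (z + h / 2) - IQ (z - h / 2))) =
    (ln (M N.+1) - (lnE z + h * corrL z)) -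
    ((IL (z + h / 2) - IL (z - h / 2)) / h - lnE z) -
    (IQ (z + h / 2) - IQ (z - h / 2) - 2 * (h / 2) * corrL z).
    by field.
  apply: le_trans (ler_normB _ _) _; apply: le_trans (lerD (ler_normB _ _) (lexx _)) _.
  by clear -lM mL mQ; lra.
(* The increment of [E] on [[z - 2 h, z - h]] is at least [h A1 (z - h)], and
   [W = h^2 E (z - h)^2 <= 7 h^2 A1 (z - h)]. *)
have tel : (C + 64) * W <= 7 * (C + 64) * h * (E (z - 2 * h) - E (z - h)).
  have zh : 0 <= z - h by lra.
  have a := A1_ge zh; have := E_step (z - 2 * h) h0'.
  have -> : z - 2 * h + h = z - h by ring.
  move=> /andP[b _].
  have -> : 7 * (C + 64) * h * (E (z - 2 * h) - E (z - h)) =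
    (C + 64) * (7 * h * (E (z - 2 * h) - E (z - h))) by ring.
  apply: ler_wpM2l; first by lra.
  apply: le_trans (_ : h ^+ 2 * (7 * A 1 (z - h)) <= _).
    by apply: ler_wpM2l a; exact: sqr_ge0.
  have -> : h ^+ 2 * (7 * A 1 (z - h)) = 7 * h * (h * A 1 (z - h)) by ring.
  by apply: ler_wpM2l b; lra.
set S := \sum_(i < N) _ in IH2 *.
have -> : S + ln (M N.+1) - ((IL Y - IL (z - h / 2)) / h + (IQ Y - IQ (z - h / 2)))
  = (S - ((IL Y - IL (z + h / 2)) / h + (IQ Y - IQ (z + h / 2)))) +
    (ln (M N.+1) - ((IL (z + h / 2) - IL (z - h / 2)) / h +
       (IQ (z + h / 2) - IQ (z - h / 2)))) by field.
apply: le_trans (ler_normD _ _) _.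
clear -IH2 tel tot; set P := 7 * (C + 64) * h in IH2 tel *.
by lra.
Qed.

End LeftSum.

(** * A difference operator and its barrier *)

Section Decay.
Variable R : realType.
Implicit Types (y t h : R) (f g : R -> R).

(** The derivative of the arc tangent: an integrable majorant, and the barrier of the
maximum principle. *)
Definition D t : R := (1 + t ^+ 2)^-1.

Lemma D_gt0 t : 0 < D t.
Proof. by rewrite invr_gt0 ltr_pwDl // sqr_ge0. Qed.

Lemma D_neq0 t : 1 + t ^+ 2 != 0.
Proof. by apply: lt0r_neq0; have := sqr_ge0 t; lra. Qed.

Lemma DV t : (1 + t ^+ 2) * D t = 1.
Proof. by rewrite mulfV // D_neq0. Qed.

Lemma D_le1 t : D t <= 1.
Proof. by have := DV t; have := D_gt0 t; have := sqr_ge0 t; nra. Qed.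

Lemma tD_le t : `|t| * D t <= 1/2.
Proof.
have h : 0 <= (1 - `|t|) ^+ 2 by exact: sqr_ge0.
have := DV t; have := D_gt0 t; rewrite -[t ^+ 2]real_normK ?num_real //; nra.
Qed.

Lemma D_shift y t : `|t - y| <= 1 -> D t <= 3 * D y.
Proof.
move=> ty.
have h : 1 + y ^+ 2 <= 3 * (1 + t ^+ 2).
  have : (t - y) ^+ 2 <= 1.
    by rewrite -[(t - y) ^+ 2]real_normK ?num_real // expr_le1.
  by have := sqr_ge0 (t + (t - y)); have := sqr_ge0 t; lra.
rewrite /D -[leRHS]/(3 / (1 + y ^+ 2)) ler_pdivlMr; last first.
  by have := sqr_ge0 y; lra.
by rewrite mulrC ler_pdivrMr //; have := sqr_ge0 t; lra.
Qed.

Definition decays f := exists2 c : R, 0 <= c & forall t, `|f t| <= c * D t ^+ 2.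

Lemma decaysD f g : decays f -> decays g -> decays (fun t => f t + g t).
Proof.
move=> [c c0 hc] [d d0 hd]; exists (c + d); first exact: addr_ge0.
move=> t; apply: le_trans (ler_normD _ _) _.
by rewrite mulrDl; apply: lerD.
Qed.

Lemma decaysZ (a : R) f : decays f -> decays (fun t => a * f t).
Proof.
move=> [c c0 hc]; exists (`|a| * c); first exact: mulr_ge0.
by move=> t; rewrite normrM -mulrA; apply: ler_wpM2l.
Qed.

Lemma decays_ext f g : (forall t, f t = g t) -> decays f -> decays g.
Proof. by move=> e [c c0 hc]; exists c => // t; rewrite -e. Qed.

Lemma decays_gauss (n : nat) : decays (fun t => t ^+ n * gauss t).
Proof.
pose c : R := 2 * (1 + n`!%:R + 2 + (n + 2)`!%:R).
have ev (m : nat) t : 0 <= (t ^+ 2) ^+ m * gauss t <= m`!%:R.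
  apply/andP; split; first exact: mulr_ge0 (exprn_ge0 _ (sqr_ge0 _)) (ltW (gauss_gt0 _)).
  by rewrite -exprM; exact: gauss_mul.
have key t : (1 + t ^+ 2) ^+ 2 * (`|t| ^+ n * gauss t) <= c.
  set s := t ^+ 2; have s0 : 0 <= s by exact: sqr_ge0.
  have g0 := gauss_gt0 t.
  have h1 : (1 + s) ^+ 2 <= 2 * (1 + s ^+ 2) by have := sqr_ge0 (1 - s); lra.
  have h2 : `|t| ^+ n <= 1 + s ^+ n.
    have -> : s ^+ n = (`|t| ^+ n) ^+ 2.
      by rewrite -exprM mulnC exprM real_normK ?num_real.
    by set z := `|t| ^+ n; have := sqr_ge0 (1 - z); have := sqr_ge0 z; lra.
  apply: le_trans (_ : (2 * (1 + s ^+ 2)) * ((1 + s ^+ n) * gauss t) <= _).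
    apply: ler_pM => //; first exact: sqr_ge0.
      by apply: mulr_ge0 (ltW g0); exact: exprn_ge0.
    exact: ler_wpM2r (ltW g0) _ _ h2.
  have -> : 2 * (1 + s ^+ 2) * ((1 + s ^+ n) * gauss t) =
    2 * (gauss t + s ^+ n * gauss t + s ^+ 2 * gauss t + s ^+ (n + 2) * gauss t).
    by rewrite exprD; ring.
  have := ev 0%N t; have := ev n t; have := ev 2%N t; have := ev (n + 2)%N t.
  rewrite -/s expr0 mul1r /c fact0 => /andP[_ a1] /andP[_ a2] /andP[_ a3] /andP[_ a4].
  apply: ler_wpM2l => //; do ![apply: lerD => //].
exists c.
  have := key 0; apply: le_trans; apply: mulr_ge0; first exact: sqr_ge0.
  by apply: mulr_ge0 (ltW (gauss_gt0 _)); exact: exprn_ge0.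
move=> t; rewrite normrM normrX (ger0_norm (ltW (gauss_gt0 t))).
have := key t; have d0 := D_gt0 t => h.
have : D t ^+ 2 * ((1 + t ^+ 2) ^+ 2 * (`|t| ^+ n * gauss t)) <= D t ^+ 2 * c.
  by apply: ler_wpM2l => //; exact: sqr_ge0.
by rewrite mulrA -exprMn [D t * _]mulrC DV expr1n mul1r [D t ^+ 2 * _]mulrC.
Qed.

Definition chain (F : nat -> R -> R) := forall i y, (i < 4)%N -> dv (F i) y (F i.+1 y).

(** Let [2 h^2 x = 1] and [y = (x - k) h].  Since [1 - 2 h y = 2 k h^2 = k / x], the
operator annihilates a function [f] on the grid exactly when the increments of
[k -> f ((x - k) h)] are in the ratio [k / x] of successive Poisson masses. *)
Definition recop h y f := f (y - h) + f (y + h) - 2 * f y - 2 * h * y * (f (y - h) - f y).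

(** To leading order the operator is [h^2 (f'' + 2 y f')], which annihilates [erfc]. *)
Lemma recop_taylor F h y B3 B4 : chain F -> 0 <= h ->
  (forall t, `|t - y| <= h -> `|F 3%N t| <= B3) ->
  (forall t, `|t - y| <= h -> `|F 4%N t| <= B4) ->
  `|recop h y (F 0%N) - h ^+ 2 * (F 2%N y + 2 * y * F 1%N y - h * y * F 2%N y)|
    <= h ^+ 4 * (B4 / 12 + `|y| * B3 / 3).
Proof.
move=> dF h0 b3 b4.
have T3 : `|F 0%N (y - h) - (F 0%N y - F 1%N y * h + F 2%N y * h ^+ 2 / 2)| <= B3 * h ^+ 3 / 6.
  have := @taylor R F 3 y B3 (- h); rewrite !normrN (ger0_norm h0).
  rewrite !big_ord_recr big_ord0 /= add0r !expr0 expr1 sqrrN.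
  have -> : 3`!%:R = 6 :> R by [].
  have -> : 2`!%:R = 2 :> R by [].
  have -> : 1`!%:R = 1 :> R by [].
  rewrite mulr1 !divr1 mulrN; apply => //.
  by move=> i x i3 _; apply: dF; exact: leq_trans i3 _.
have T4 e : `|e| = h -> `|F 0%N (y + e) - (F 0%N y + F 1%N y * e + F 2%N y * e ^+ 2 / 2
    + F 3%N y * e ^+ 3 / 6)| <= B4 * h ^+ 4 / 24.
  move=> eh; have := @taylor R F 4 y B4 e; rewrite eh.
  rewrite !big_ord_recr big_ord0 /= add0r !expr0 expr1.
  have -> : 4`!%:R = 24 :> R by [].
  have -> : 3`!%:R = 6 :> R by [].
  have -> : 2`!%:R = 2 :> R by [].
  have -> : 1`!%:R = 1 :> R by [].
  rewrite mulr1 !divr1; apply => //.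
  by move=> i x i3 _; exact: dF.
have t1 := T4 h (ger0_norm h0); have t2 := T4 (- h).
rewrite normrN (ger0_norm h0) in t2; have {}t2 := t2 erefl.
rewrite /recop.
set e1 := (X in `|X| <= _) in t1; set e2 := (X in `|X| <= _) in t2.
set e3 := (X in `|X| <= _) in T3.
have -> : F 0%N (y - h) + F 0%N (y + h) - 2 * F 0%N y - 2 * h * y * (F 0%N (y - h) - F 0%N y)
  - h ^+ 2 * (F 2%N y + 2 * y * F 1%N y - h * y * F 2%N y) = e1 + e2 - 2 * h * y * e3.
  by rewrite /e1 /e2 /e3; field.
apply: le_trans (ler_normB _ _) _; apply: le_trans (lerD (ler_normD _ _) (lexx _)) _.
have -> : `|2 * h * y * e3| = 2 * h * `|y| * `|e3| by rewrite !normrM (ger0_norm h0) ger0_norm.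
have : 2 * h * `|y| * `|e3| <= 2 * h * `|y| * (B3 * h ^+ 3 / 6).
  by apply: ler_wpM2l => //; rewrite !mulr_ge0.
by lra.
Qed.

(** The first four derivatives of [D]. *)
Definition Dd i : R -> R :=
  match i with
  | 0 => D | 1 => fun y => - (2 * y * D y ^+ 2)
  | 2 => fun y => (6 * y ^+ 2 - 2) * D y ^+ 3
  | 3 => fun y => 24 * (y - y ^+ 3) * D y ^+ 4
  | _ => fun y => 24 * (5 * y ^+ 4 - 10 * y ^+ 2 + 1) * D y ^+ 5
  end.

Lemma chain_D : chain Dd.
Proof.
have dD y : dv D y (- (2 * y * D y ^+ 2)).
  apply: dv_eq; first by apply: dvV; [exact: D_neq0 | exact: (dvD (dvC _ _) (dvX 2 (dvI _)))].
  by rewrite /= /D expr1; ring.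
move=> i y; case: i => [|[|[|[|i]]]] hi.
- exact: dD.
- apply: dv_eq; first exact: (dvN (dvM (dvM (dvC _ _) (dvI _)) (dvX 2 (dD y)))).
  by rewrite /Dd /D /=; have := D_neq0 y => h; field.
- apply: dv_eq.
    exact: (dvM (dvD (dvM (dvC _ _) (dvX 2 (dvI _))) (dvN (dvC _ _))) (dvX 3 (dD y))).
  by rewrite /Dd /D /=; have := D_neq0 y => h; field.
- apply: dv_eq.
    exact: (dvM (dvM (dvC _ _) (dvD (dvI _) (dvN (dvX 3 (dvI _))))) (dvX 4 (dD y))).
  by rewrite /Dd /D /=; have := D_neq0 y => h; field.
- by [].
Qed.

End Decay.

Section Barrier.
Variable R : realType.
Implicit Types (y t h : R).
Local Notation D := (@D R).

Lemma D2_le t : t ^+ 2 * D t <= 1.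
Proof. by have := DV t; have := D_gt0 t; lra. Qed.

Lemma Dd3_le t : `|Dd 3 t| <= 24 * D t ^+ 2.
Proof.
rewrite /Dd /=.
have -> : 24 * (t - t ^+ 3) * D t ^+ 4 = 24 * (t * D t) * ((1 - t ^+ 2) * D t) * D t ^+ 2 by ring.
rewrite normrM [`|D t ^+ 2|]ger0_norm ?sqr_ge0 //; apply: ler_wpM2r; first exact: sqr_ge0.
have h1 : `|t * D t| <= 1.
  by rewrite normrM (ger0_norm (ltW (D_gt0 t))); have := tD_le t; lra.
have h2 : `|(1 - t ^+ 2) * D t| <= 1.
  have := D2_le t; have := D_le1 t; have := D_gt0 t; have := sqr_ge0 t => a b c d.
  by rewrite ler_norml; apply/andP; split; nra.
rewrite normrM normrM (@ger0_norm _ 24) // -[leRHS]mulr1 -mulrA.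
have : `|t * D t| * `|(1 - t ^+ 2) * D t| <= 1 by apply: mulr_ile1.
by rewrite mulrA; lra.
Qed.

Lemma Dd4_le t : `|Dd 4 t| <= 240 * D t.
Proof.
rewrite /Dd /=; set d := D t; set s := t ^+ 2.
have d0 : 0 < d := D_gt0 t; have d1 : d <= 1 := D_le1 t.
have sd : s * d <= 1 := D2_le t; have s0 : 0 <= s := sqr_ge0 t.
have sd0 : 0 <= s * d by apply: mulr_ge0 => //; exact: ltW.
have -> : 24 * (5 * t ^+ 4 - 10 * s + 1) * d ^+ 5 =
  24 * (d * d * (5 * (s * d) ^+ 2 - 10 * (s * d) * d + d ^+ 2)) * d by rewrite /s; ring.
rewrite normrM (ger0_norm (ltW d0)); apply: ler_wpM2r; first exact: ltW.
have h1 : `|5 * (s * d) ^+ 2 - 10 * (s * d) * d + d ^+ 2| <= 10.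
  by rewrite ler_norml; apply/andP; split; nra.
rewrite !normrM (ger0_norm (ltW d0)) (@ger0_norm _ 24) //.
have : d * d * `|5 * (s * d) ^+ 2 - 10 * (s * d) * d + d ^+ 2| <= 1 * 10.
  by apply: ler_pM => //; [apply: mulr_ge0; exact: ltW|apply: mulr_ile1 => //; exact: ltW].
lra.
Qed.

Lemma yDd2_le t : `|t * Dd 2 t| <= 3 * D t.
Proof.
rewrite /Dd /=.
have -> : t * ((6 * t ^+ 2 - 2) * D t ^+ 3) = (t * D t) * ((6 * t ^+ 2 - 2) * D t) * D t by ring.
rewrite normrM (ger0_norm (ltW (D_gt0 t))); apply: ler_wpM2r; first exact/ltW/D_gt0.
rewrite normrM [`|t * D t|]normrM (ger0_norm (ltW (D_gt0 t))).
have h2 : `|(6 * t ^+ 2 - 2) * D t| <= 6.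
  have := D2_le t; have := D_le1 t; have := D_gt0 t; have := sqr_ge0 t => a b c d.
  by rewrite ler_norml; apply/andP; split; nra.
have -> : 3 = 1/2 * 6 :> R by field.
apply: ler_pM => //; last exact: tD_le.
by apply: mulr_ge0 => //; exact/ltW/D_gt0.
Qed.

(** The difference of the two sides is a multiple of [(5 t^2 - 3)^2]. *)
Lemma D_drift t : Dd 2 t + 2 * t * Dd 1 t <= - (7/8) * D t.
Proof.
rewrite /Dd /=.
have -> : - (7/8) * D t = - (7/8) * ((1 + t ^+ 2) * D t) ^+ 2 * D t by rewrite DV expr1n mulr1.
have -> : (6 * t ^+ 2 - 2) * D t ^+ 3 + 2 * t * - (2 * t * D t ^+ 2) =
  (6 * t ^+ 2 - 2) * D t ^+ 3 - 4 * t ^+ 2 * ((1 + t ^+ 2) * D t) * D t ^+ 2.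
  by rewrite DV; ring.
rewrite -subr_ge0.
have -> : - (7/8) * ((1 + t ^+ 2) * D t) ^+ 2 * D t - ((6 * t ^+ 2 - 2) * D t ^+ 3
   - 4 * t ^+ 2 * ((1 + t ^+ 2) * D t) * D t ^+ 2) =
   D t ^+ 3 * (25 * t ^+ 4 - 30 * t ^+ 2 + 9) / 8 by field.
have -> : 25 * t ^+ 4 - 30 * t ^+ 2 + 9 = (5 * t ^+ 2 - 3) ^+ 2 by ring.
by rewrite divr_ge0 // mulr_ge0 ?sqr_ge0 // exprn_ge0 // ltW // D_gt0.
Qed.

Lemma near_D h y t : 0 <= h -> h <= 1 -> `|t - y| <= h -> D t <= 3 * D y.
Proof. by move=> h0 h1 ty; apply: D_shift; exact: le_trans h1. Qed.

Lemma near_D2 h y t : 0 <= h -> h <= 1 -> `|t - y| <= h -> D t ^+ 2 <= 9 * D y ^+ 2.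
Proof.
move=> h0 h1 ty; have := near_D h0 h1 ty; have := D_gt0 t => a b.
have -> : 9 * D y ^+ 2 = (3 * D y) ^+ 2 by ring.
by have d := D_gt0 y; apply: lerXn2r; rewrite ?nnegrE; lra.
Qed.

(** By [D_drift] the leading part of [recop h y D] is at most [- (7/8) h^2 D], and the
other terms are smaller by a factor [h]. *)
Lemma recop_D : exists2 hs : R, 0 < hs &
  forall h y, 0 < h -> h <= hs -> recop h y D <= - (1/2) * h ^+ 2 * D y.
Proof.
pose c : R := 3 + 60 + 36.
exists ((3/8) / c); first by apply: divr_gt0; rewrite /c; lra.
move=> h y h0 hs.
have c0 : 0 < c by rewrite /c; lra.
have hc : h * c <= 3/8 by move: hs; rewrite ler_pdivlMr.
have h1 : h <= 1 by move: hc; rewrite /c; lra.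
have h0' := ltW h0; have d0 := D_gt0 y.
have := @recop_taylor R (@Dd R) h y (24 * (9 * D y ^+ 2)) (240 * (3 * D y)) (@chain_D R) h0'.
have b3 t : `|t - y| <= h -> `|Dd 3 t| <= 24 * (9 * D y ^+ 2).
  move=> ty; apply: le_trans (Dd3_le t) _.
  by have := near_D2 h0' h1 ty; lra.
have b4 t : `|t - y| <= h -> `|Dd 4 t| <= 240 * (3 * D y).
  move=> ty; apply: le_trans (Dd4_le t) _.
  by have := near_D h0' h1 ty; lra.
move=> /(_ b3 b4); rewrite -[Dd 0%N]/D ler_norml => /andP[_ up].
have dr := D_drift y; have yd2 := yDd2_le y; have td := tD_le y.
have u1 : `|y| * (24 * (9 * D y ^+ 2)) / 3 <= 36 * D y.
  have -> : `|y| * (24 * (9 * D y ^+ 2)) / 3 = 72 * (`|y| * D y) * D y by field.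
  by apply: ler_wpM2r; [exact: ltW|lra].
have u2 : - (y * Dd 2 y) <= 3 * D y by move: yd2; rewrite ler_norml => /andP[]; lra.
have u3 : h * (- (y * Dd 2 y)) <= h * (3 * D y) by apply: ler_wpM2l.
have u4 : h ^+ 2 * (Dd 2 y + 2 * y * Dd 1 y - h * y * Dd 2 y) <=
  h ^+ 2 * (- (7/8) * D y + h * (3 * D y)) by apply: ler_wpM2l; [exact: sqr_ge0|lra].
have u5 : h ^+ 4 * (240 * (3 * D y) / 12 + `|y| * (24 * (9 * D y ^+ 2)) / 3) <=
  h ^+ 4 * (96 * D y) by apply: ler_wpM2l; [exact: exprn_ge0|lra].
have u6 : h ^+ 4 * (96 * D y) <= h ^+ 2 * (h * (96 * D y)).
  have -> : h ^+ 4 * (96 * D y) = h ^+ 2 * (h * (96 * D y)) * h by ring.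
  rewrite -[leRHS]mulr1; apply: ler_wpM2l => //.
  by rewrite mulr_ge0 ?sqr_ge0 // mulr_ge0 //; lra.
have u7 : h ^+ 2 * ((h * c) * D y) <= h ^+ 2 * (3/8 * D y).
  by apply: ler_wpM2l; [exact: sqr_ge0|apply: ler_wpM2r => //; exact: ltW].
move: u7; rewrite /c => u7; clear -up u4 u5 u6 u7.
by lra.
Qed.

Let sp : R := Num.sqrt pi.
(** The leading term [erfc / 2] of the approximation, followed by its derivatives. *)
Definition edge0 i : R -> R :=
  match i with
  | 0 => fun y => erfc y / 2
  | 1 => fun y => - sp^-1 * gauss y
  | 2 => fun y => sp^-1 * (2 * y * gauss y)
  | 3 => fun y => sp^-1 * ((2 - 4 * y ^+ 2) * gauss y)
  | _ => fun y => sp^-1 * ((8 * y ^+ 3 - 12 * y) * gauss y)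
  end.
(** The coefficient of [h] in the approximation, followed by its derivatives.  It is
the decaying solution of [f'' + 2 y f' = y edge0''], which cancels the contribution
of order [h^3]. *)
Definition edge1 i : R -> R :=
  match i with
  | 0 => fun y => - (3 * sp)^-1 * ((1 + y ^+ 2) * gauss y)
  | 1 => fun y => (3 * sp)^-1 * (2 * y ^+ 3 * gauss y)
  | 2 => fun y => (3 * sp)^-1 * ((6 * y ^+ 2 - 4 * y ^+ 4) * gauss y)
  | 3 => fun y => (3 * sp)^-1 * ((12 * y - 28 * y ^+ 3 + 8 * y ^+ 5) * gauss y)
  | _ => fun y => (3 * sp)^-1 * ((12 - 108 * y ^+ 2 + 96 * y ^+ 4 - 16 * y ^+ 6) * gauss y)
  end.

Lemma sp_neq0 : sp != 0. Proof. exact: lt0r_neq0 (sqrtpi_gt0 R). Qed.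

Lemma dvcM (c : R) (f : R -> R) y a : dv f y a -> dv (fun y => c * f y) y (c * a).
Proof. by move=> h; apply: dv_eq; [exact: dvM (dvC _ _) h | rewrite mul0r add0r]. Qed.

Lemma chain_edge0 : chain edge0.
Proof.
have sp0 := sp_neq0.
move=> i y; case: i => [|[|[|[|i]]]] hi.
- apply: dv_eq; first exact: (dvM (dv_erfc y) (dvC _ _)).
  by rewrite /edge0 /= -/sp; field.
- apply: dv_eq; first exact: (dvcM _ (dv_gauss y)).
  by rewrite /edge0 /=; field.
- apply: dv_eq; first exact: (dvcM _ (dvM (dvM (dvC _ _) (dvI _)) (dv_gauss y))).
  by rewrite /edge0 /=; field.
- apply: dv_eq.
    exact: (dvcM _ (dvM (dvD (dvC _ _) (dvN (dvM (dvC _ _) (dvX 2 (dvI _))))) (dv_gauss y))).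
  by rewrite /edge0 /=; field.
- by [].
Qed.

Lemma chain_edge1 : chain edge1.
Proof.
have sp0 := sp_neq0.
move=> i y; case: i => [|[|[|[|i]]]] hi.
- apply: dv_eq; first exact: (dvcM _ (dvM (dvD (dvC _ _) (dvX 2 (dvI _))) (dv_gauss y))).
  by rewrite /edge1 /=; field.
- apply: dv_eq; first exact: (dvcM _ (dvM (dvM (dvC _ _) (dvX 3 (dvI _))) (dv_gauss y))).
  by rewrite /edge1 /=; field.
- apply: dv_eq.
    exact: (dvcM _ (dvM (dvD (dvM (dvC _ _) (dvX 2 (dvI _))) (dvN (dvM (dvC _ _) (dvX 4 (dvI _))))) (dv_gauss y))).
  by rewrite /edge1 /=; field.
- apply: dv_eq.
    exact: (dvcM _ (dvM (dvD (dvD (dvM (dvC _ _) (dvI _)) (dvN (dvM (dvC _ _) (dvX 3 (dvI _))))) (dvM (dvC _ _) (dvX 5 (dvI _)))) (dv_gauss y))).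
  by rewrite /edge1 /=; field.
- by [].
Qed.

Lemma decays_edge0_3 : decays (edge0 3).
Proof.
apply: (@decays_ext _ (fun t => 2 * sp^-1 * (t ^+ 0 * gauss t) + - 4 * sp^-1 * (t ^+ 2 * gauss t))).
  by move=> t; rewrite /edge0 /=; ring.
by apply: decaysD; apply: decaysZ; exact: decays_gauss.
Qed.

Lemma decays_edge0_4 : decays (edge0 4).
Proof.
apply: (@decays_ext _ (fun t => 8 * sp^-1 * (t ^+ 3 * gauss t) + - 12 * sp^-1 * (t ^+ 1 * gauss t))).
  by move=> t; rewrite /edge0 /=; ring.
by apply: decaysD; apply: decaysZ; exact: decays_gauss.
Qed.

Lemma decays_edge1_0 : decays (edge1 0).
Proof.
apply: (@decays_ext _ (fun t => - (3 * sp)^-1 * (t ^+ 0 * gauss t) + - (3 * sp)^-1 * (t ^+ 2 * gauss t))).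
  by move=> t; rewrite /edge1 /=; ring.
by apply: decaysD; apply: decaysZ; exact: decays_gauss.
Qed.

Lemma decays_y_edge1_2 : decays (fun y => y * edge1 2 y).
Proof.
apply: (@decays_ext _ (fun t => (3 * sp)^-1 * 6 * (t ^+ 3 * gauss t) + (3 * sp)^-1 * -4 * (t ^+ 5 * gauss t))).
  by move=> t; rewrite /edge1 /=; ring.
by apply: decaysD; apply: decaysZ; exact: decays_gauss.
Qed.

Lemma decays_edge1_3 : decays (edge1 3).
Proof.
apply: (@decays_ext _ (fun t => (3 * sp)^-1 * 12 * (t ^+ 1 * gauss t) + (3 * sp)^-1 * -28 * (t ^+ 3 * gauss t) + (3 * sp)^-1 * 8 * (t ^+ 5 * gauss t))).
  by move=> t; rewrite /edge1 /=; ring.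
by do 2?apply: decaysD; apply: decaysZ; exact: decays_gauss.
Qed.

Lemma decays_edge1_4 : decays (edge1 4).
Proof.
apply: (@decays_ext _ (fun t => (3 * sp)^-1 * 12 * (t ^+ 0 * gauss t) + (3 * sp)^-1 * -108 * (t ^+ 2 * gauss t) + (3 * sp)^-1 * 96 * (t ^+ 4 * gauss t)+ (3 * sp)^-1 * -16 * (t ^+ 6 * gauss t))).
  by move=> t; rewrite /edge1 /=; ring.
by do 3?apply: decaysD; apply: decaysZ; exact: decays_gauss.
Qed.

Definition edgeworth h y := edge0 0 y + h * edge1 0 y.

(** The terms of order [h^2] and [h^3] in [recop_taylor] vanish by the choice of
[edge0] and [edge1].  The Gaussian factors of the remainder are better than [D]. *)
Lemma recop_edgeworth : exists2 C : R, 0 <= C &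
  forall h y, 0 < h -> h <= 1 -> `|recop h y (edgeworth h)| <= C * h ^+ 4 * D y.
Proof.
have [p3 p30 hp3] := decays_edge0_3; have [p4 p40 hp4] := decays_edge0_4.
have [q3 q30 hq3] := decays_edge1_3; have [q4 q40 hq4] := decays_edge1_4.
have [q2 q20 hq2] := decays_y_edge1_2.
exists (q2 + 9 * (p4 + q4) + 9 * (p3 + q3)); first by lra.
move=> h y h0 h1; have h0' := ltW h0.
pose F i y := edge0 i y + h * edge1 i y.
have cF : chain F.
  by move=> i t i4; apply: dvD (chain_edge0 _ i4) (dvcM _ (chain_edge1 _ i4)).
have d0 := D_gt0 y; have d1 := D_le1 y; have td := tD_le y.
have d2 : D y ^+ 2 <= D y by rewrite expr2; nra.
have gen p q pp qq t : 0 <= p -> 0 <= q -> `|t - y| <= h -> `|pp| <= p * D t ^+ 2 ->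
   `|qq| <= q * D t ^+ 2 -> `|pp + h * qq| <= (p + q) * (9 * D y ^+ 2).
  move=> p0 q0 ty hp hq; apply: le_trans (ler_normD _ _) _.
  rewrite normrM (ger0_norm h0').
  have dd := near_D2 h0' h1 ty.
  have : h * `|qq| <= 1 * `|qq| by apply: ler_wpM2r.
  have : (p + q) * D t ^+ 2 <= (p + q) * (9 * D y ^+ 2) by apply: ler_wpM2l; [lra|].
  by clear -hp hq; lra.
have := @recop_taylor R F h y ((p3 + q3) * (9 * D y ^+ 2)) ((p4 + q4) * (9 * D y ^+ 2)) cF h0'.
move=> /(_ _ _)H; have {}H := H _ _.
have {H} := H (fun t ty => gen _ _ _ _ t p30 q30 ty (hp3 t) (hq3 t))
  (fun t ty => gen _ _ _ _ t p40 q40 ty (hp4 t) (hq4 t)).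
have -> : F 2%N y + 2 * y * F 1%N y - h * y * F 2%N y = - (h ^+ 2 * (y * edge1 2 y)).
  by rewrite /F /edge0 /edge1 /=; have sp0 := sp_neq0; field.
rewrite -[F 0%N]/(edgeworth h) => H.
set T := recop _ _ _ in H *; set w := h ^+ 2 * - _ in H.
have -> : T = (T - w) + w by ring.
apply: le_trans (ler_normD _ _) _.
have h4 : 0 <= h ^+ 4 by exact: exprn_ge0.
have wb : `|w| <= h ^+ 4 * (q2 * D y).
  have -> : w = - (h ^+ 4 * (y * edge1 2 y)) by rewrite /w; ring.
  rewrite normrN normrM (ger0_norm h4).
  apply: ler_wpM2l => //; apply: le_trans (hq2 y) _; exact: ler_wpM2l.
apply: le_trans (lerD H wb) _.
have -> : (q2 + 9 * (p4 + q4) + 9 * (p3 + q3)) * h ^+ 4 * D y =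
  h ^+ 4 * (9 * (p4 + q4) * D y + 9 * (p3 + q3) * D y) + h ^+ 4 * (q2 * D y) by ring.
apply: lerD => //; apply: ler_wpM2l => //; apply: lerD.
  have : (p4 + q4) * D y ^+ 2 <= (p4 + q4) * D y by apply: ler_wpM2l; [lra|].
  have : 0 <= (p4 + q4) * D y by apply: mulr_ge0; lra.
  by lra.
have -> : `|y| * ((p3 + q3) * (9 * D y ^+ 2)) / 3 = 3 * (p3 + q3) * D y * (`|y| * D y) by field.
have : 3 * (p3 + q3) * D y * (`|y| * D y) <= 3 * (p3 + q3) * D y * (1/2).
  by apply: ler_wpM2l td; apply: mulr_ge0; lra.
have : 0 <= (p3 + q3) * D y by apply: mulr_ge0; lra.
by lra.
Qed.
End Barrier.

(** * Maximum principle and the comparison to the right of the mean *)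

Section MaximumPrinciple.
Variable R : realType.
Implicit Types (h y : R).
Local Notation D := (@D R).

(** A sequence that starts nonnegative and becomes negative has a downward step to a
negative value.  The hypothesis keeps it decreasing from there on, so that its
limit would be negative. *)
Lemma maximum_principle (c V : nat -> R) (l : R) :
  (forall j, 0 < c j) ->
  (forall j, c j * (V j.+2 - V j.+1) <= V j.+1 - V j) ->
  0 <= V 0%N -> V @ \oo --> l -> 0 <= l -> forall j, 0 <= V j.
Proof.
move=> c0 sup V0 Vl l0 j; rewrite leNgt; apply/negP => Vj.
have [i Vi di] : exists2 i, V i.+1 < 0 & V i.+1 - V i < 0.
  elim: j Vj => [|j IH] Vj; first by move: V0; lra.
  have [Vj'|Vj'] := ltP (V j) 0; first exact: IH.
  by exists j => //; lra.
have dec k : V (i + k.+1)%N - V (i + k)%N < 0.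
  elim: k => [|k IH]; first by rewrite addn0 addn1.
  rewrite !addnS in IH *; have h := sup (i + k)%N.
  have h2 := le_lt_trans h IH.
  by rewrite -(pmulr_rlt0 _ (c0 (i + k)%N)).
have le k : V (i + k.+1)%N <= V i.+1.
  elim: k => [|k IH]; first by rewrite addn1.
  by have := dec k.+1; lra.
have : l <= V i.+1.
  apply: (cvgr_to_le Vl).
  exists i.+1 => // n /= ni; have -> : n = (i + (n - i.+1).+1)%N by lia.
  exact: le.
lra.
Qed.

Lemma cvg_seq_tends (f : R -> R) (l : R) h x : 0 < h ->
  tends f l -> (fun n => f (n%:R * h + x)) @ \oo --> l.
Proof.
move=> h0 fl; apply/cvgrPdist_le => e e0; have [A hA] := fl e e0.
near=> n; rewrite distrC; apply: hA.
rewrite -lerBlDr -ler_pdivrMr //; near: n; exact: nbhs_infty_ger.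
Unshelve. all: by end_near. Qed.

Lemma tends_cst (c : R) : tends (fun=> c) c.
Proof. by move=> e e0; exists 0 => x _; rewrite subrr normr0 ltW. Qed.

Lemma decays_tends (f : R -> R) : decays f -> tends f 0.
Proof.
move=> [c c0 hc]; apply: (@tends_inv _ _ _ c) => x x1; rewrite subr0.
apply: le_trans (hc x) _; apply: ler_wpM2l => //.
have := DV x; have := D_gt0 x; have := D_le1 x => a b d.
rewrite -[leRHS]mul1r ler_pdivlMr; last by lra.
have : D x * x <= 1 by nra.
by rewrite expr2; nra.
Qed.

(** Apply the maximum principle to [B h^2 D] plus or minus the difference between [p]
and the approximation: [recop_D] makes the first term a strict supersolution, by
more than the residual [recop_edgeworth] of the second, and everything vanishes at
infinity. *)
Lemma right_comparison : exists hs C : R, [/\ 0 < hs, hs <= 1, 0 <= C &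
  forall h (p : nat -> R) N (K : R), 0 < h -> h <= hs -> 0 <= K ->
  (forall k, 2 * k.+1%:R * h ^+ 2 * (p k.+2 - p k.+1) = p k.+1 - p k) ->
  p @ \oo --> (1 : R) ->
  let y k := 1 / (2 * h) - k%:R * h in
  `|y N| <= 1 ->
  `|p N - edgeworth h (y N)| <= K * h ^+ 2 ->
  forall k, (N <= k)%N -> `|p k - edgeworth h (y k)| <= (C + 2 * K) * h ^+ 2 * D (y k)].
Proof.
have [hs hs0 rD] := recop_D R; have [C C0 rP] := recop_edgeworth R.
exists (Num.min hs 1), (2 * C); split.
- by rewrite lt_min hs0 ltr01.
- by rewrite ge_min lexx orbT.
- lra.
move=> h p N K h0; rewrite le_min => /andP[hhs h1] K0 rec p1 y yN pN k Nk.
have {}rD := rD h _ h0 hhs; have {}rP := rP h _ h0 h1.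
have hn := lt0r_neq0 h0.
pose B := 2 * C + 2 * K.
have B0 : 0 <= B by rewrite /B; lra.
have yS j : y j.+1 = y j - h by rewrite /y -[j.+1%:R]natr1; ring.
have yk j : 2 * j%:R * h ^+ 2 = 1 - 2 * h * y j by rewrite /y; field.
have cvP : (fun n => edgeworth h (y (N + n)%N)) @ \oo --> (1 : R).
  have t1 : tends (fun t => edgeworth h (- t)) 1.
    have -> : (1 : R) = 1 + (- (1/2)) * 0 + h * 0 by ring.
    have -> : (fun t => edgeworth h (- t)) =
      fun t : R => 1 + (- (1/2)) * erfc t + h * edge1 0 (- t).
      by apply/funext => t; rewrite /edgeworth /edge0 erfcN; field.
    apply: tendsD; last first.
      apply: tendsZ; have -> : (fun t : R => edge1 0 (- t)) = edge1 0.
        by apply/funext => t; rewrite /edge1 /= sqrrN /gauss sqrrN.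
      exact: decays_tends (decays_edge1_0 R).
    exact (tendsD (tends_cst 1) (tendsZ (- (1/2)) (@tends_erfc R))).
  have := cvg_seq_tends (- y N) h0 t1.
  have -> : (fun n : nat => edgeworth h (- (n%:R * h + - y N))) =
            (fun n : nat => edgeworth h (y (N + n)%N)).
    by apply/funext => n; congr edgeworth; rewrite /y natrD; ring.
  by [].
have cvD : (fun n => D (y (N + n)%N)) @ \oo --> (0 : R).
  have t1 : tends (fun t => D (- t)) (0 : R).
    apply: (@tends_inv _ _ _ 1) => x x1; rewrite subr0 ger0_norm; last exact/ltW/D_gt0.
    have := DV x; have := D_gt0 x; rewrite /D sqrrN -/(D x) => a b.
    rewrite ler_pdivlMr; last by lra.
    by nra.
  have := cvg_seq_tends (- y N) h0 t1.
  have -> : (fun n : nat => D (- (n%:R * h + - y N))) = (fun n : nat => D (y (N + n)%N)).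
    by apply/funext => n; congr D; rewrite /y natrD; ring.
  by [].
have cvp : (fun n => p (N + n)%N) @ \oo --> (1 : R).
  exact: cvg_comp (cvg_addnl N) p1.
(* The difference operator in terms of increments along the grid. *)
have recS (f : R -> R) j : 2 * (N + j).+1%:R * h ^+ 2 * (f (y (N + j).+2) - f (y (N + j).+1)) =
    f (y (N + j).+1) - f (y (N + j)%N) + recop h (y (N + j).+1) f.
  rewrite yk /recop (yS (N + j).+1).
  have -> : y (N + j)%N = y (N + j).+1 + h by rewrite yS; ring.
  by ring.
have c0 j : 0 < 2 * (N + j).+1%:R * h ^+ 2 :> R.
  by apply: mulr_gt0; [apply: mulr_gt0; rewrite ?ltr0n | exact: exprn_gt0].
have hh2 : 0 <= h ^+ 2 by exact: sqr_ge0.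
have hB : 0 <= B * h ^+ 2 by exact: mulr_ge0.
have dN : 1/2 <= D (y N).
  have := DV (y N); have := D_gt0 (y N); have : y N ^+ 2 <= 1.
    by rewrite -[y N ^+ 2]real_normK ?num_real // expr_le1.
  by nra.
(* [B >= 2 C], and [recop h z D <= - h^2 D z / 2]. *)
have barrier z : C * h ^+ 4 * D z + B * h ^+ 2 * recop h z D <= 0.
  have : B * h ^+ 2 * recop h z D <= B * h ^+ 2 * (- (1/2) * h ^+ 2 * D z).
    exact: ler_wpM2l.
  have : 0 <= K * (h ^+ 4 * D z).
    by apply: mulr_ge0 => //; apply: mulr_ge0; [exact: exprn_ge0 (ltW h0)|exact/ltW/D_gt0].
  by rewrite /B; lra.
have pN' : `|p N - edgeworth h (y N)| <= B * h ^+ 2 * D (y N).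
  apply: le_trans pN _; apply: le_trans (_ : B * h ^+ 2 * (1/2) <= _).
    have : 0 <= C * h ^+ 2 by exact: mulr_ge0.
    by rewrite /B; lra.
  exact: ler_wpM2l.
have key (s : R) : (s = 1) \/ (s = -1) -> forall j,
    0 <= B * h ^+ 2 * D (y (N + j)%N) + s * (edgeworth h (y (N + j)%N) - p (N + j)%N).
  move=> hs'.
  have s1 : forall a b : R, `|a| <= b -> s * a <= b.
    by move=> a b; rewrite ler_norml => /andP[]; case: hs' => ->; lra.
  apply: (@maximum_principle (fun j => 2 * (N + j).+1%:R * h ^+ 2) _ 0) => //.
  - move=> j; rewrite !addnS.
    have e1 := recS (edgeworth h) j; have e2 := recS D j; have e3 := rec (N + j)%N.
    have b := barrier (y (N + j).+1); have r := s1 _ _ (rP (y (N + j).+1)).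
    set cc := 2 * _ * _ in e1 e2 e3 *.
    have -> : cc * (B * h ^+ 2 * D (y (N + j).+2) + s * (edgeworth h (y (N + j).+2) - p (N + j).+2) -
      (B * h ^+ 2 * D (y (N + j).+1) + s * (edgeworth h (y (N + j).+1) - p (N + j).+1))) =
      B * h ^+ 2 * (cc * (D (y (N + j).+2) - D (y (N + j).+1))) +
      s * (cc * (edgeworth h (y (N + j).+2) - edgeworth h (y (N + j).+1))) -
      s * (cc * (p (N + j).+2 - p (N + j).+1)) by ring.
    by rewrite e1 e2 e3; lra.
  - rewrite addn0; have := s1 _ _ pN'; set b := B * _ * _; clear; lra.
  - have -> : (0 : R) = B * h ^+ 2 * 0 + s * (1 - 1) by ring.
    apply: cvgD; first by apply: cvgM; [exact: cvg_cst|exact: cvD].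
    by apply: cvgM; [exact: cvg_cst|exact: cvgB].
have -> : k = (N + (k - N))%N by rewrite subnKC.
have k1 := key 1 (or_introl erefl) (k - N)%N; have k2 := key (-1) (or_intror erefl) (k - N)%N.
rewrite -/B ler_norml; apply/andP; split; lra.
Qed.
End MaximumPrinciple.

(** * Summation of the logarithms to the right of the mean *)

Section RightSum.
Variable R : realType.
Implicit Types (y h : R).
Local Notation D := (@D R).
Let sp : R := Num.sqrt pi.

(** With its derivatives [lnerfc1], [lnerfc2], the leading term of [ln (pois x k)]. *)
Definition lnerfc y : R := ln (erfc y / 2).
Definition lnerfc1 y : R := - 2 * (E y)^-1.
Definition lnerfc2 y : R := - 4 * (E y)^-1 ^+ 2 + 4 * (y * (E y)^-1).
(** The relative first correction: [edge1 / edge0]. *)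
Definition corrR y : R := - (2/3) * ((1 + y ^+ 2) * (E y)^-1).
Definition corrR1 y : R := - (2/3) * (2 * (y * (E y)^-1) +
   (1 + y ^+ 2) * (2 * (E y)^-1 ^+ 2 - 2 * (y * (E y)^-1))).

Lemma dv_EV y : dv (fun y => (E y)^-1) y (2 * (E y)^-1 ^+ 2 - 2 * (y * (E y)^-1)).
Proof.
have e := lt0r_neq0 (E_gt0 y).
apply: dv_eq; first exact: (dvV e (dv_E' y)).
by rewrite A1E; field.
Qed.

Lemma dv_lnerfc y : dv lnerfc y (lnerfc1 y).
Proof.
have e := lt0r_neq0 (E_gt0 y); have g := lt0r_neq0 (gauss_gt0 y).
have s0 := sp_neq0 R.
apply: dv_eq.
  apply: (@dvL _ (fun y => erfc y / 2)); first by rewrite divr_gt0 // erfc_gt0.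
  exact: (dvM (dv_erfc y) (dvC _ _)).
by rewrite /lnerfc1 erfcE; field; rewrite s0 g e.
Qed.

Lemma dv_lnerfc1 y : dv lnerfc1 y (lnerfc2 y).
Proof.
by apply: dv_eq; [exact: (dvcM _ (dv_EV y)) | rewrite /lnerfc2; ring].
Qed.

Lemma dv_corrR y : dv corrR y (corrR1 y).
Proof.
apply: dv_eq; first exact: (dvcM _ (dvM (dvD (dvC _ _) (dvX 2 (dvI _))) (dv_EV y))).
by rewrite /corrR1 /= expr1; ring.
Qed.

Lemma lnerfcE y : lnerfc y = lnE y - y ^+ 2 - ln (2 * sp).
Proof.
have s0 : 0 < sp := sqrtpi_gt0 R.
rewrite /lnerfc erfcE /lnE.
have -> : gauss y * E y / sp / 2 = gauss y * (E y / (2 * sp)).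
  by field; exact: lt0r_neq0.
have e0 : 0 < E y / (2 * sp) by rewrite divr_gt0 ?E_gt0 //; lra.
rewrite lnM ?posrE ?gauss_gt0 // expRK ln_div ?posrE ?E_gt0 //; last by lra.
by ring.
Qed.

Lemma edgeworthE h y : edgeworth h y = erfc y / 2 * (1 + h * corrR y).
Proof.
have e := lt0r_neq0 (E_gt0 y); have s0 := sp_neq0 R.
by rewrite /edgeworth /edge0 /edge1 /corrR erfcE -/sp; field; rewrite s0 e.
Qed.

Lemma EV_le : exists2 k : R, 0 <= k & forall y, y <= 1 -> 0 < (E y)^-1 <= k * gauss y.
Proof.
have s0 : 0 < sp := sqrtpi_gt0 R; have e1 := erfc_gt0 (1 : R).
exists (sp * erfc 1)^-1; first by rewrite invr_ge0 mulr_ge0 // ltW.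
move=> y y1; have e := E_gt0 y; rewrite invr_gt0 e /=.
have g := gauss_gt0 y.
have -> : (E y)^-1 = (sp * erfc y)^-1 * gauss y.
  by rewrite erfcE -/sp; field; rewrite !lt0r_neq0.
apply: ler_wpM2r; first exact: ltW.
have ey := erfc_gt0 y.
have m1 : 0 < sp * erfc 1 by exact: mulr_gt0.
have m2 : 0 < sp * erfc y by exact: mulr_gt0.
rewrite lef_pV2 ?posrE //.
apply: ler_wpM2l; first exact: ltW.
by move: y1; rewrite le_eqVlt => /orP[/eqP ->//|/erfc_decr/ltW].
Qed.

Lemma decays_bound (f : R -> R) : decays f -> exists2 c : R, 0 <= c & forall t, `|f t| <= c * D t.
Proof.
move=> [c c0 hc]; exists c => // t; apply: le_trans (hc t) _.
apply: ler_wpM2l => //; have := D_gt0 t; have := D_le1 t; rewrite expr2; nra.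
Qed.

(** To the left of 1 all these functions are polynomials times powers of [E^-1], and
[E^-1] is at most a multiple of the Gaussian there. *)
Lemma right_bounds : exists2 C : R, 0 <= C &
  forall y, y <= 1 -> [/\ `|lnerfc2 y| <= C * D y, `|corrR y| <= C * D y & `|corrR1 y| <= C * D y].
Proof.
have [k k0 hk] := EV_le.
have [b0 b00 hb0] := decays_bound (decays_gauss R 0).
have [b1 b10 hb1] := decays_bound (decays_gauss R 1).
have [b2 b20 hb2] := decays_bound (decays_gauss R 2).
have [b3 b30 hb3] := decays_bound (decays_gauss R 3).
pose c0 := k * b0; pose c1 := k * b1; pose c2 := k * b2; pose c3 := k * b3.
exists (4 * (k * c0) + 4 * c1 + (c0 + c2) + (2 * c1 + (2 * (k * c0) + 2 * (k * c2)) + 2 * (c1 + c3))).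
  have c00 : 0 <= c0 by exact: mulr_ge0.
  have c10 : 0 <= c1 by exact: mulr_ge0.
  have c20 : 0 <= c2 by exact: mulr_ge0.
  have c30 : 0 <= c3 by exact: mulr_ge0.
  have kc0 : 0 <= k * c0 by exact: mulr_ge0.
  have kc2 : 0 <= k * c2 by exact: mulr_ge0.
  by lra.
move=> y y1; have /andP[w0 wk] := hk y y1.
have w0' := ltW w0; have g0 := gauss_gt0 y.
have g1 : gauss y <= 1 by rewrite -expR0 ler_expR oppr_le0 sqr_ge0.
have pw n b : `|y ^+ n * gauss y| <= b * D y -> `|y ^+ n * (E y)^-1| <= k * b * D y.
  move=> h; rewrite normrM (ger0_norm w0').
  apply: le_trans (_ : k * (`|y ^+ n| * gauss y) <= _).
    rewrite mulrCA; apply: ler_wpM2l => //; exact: wk.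
  rewrite -mulrA; apply: ler_wpM2l => //.
  by move: h; rewrite normrM (ger0_norm (ltW g0)).
have wk1 : (E y)^-1 <= k by apply: le_trans wk _; rewrite ler_piMr.
have p0 := pw 0%N _ (hb0 y); have p1 := pw 1%N _ (hb1 y).
have p2 := pw 2%N _ (hb2 y); have p3 := pw 3%N _ (hb3 y).
rewrite -/c0 expr0 mul1r in p0; rewrite -/c1 expr1 in p1; rewrite -/c2 in p2; rewrite -/c3 in p3.
have sqw n b : `|y ^+ n * (E y)^-1| <= b * D y -> `|y ^+ n * (E y)^-1 ^+ 2| <= k * b * D y.
  move=> h; rewrite expr2 mulrA normrM (ger0_norm w0') mulrC -mulrA.
  by apply: ler_pM.
have q0 : `|(E y)^-1 ^+ 2| <= k * c0 * D y.
  by have := sqw 0%N c0; rewrite expr0 !mul1r; apply.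
have q2 := sqw 2%N _ p2.
have d0 := ltW (D_gt0 y).
have nn : [/\ 0 <= c0 * D y, 0 <= c1 * D y, 0 <= c2 * D y & 0 <= c3 * D y].
  by split; rewrite mulr_ge0 // /c0 /c1 /c2 /c3 mulr_ge0.
have nk : [/\ 0 <= k * c0 * D y & 0 <= k * c2 * D y].
  by split; rewrite -mulrA mulr_ge0 //; case: nn.
case: nn nk => n0 n1 n2 n3 [m0 m2].
rewrite /lnerfc2 /corrR /corrR1.
have e1 : (1 + y ^+ 2) * (E y)^-1 = (E y)^-1 + y ^+ 2 * (E y)^-1 by ring.
have e2 : 2 * (y * (E y)^-1) +
   (1 + y ^+ 2) * (2 * (E y)^-1 ^+ 2 - 2 * (y * (E y)^-1)) =
   2 * (E y)^-1 ^+ 2 + 2 * (y ^+ 2 * (E y)^-1 ^+ 2) - 2 * (y ^+ 3 * (E y)^-1) by ring.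
rewrite e1 e2.
move: p0 p1 p2 p3 q0 q2; rewrite !ler_norml.
clear -n0 n1 n2 n3 m0 m2.
set A0 := (E y)^-1; set A1 := y * A0; set A2 := y ^+ 2 * A0; set A3 := y ^+ 3 * A0.
set B0 := A0 ^+ 2; set B2 := y ^+ 2 * B0.
set C0 := c0 * D y in n0 *; set C1 := c1 * D y in n1 *.
set C2 := c2 * D y in n2 *; set C3 := c3 * D y in n3 *.
set K0 := k * c0 * D y in m0 *; set K2 := k * c2 * D y in m2 *.
have -> : (4 * (k * c0) + 4 * c1 + (c0 + c2) + (2 * c1 + (2 * (k * c0) + 2 * (k * c2)) + 2 * (c1 + c3))) * D y
  = 4 * K0 + 4 * C1 + (C0 + C2) + (2 * C1 + (2 * K0 + 2 * K2) + 2 * (C1 + C3)).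
  by rewrite /K0 /K2 /C0 /C1 /C2 /C3; ring.
clearbody A0 A1 A2 A3 B0 B2 C0 C1 C2 C3 K0 K2.
move=> /andP[p0 p0'] /andP[p1 p1'] /andP[p2 p2'] /andP[p3 p3'] /andP[q0 q0'] /andP[q2 q2'].
split; apply/andP; split; lra.
Qed.

(** Divides the bound of [right_comparison] by [erfc y / 2], which is bounded below
for [y <= 1], and expands the logarithm. *)
Lemma right_log (K : R) : 0 <= K -> exists C hs : R, [/\ 0 <= C, 0 < hs &
  forall h y p, 0 < h -> h <= hs -> y <= 1 -> `|p - edgeworth h y| <= K * h ^+ 2 * D y ->
  0 < p /\ `|ln p - (lnerfc y + h * corrR y)| <= C * h ^+ 2 * D y].
Proof.
move=> K0; have [C C0 hC] := right_bounds.
have e1 := erfc_gt0 (1 : R).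
pose K' := K * (2 / erfc 1).
have K'0 : 0 <= K' by rewrite mulr_ge0 // divr_ge0 // ltW.
pose M := C + K' + 1.
have M1 : 1 <= M by rewrite /M; lra.
exists (M ^+ 2 + K'), ((1/2) / M); split.
- by rewrite addr_ge0 // sqr_ge0.
- by rewrite divr_gt0 //; lra.
move=> h y p h0 hs y1 hp.
have hM : h * M <= 1/2 by move: hs; rewrite ler_pdivlMr; lra.
have h1 : h <= 1 by nra.
have [_ hc _] := hC y y1; have d0 := D_gt0 y; have d1 := D_le1 y.
have ey := erfc_gt0 y.
have ey1 : erfc 1 <= erfc y.
  by move: y1; rewrite le_eqVlt => /orP[/eqP ->//|/erfc_decr/ltW].
pose rho := (p - edgeworth h y) / (erfc y / 2).
have hr : `|rho| <= K' * h ^+ 2 * D y.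
  have e2i : 0 <= (erfc y / 2)^-1 by rewrite invr_ge0; lra.
  rewrite /rho normrM [`|(_ / 2)^-1|]ger0_norm //.
  apply: le_trans (_ : (K * h ^+ 2 * D y) * (2 / erfc 1) <= _); last by rewrite /K'; lra.
  apply: ler_pM => //.
  by rewrite invf_div ler_pM2l // lef_pV2.
pose u := h * corrR y + rho.
have pE : p = erfc y / 2 * (1 + u).
  have -> : p = edgeworth h y + (p - edgeworth h y) by ring.
  by rewrite {1}edgeworthE /u /rho; field; exact: lt0r_neq0.
have hu : `|u| <= M * (h * D y).
  apply: le_trans (ler_normD _ _) _; rewrite normrM (ger0_norm (ltW h0)).
  have : h * `|corrR y| <= h * (C * D y) by apply: ler_wpM2l => //; exact: ltW.
  have : K' * h ^+ 2 * D y <= K' * (h * D y).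
    rewrite -mulrA; apply: ler_wpM2l => //; apply: ler_wpM2r; first exact: ltW.
    by rewrite expr2 ler_piMl // ltW.
  have : 0 <= h * D y by rewrite mulr_ge0 // ltW.
  by rewrite /M; lra.
have hd : h * D y <= h by rewrite ler_piMr // ltW.
have hd0 : 0 <= h * D y by rewrite mulr_ge0 // ltW.
have hu2 : `|u| <= 1/2.
  apply: le_trans hu _; apply: le_trans (_ : M * h <= _); last by lra.
  by apply: ler_wpM2l => //; lra.
have u1 : 0 < 1 + u by move: hu2; rewrite ler_norml => /andP[]; lra.
have e20 : 0 < erfc y / 2 by lra.
split; first by rewrite pE mulr_gt0.
rewrite pE lnM ?posrE // -/(lnerfc y).
have -> : lnerfc y + ln (1 + u) - (lnerfc y + h * corrR y) = (ln (1 + u) - u) + rho by rewrite /u; ring.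
apply: le_trans (ler_normD _ _) _.
have l := ln1D_approx hu2.
have s : u ^+ 2 <= M ^+ 2 * h ^+ 2 * D y.
  apply: le_trans (_ : (M * (h * D y)) ^+ 2 <= _).
    rewrite -[u ^+ 2]real_normK ?num_real //; apply: lerXn2r; rewrite ?nnegrE //.
    by apply: mulr_ge0 => //; lra.
  rewrite !exprMn -mulrA; apply: ler_wpM2l; first exact: sqr_ge0.
  by apply: ler_wpM2l; [exact: sqr_ge0 | rewrite expr2; nra].
by rewrite mulrDl mulrDl; lra.
Qed.

(** Sums of [h D] over a grid are bounded by telescoping the arc tangent. *)
Lemma D_atan h y : 0 <= h -> h <= 1 -> h * D y <= 3 * (atan (y + h / 2) - atan (y - h / 2)).
Proof.
move=> h0 h1; have yh : y - h / 2 <= y + h / 2 by lra.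
have [c cy ->] := @mvt R atan (fun x => (1 + x ^+ 2)^-1) _ _ yh (fun t _ => is_derive1_atan t).
rewrite -/(D c); have : D y <= 3 * D c.
  by apply: D_shift; rewrite ler_norml; lra.
have -> : y + h / 2 - (y - h / 2) = h by field.
by move=> hd; have : h * D y <= h * (3 * D c) by [apply: ler_wpM2l]; lra.
Qed.

(** The errors of [right_log] and of the midpoint rule are [O(h^2 D)]; by [D_atan] they
add up to [O(h)] uniformly in the number of terms. *)
Lemma right_sum (K : R) : 0 <= K -> exists C hs : R, [/\ 0 <= C, 0 < hs, hs <= 1 &
  forall h y (p : nat -> R) (IF IC : R -> R), 0 < h -> h <= hs ->
  (forall y, dv IF y (lnerfc y)) -> (forall y, dv IC y (corrR y)) ->
  y <= 1/2 ->
  (forall i, `|p i - edgeworth h (y - h / 2 - i%:R * h)| <= K * h ^+ 2 * D (y - h / 2 - i%:R * h)) ->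
  (forall i, 0 < p i) /\ forall n,
  `|\sum_(i < n) ln (p i) - ((IF y - IF (y - n%:R * h)) / h + (IC y - IC (y - n%:R * h)))|
   <= C * h].
Proof.
move=> K0; have [C1 [hs1 [C10 hs10 hl]]] := right_log K0.
have [C2 C20 hb] := right_bounds.
exists (3 * (C1 + C2) * pi), (Num.min hs1 1); split.
- by rewrite mulr_ge0 ?pi_ge0 // mulr_ge0 //; lra.
- by rewrite lt_min hs10 ltr01.
- by rewrite ge_min lexx orbT.
move=> h y p IF IC h0; rewrite le_min => /andP[hh h1] dIF dIC y12 hp.
have hn := lt0r_neq0 h0; have h0' := ltW h0.
have pl i : 0 < p i /\ `|ln (p i) - (lnerfc (y - h / 2 - i%:R * h) + h * corrR (y - h / 2 - i%:R * h))|
    <= C1 * h ^+ 2 * D (y - h / 2 - i%:R * h).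
  apply: hl => //.
  have : 0 <= i%:R * h by rewrite mulr_ge0.
  by lra.
split=> [i|n]; first by case: (pl i).
suff H : `|\sum_(i < n) ln (p i) - ((IF y - IF (y - n%:R * h)) / h + (IC y - IC (y - n%:R * h)))|
   <= 3 * (C1 + C2) * h * (atan y - atan (y - n%:R * h)).
  apply: le_trans H _.
  have -> : 3 * (C1 + C2) * pi * h = 3 * (C1 + C2) * h * pi by ring.
  apply: ler_wpM2l; first by rewrite mulr_ge0 // mulr_ge0 //; lra.
  by have := atan_ltpi2 y; have := atan_gtNpi2 (y - n%:R * h); lra.
elim: n => [|n IH].
  by rewrite big_ord0 mul0r subr0 !subrr mul0r addr0 subrr normr0 mulr0.
have [_ ln_] := pl n.
pose z := y - h / 2 - n%:R * h.
have nh : 0 <= n%:R * h by rewrite mulr_ge0.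
have z1 : z + h / 2 <= 1 by rewrite /z; lra.
rewrite -/z in ln_.
have zu : y - n%:R * h = z + h / 2 by rewrite /z; field.
have zd : y - n.+1%:R * h = z - h / 2 by rewrite /z -[n.+1%:R]natr1; field.
rewrite big_ord_recr /= zd; rewrite zu in IH.
have d0 := D_gt0 z.
have int t : z - h / 2 <= t <= z + h / 2 -> t <= 1 /\ C2 * D t <= C2 * (3 * D z).
  move=> tz; split; first by lra.
  by apply: ler_wpM2l => //; apply: D_shift; rewrite ler_norml; lra.
have hd : 0 <= h / 2 by lra.
have mF : `|IF (z + h / 2) - IF (z - h / 2) - 2 * (h / 2) * lnerfc z| <=
   C2 * (3 * D z) * (h / 2) ^+ 3 / 3.
  apply: (midpoint hd (fun t _ => dIF t) (fun t _ => dv_lnerfc t) (fun t _ => dv_lnerfc1 t)).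
  move=> t tz; have [t1 td] := int t tz; have [b _ _] := hb t t1.
  exact: le_trans td.
have mC : `|IC (z + h / 2) - IC (z - h / 2) - 2 * (h / 2) * corrR z| <=
   C2 * (3 * D z) * (h / 2) ^+ 2.
  apply: (midpoint1 hd (fun t _ => dIC t) (fun t _ => dv_corrR t)).
  move=> t tz; have [t1 td] := int t tz; have [_ _ b] := hb t t1.
  exact: le_trans td.
set W := h ^+ 2 * D z.
have W0 : 0 <= W by rewrite mulr_ge0 ?sqr_ge0 // ltW.
have {}ln_ : `|ln (p n) - (lnerfc z + h * corrR z)| <= C1 * W by rewrite /W mulrA.
have cW : 0 <= C2 * W by exact: mulr_ge0.
have {}mF : `|(IF (z + h / 2) - IF (z - h / 2)) / h - lnerfc z| <= C2 * W / 8.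
  have -> : (IF (z + h / 2) - IF (z - h / 2)) / h - lnerfc z =
    (IF (z + h / 2) - IF (z - h / 2) - 2 * (h / 2) * lnerfc z) / h by field.
  rewrite normrM [`|h^-1|]ger0_norm ?invr_ge0 // ler_pdivrMr //.
  apply: le_trans mF _.
  have -> : C2 * (3 * D z) * (h / 2) ^+ 3 / 3 = C2 * W / 8 * h by rewrite /W; field.
  exact: lexx.
have {}mC : `|IC (z + h / 2) - IC (z - h / 2) - 2 * (h / 2) * corrR z| <= C2 * W * (3/4).
  apply: le_trans mC _.
  have -> : C2 * (3 * D z) * (h / 2) ^+ 2 = C2 * W * (3/4) by rewrite /W; field.
  exact: lexx.
have tot : `|ln (p n) - ((IF (z + h / 2) - IF (z - h / 2)) / h +
    (IC (z + h / 2) - IC (z - h / 2)))| <= (C1 + C2) * W.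
  have -> : ln (p n) - ((IF (z + h / 2) - IF (z - h / 2)) / h +
    (IC (z + h / 2) - IC (z - h / 2))) =
    (ln (p n) - (lnerfc z + h * corrR z)) -
    ((IF (z + h / 2) - IF (z - h / 2)) / h - lnerfc z) -
    (IC (z + h / 2) - IC (z - h / 2) - 2 * (h / 2) * corrR z).
    by field.
  apply: le_trans (ler_normB _ _) _; apply: le_trans (lerD (ler_normB _ _) (lexx _)) _.
  by clear -ln_ mF mC cW; lra.
have tel : (C1 + C2) * W <= 3 * (C1 + C2) * h * (atan (z + h / 2) - atan (z - h / 2)).
  have := D_atan z h0' h1 => hda.
  have -> : (C1 + C2) * W = (C1 + C2) * h * (h * D z) by rewrite /W; ring.
  have -> : 3 * (C1 + C2) * h * (atan (z + h / 2) - atan (z - h / 2)) =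
    (C1 + C2) * h * (3 * (atan (z + h / 2) - atan (z - h / 2))) by ring.
  by apply: ler_wpM2l hda; rewrite mulr_ge0 //; lra.
set S := \sum_(i < n) _ in IH *.
have -> : S + ln (p n) - ((IF y - IF (z - h / 2)) / h + (IC y - IC (z - h / 2)))
  = (S - ((IF y - IF (z + h / 2)) / h + (IC y - IC (z + h / 2)))) +
    (ln (p n) - ((IF (z + h / 2) - IF (z - h / 2)) / h +
       (IC (z + h / 2) - IC (z - h / 2)))) by field.
apply: le_trans (ler_normD _ _) _.
by clear -IH tel tot; lra.
Qed.

End RightSum.

(** * Telescoping and the Euler-Maclaurin step *)

Section EulerMaclaurin.
Variable R : realType.

(** [u - b] is nondecreasing and bounded. *)
Lemma cvg_telescope (u b : nat -> R) (n0 : nat) :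
  (forall n, (n0 <= n)%N -> `|u n.+1 - u n| <= b n - b n.+1) ->
  b @ \oo --> (0 : R) ->
  exists2 l : R, u @ \oo --> l & forall n, (n0 <= n)%N -> `|l - u n| <= b n.
Proof.
move=> ub b0.
have tel n k : (n0 <= n)%N -> `|u (n + k)%N - u n| <= b n - b (n + k)%N.
  move=> nn; elim: k => [|k IH]; first by rewrite addn0 !subrr normr0.
  rewrite addnS; have -> : u (n + k).+1 - u n = (u (n + k).+1 - u (n + k)%N) + (u (n + k)%N - u n) by ring.
  apply: le_trans (ler_normD _ _) _.
  by have := ub (n + k)%N (leq_trans nn (leq_addr _ _)); lra.
have b_ge n : (n0 <= n)%N -> 0 <= b n.
  move=> nn; have h k : b (n + k)%N <= b n.
    by have := tel n k nn; have := normr_ge0 (u (n + k)%N - u n); lra.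
  by apply: (cvgr_to_le (cvg_comp (addn n) b (cvg_addnl n) b0)); exists 0%N => // k _; exact: h.
pose v k := u (n0 + k)%N - b (n0 + k)%N.
have cv : cvgn v.
  apply: nondecreasing_is_cvgn.
    apply/nondecreasing_seqP => k; rewrite /v addnS.
    by have := ub (n0 + k)%N (leq_addr _ _); rewrite ler_norml => /andP[]; lra.
  exists (u n0 + b n0) => _ [k _ <-]; rewrite /v.
  have := tel n0 k (leqnn _); have := b_ge (n0 + k)%N (leq_addr _ _).
  by rewrite ler_norml => ? /andP[]; lra.
have cu : u @ \oo --> limn v.
  rewrite -(cvg_shiftn n0).
  have -> : (fun n => u (n + n0)%N) = (fun n => v n + b (n0 + n)%N).
    by apply/funext => n; rewrite /v addnC; ring.
  rewrite -[limn v]addr0; apply: cvgD; first exact: cv.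
  exact: cvg_comp (cvg_addnl n0) b0.
exists (limn v) => // n nn.
have cun : u (n + k)%N @[k --> \oo] --> limn v by exact: cvg_comp (cvg_addnl n) cu.
rewrite ler_norml; apply/andP; split.
  suff : u n - b n <= limn v by lra.
  apply: (cvgr_to_ge cun); exists 0%N => // k _.
  have := tel n k nn; have := b_ge (n + k)%N (leq_trans nn (leq_addr _ _)).
  by rewrite ler_norml => ? /andP[]; lra.
suff : limn v <= u n + b n by lra.
apply: (cvgr_to_le cun); exists 0%N => // k _.
have := tel n k nn; have := b_ge (n + k)%N (leq_trans nn (leq_addr _ _)).
by rewrite ler_norml => ? /andP[]; lra.
Qed.

(** Combines three Taylor expansions at [a]; the constant is not the sharp one. *)
Lemma euler_maclaurin_step (G : nat -> R -> R) (a B : R) :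
  (forall i x, (i < 4)%N -> a <= x <= a + 1 -> dv (G i) x (G i.+1 x)) ->
  (forall x, a <= x <= a + 1 -> `|G 4%N x| <= B) ->
  `|(G 1%N a + G 1%N (a + 1)) / 2 - (G 0%N (a + 1) - G 0%N a)
     - (G 2%N (a + 1) - G 2%N a) / 12| <= B / 6.
Proof.
move=> dG bG.
have f4 : 4`!%:R = 24 :> R by [].
have f3 : 3`!%:R = 6 :> R by [].
have f2 : 2`!%:R = 2 :> R by [].
have f1 : 1`!%:R = 1 :> R by [].
have t0 : `|G 0%N (a + 1) - (G 0%N a + G 1%N a + G 2%N a / 2 + G 3%N a / 6)| <= B / 24.
  have := @taylor_pos R G 4 a B 1 ler01 dG bG.
  by rewrite !big_ord_recr big_ord0 /= add0r !expr1n f1 f2 f3 f4 !mulr1 !divr1.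
have t1 : `|G 1%N (a + 1) - (G 1%N a + G 2%N a + G 3%N a / 2)| <= B / 6.
  have := @taylor_pos R (fun i => G i.+1) 3 a B 1 ler01 _ bG.
  rewrite !big_ord_recr big_ord0 /= add0r !expr1n f1 f2 f3 !mulr1 !divr1; apply.
  by move=> i x i3 xa; apply: dG.
have t2 : `|G 2%N (a + 1) - (G 2%N a + G 3%N a)| <= B / 2.
  have := @taylor_pos R (fun i => G i.+2) 2 a B 1 ler01 _ bG.
  rewrite !big_ord_recr big_ord0 /= add0r !expr1n f1 f2 !mulr1 !divr1; apply.
  by move=> i x i3 xa; apply: dG.
set e0 := (X in `|X| <= _) in t0; set e1 := (X in `|X| <= _) in t1.
set e2 := (X in `|X| <= _) in t2.
have -> : (G 1%N a + G 1%N (a + 1)) / 2 - (G 0%N (a + 1) - G 0%N a)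
     - (G 2%N (a + 1) - G 2%N a) / 12 = e1 / 2 - e0 - e2 / 12.
  by rewrite /e0 /e1 /e2; field.
move: t0 t1 t2; rewrite !ler_norml => /andP[? ?] /andP[? ?] /andP[? ?].
by apply/andP; split; lra.
Qed.

Lemma inv_cvg0 (c : R) (k : nat) : (fun n : nat => c * n%:R^-1 ^+ k.+1) @ \oo --> (0 : R).
Proof.
have -> : (0 : R) = c * 0 ^+ k.+1 by rewrite expr0n /= mulr0.
apply: cvgM; first exact: cvg_cst.
apply: (@cvg_comp _ _ _ (fun n : nat => n%:R^-1 : R) (fun x => x ^+ k.+1) _ (nbhs (0:R))).
  by rewrite -cvg_shiftS; exact: cvg_harmonic.
exact: exprn_continuous.
Qed.
End EulerMaclaurin.

(** * Expansions of ln n! and of the sum of i ln i *)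

Section Stirling.
Variable R : realType.
Implicit Types (n N : nat).

Lemma dv_ln (x : R) : 0 < x -> dv (@ln R) x x^-1.
Proof. by move=> x0; exact: is_derive1_ln. Qed.

Definition lnfact n : R := \sum_(i < n) ln i.+1%:R.
Definition sumilni n : R := \sum_(i < n) (i.+1%:R * ln i.+1%:R).

Lemma lnfactE n : ln (n`!%:R : R) = lnfact n.
Proof.
elim: n => [|n IH]; first by rewrite /lnfact big_ord0 fact0 ln1.
by rewrite /lnfact big_ord_recr /= factS natrM lnM ?posrE ?ltr0n ?fact_gt0 // IH addrC.
Qed.

(** Euler-Maclaurin with the antiderivative [v ln v - v] of [ln]. *)
Definition stirling_main (x : R) := x * ln x - x + ln x / 2 + (12 * x)^-1.
(** Euler-Maclaurin with the antiderivative [v^2 ln v / 2 - v^2 / 4] of [v ln v],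
without the constant [1/12] that the last term would add. *)
Definition glaisher_main (x : R) := x ^+ 2 / 2 * ln x - x ^+ 2 / 4 + x * ln x / 2 + ln x / 12.

Lemma lnfact_cvg : exists2 k : R, (fun n => lnfact n - stirling_main n%:R) @ \oo --> k &
  forall n, (0 < n)%N -> `|lnfact n - stirling_main n%:R - k| <= (n%:R ^+ 2)^-1.
Proof.
pose G i (v : R) := match i with 0 => v * ln v - v | 1 => ln v | 2 => v^-1 | 3 => - v^-1 ^+ 2
  | _ => 2 * v^-1 ^+ 3 end.
have dG i v : (i < 4)%N -> 0 < v -> dv (G i) v (G i.+1 v).
  move=> i4 v0; have vn := lt0r_neq0 v0.
  case: i i4 => [|[|[|[|i]]]] i4.
  - apply: dv_eq; first exact: (dvD (dvM (dvI _) (dv_ln v0)) (dvN (dvI _))).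
    by rewrite /G; field.
  - exact: dv_ln.
  - by apply: dv_eq; [exact: (dvV vn (dvI _)) | rewrite /G; ring].
  - by apply: dv_eq; [exact: (dvN (dvX 2 (dvV vn (dvI _)))) | rewrite /G /=; ring].
  - by [].
pose u n := lnfact n - stirling_main n%:R.
have := @cvg_telescope R u (fun n => 1 * n%:R^-1 ^+ 2) 1 _ (inv_cvg0 1 1).
case.
  move=> n n1; have a0 : 0 < n%:R :> R by rewrite ltr0n.
  set a : R := n%:R in a0 *.
  have H1 i x : (i < 4)%N -> a <= x <= a + 1 -> dv (G i) x (G i.+1 x).
    by move=> i4 xa; apply: dG => //; lra.
  have H2 x : a <= x <= a + 1 -> `|G 4%N x| <= 2 * a^-1 ^+ 3.
    move=> xa; have x0 : 0 < x by lra.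
    rewrite /G ger0_norm; last by rewrite mulr_ge0 // exprn_ge0 // invr_ge0 ltW.
    apply: ler_wpM2l => //; apply: lerXn2r; rewrite ?nnegrE ?invr_ge0; [exact: ltW|exact: ltW|].
    by rewrite lef_pV2 ?posrE //; lra.
  have := euler_maclaurin_step H1 H2.
  have -> : u n.+1 - u n = (G 1%N a + G 1%N (a + 1)) / 2 - (G 0%N (a + 1) - G 0%N a)
     - (G 2%N (a + 1) - G 2%N a) / 12.
    rewrite /u /lnfact big_ord_recr /= -[n.+1%:R]natr1 -/a /stirling_main /G.
    by field; apply/andP; split; apply: lt0r_neq0; lra.
  move=> /le_trans; apply; rewrite -[n.+1%:R]natr1 -/a !mul1r.
  have b0 : 0 < a + 1 by lra.
  have a1 : 1 <= a by rewrite ler1n.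
  rewrite -subr_ge0.
  have -> : a^-1 ^+ 2 - (a + 1)^-1 ^+ 2 - 2 * a^-1 ^+ 3 / 6 =
    (5 * a ^+ 2 + a - 1) / (3 * a ^+ 3 * (a + 1) ^+ 2).
    by field; apply/andP; split; apply: lt0r_neq0.
  apply: divr_ge0; first by nra.
  by rewrite !mulr_ge0 ?exprn_ge0 // ltW.
move=> l ul hl; exists l => // n n0.
by rewrite distrC; have := hl n n0; rewrite mul1r exprVn.
Qed.

Lemma sumilni_cvg : exists2 k : R, (fun n => sumilni n - glaisher_main n%:R) @ \oo --> k &
  forall n, (0 < n)%N -> `|sumilni n - glaisher_main n%:R - k| <= n%:R^-1.
Proof.
pose G i (v : R) := match i with 0 => v ^+ 2 / 2 * ln v - v ^+ 2 / 4 | 1 => v * ln v | 2 => ln v + 1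
  | 3 => v^-1 | _ => - v^-1 ^+ 2 end.
have dG i v : (i < 4)%N -> 0 < v -> dv (G i) v (G i.+1 v).
  move=> i4 v0; have vn := lt0r_neq0 v0.
  case: i i4 => [|[|[|[|i]]]] i4.
  - apply: dv_eq.
      exact: (dvD (dvM (dvM (dvX 2 (dvI _)) (dvC _ _)) (dv_ln v0)) (dvN (dvM (dvX 2 (dvI _)) (dvC _ _)))).
    by rewrite /G /=; field.
  - by apply: dv_eq; [exact: (dvM (dvI _) (dv_ln v0)) | rewrite /G; field].
  - by apply: dv_eq; [exact: (dvD (dv_ln v0) (dvC _ _)) | rewrite /G; ring].
  - by apply: dv_eq; [exact: (dvV vn (dvI _)) | rewrite /G; ring].
  - by [].
pose u n := sumilni n - glaisher_main n%:R.
have := @cvg_telescope R u (fun n => 1 * n%:R^-1 ^+ 1) 1 _ (inv_cvg0 1 0).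
case.
  move=> n n1; have a0 : 0 < n%:R :> R by rewrite ltr0n.
  set a : R := n%:R in a0 *.
  have H1 i x : (i < 4)%N -> a <= x <= a + 1 -> dv (G i) x (G i.+1 x).
    by move=> i4 xa; apply: dG => //; lra.
  have H2 x : a <= x <= a + 1 -> `|G 4%N x| <= a^-1 ^+ 2.
    move=> xa; have x0 : 0 < x by lra.
    rewrite /G normrN ger0_norm; last exact: sqr_ge0.
    apply: lerXn2r; rewrite ?nnegrE ?invr_ge0; [exact: ltW|exact: ltW|].
    by rewrite lef_pV2 ?posrE //; lra.
  have := euler_maclaurin_step H1 H2.
  have -> : u n.+1 - u n = (G 1%N a + G 1%N (a + 1)) / 2 - (G 0%N (a + 1) - G 0%N a)
     - (G 2%N (a + 1) - G 2%N a) / 12.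
    rewrite /u /sumilni big_ord_recr /= -[n.+1%:R]natr1 -/a /glaisher_main /G.
    by field.
  move=> /le_trans; apply; rewrite -[n.+1%:R]natr1 -/a !mul1r !expr1.
  have b0 : 0 < a + 1 by lra.
  have a1 : 1 <= a by rewrite ler1n.
  rewrite -subr_ge0.
  have -> : a^-1 - (a + 1)^-1 - a^-1 ^+ 2 / 6 = (5 * a - 1) / (6 * a ^+ 2 * (a + 1)).
    by field; apply/andP; split; apply: lt0r_neq0.
  apply: divr_ge0; first by lra.
  by rewrite !mulr_ge0 ?exprn_ge0 // ltW.
move=> l ul hl; exists l => // n n0.
by rewrite distrC; have := hl n n0; rewrite mul1r expr1.
Qed.

(** The integrals of [sin^n] over a quarter period; the recurrence is integration by
parts. *)
Lemma wallis : exists W : nat -> R,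
  [/\ W 0%N = pi / 2, W 1%N = 1, (forall n, W n.+1 <= W n),
     (forall n, 0 <= W n) & forall n, n.+2%:R * W n.+2 = n.+1%:R * W n].
Proof.
have cs n : continuous (fun t : R => sin t ^+ n).
  by move=> t; exact: dv_cont (dvX n (dvsin (dvI t))).
pose I n := projT1 (cid2 (antiderivative (cs n))).
have I0 n : I n 0 = 0 by rewrite /I; case: cid2.
have dI n t : dv (I n) t (sin t ^+ n) by rewrite /I; case: cid2.
have p0 : 0 <= pi / 2 :> R by rewrite divr_ge0 ?pi_ge0.
have s01 (t : R) : 0 <= t <= pi / 2 -> 0 <= sin t <= 1.
  move=> tp; rewrite sin_le1 andbT; apply: sin_ge0_pi; have := pi_ge0 R; lra.
exists (fun n => I n (pi / 2)); split.
- have := dv_unique p0 (fun t _ => dI 0%N t) (fun t _ => dvI t).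
  by rewrite I0 !subr0.
- have dc t : dv (fun t : R => - cos t) t (sin t ^+ 1).
    by apply: dv_eq; [exact: (dvN (dvcos (dvI t))) | ring].
  have := dv_unique p0 (fun t _ => dI 1%N t) (fun t _ => dc t).
  by rewrite I0 cos_pihalf cos0; lra.
- move=> n; suff : I n.+1 (pi / 2) - I n.+1 0 <= I n (pi / 2) - I n 0 by rewrite !I0 !subr0.
  apply: (dv_le p0 (fun t _ => dI n.+1 t) (fun t _ => dI n t)) => t tp.
  by have /andP[s0 s1] := s01 t tp; rewrite exprS ler_piMl // exprn_ge0.
- move=> n; suff : I n 0 <= I n (pi / 2) by rewrite I0.
  apply: (dv_nondecr p0 (fun t _ => dI n t)) => t tp.
  by have /andP[s0 s1] := s01 t tp; rewrite exprn_ge0.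
- move=> n; have dd t : dv (fun t => n.+1%:R * I n t - cos t * sin t ^+ n.+1) t
     (n.+2%:R * sin t ^+ n.+2).
    apply: dv_eq.
      exact: (dvD (dvcM _ (dI n t)) (dvN (dvM (dvcos (dvI t)) (dvX n.+1 (dvsin (dvI t)))))).
    rewrite /= !exprS -[n.+2%:R]natr1.
    have c2 := cos2Dsin2 t.
    have -> : n.+1%:R * sin t ^+ n - (- sin t * 1 * (sin t * sin t ^+ n) +
      cos t * (n.+1%:R * sin t ^+ n * (cos t * 1))) =
      n.+1%:R * sin t ^+ n * (1 - cos t ^+ 2) + sin t ^+ 2 * sin t ^+ n by ring.
    have -> : 1 - cos t ^+ 2 = sin t ^+ 2 by rewrite -c2; ring.
    by ring.
  have := dv_unique p0 (fun t _ => dvcM n.+2%:R (dI n.+2 t)) (fun t _ => dd t).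
  by rewrite !I0 cos_pihalf sin0 expr0n /=; lra.
Qed.

(** [(n + 1) W n W (n + 1)] is constant and [W] is nonincreasing, which determines
[W (2 m)] up to a factor [1 + O(1/m)].  As [W (2 m)] is also a quotient of factorials,
this fixes the constant of [lnfact_cvg]. *)
Lemma stirling : (forall n, (0 < n)%N ->
  `|lnfact n - stirling_main n%:R - ln (2 * pi) / 2| <= (n%:R ^+ 2)^-1).
Proof.
have [k _ hk] := lnfact_cvg.
suff -> : ln (2 * pi) / 2 = k by [].
have [W [W0 W1 Wd Wge Wr]] := wallis.
have pi0 := pi_gt0 R.
have prod n : n.+1%:R * (W n * W n.+1) = pi / 2.
  elim: n => [|n IH]; first by rewrite W0 W1; field.
  by rewrite mulrCA Wr -IH; ring.
have Wpos n : 0 < W n.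
  rewrite lt_neqAle Wge andbT; apply/eqP => h; have := prod n.
  by rewrite -h mul0r mulr0; lra.
(* [W (2 m) = (pi / 2) (2 m)! / (4^m m!^2)]. *)
have lnW m : ln (W (2 * m)%N) = ln (pi / 2) + lnfact (2 * m) - (2 * m)%:R * ln 2 - 2 * lnfact m.
  elim: m => [|m IH].
    by rewrite muln0 W0 /lnfact !big_ord0; ring.
  have -> : (2 * m.+1 = (2 * m).+2)%N by lia.
  have w : W (2 * m).+2 = (2 * m).+1%:R * ((2 * m).+2%:R)^-1 * W (2 * m)%N.
    have := Wr (2 * m)%N; have : (2 * m).+2%:R != 0 :> R by rewrite pnatr_eq0.
    by move=> a b; rewrite mulrAC -b; field.
  have q1 : 0 < (2 * m).+1%:R :> R by rewrite ltr0n.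
  have q2 : 0 < (2 * m).+2%:R :> R by rewrite ltr0n.
  have -> : ln (W (2 * m).+2) = ln (2 * m).+1%:R - ln (2 * m).+2%:R + ln (W (2 * m)%N).
    by rewrite w lnM ?posrE ?Wpos ?divr_gt0 // ln_div ?posrE.
  rewrite IH /lnfact !big_ord_recr /=.
  have -> : ((2 * m).+2%:R : R) = 2 * m.+1%:R.
    by rewrite -natrM; congr (_%:R); lia.
  have -> : ln (2 * m.+1%:R) = ln 2 + ln m.+1%:R :> R by rewrite lnM ?posrE ?ltr0n.
  have -> : (2 * m.+1%:R : R) = (2 * m)%:R + 2 by rewrite natrM -natr1; ring.
  by ring.
(* [W (2 m + 1) <= W (2 m) <= W (2 m - 1) = (1 + 1 / (2 m)) W (2 m + 1)]. *)
have sq m : (0 < m)%N -> `|2 * ln (W (2 * m)%N) + ln (2 * m).+1%:R - ln (pi / 2)| <= (2 * m%:R)^-1.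
  move=> m0; set M := (2 * m)%N.
  have M0 : 0 < M%:R :> R by rewrite ltr0n /M muln_gt0.
  have M1 : 0 < M.+1%:R :> R by rewrite ltr0n.
  have h1 : ln (pi / 2) = ln M.+1%:R + (ln (W M) + ln (W M.+1)).
    by rewrite -(prod M) lnM ?posrE ?mulr_gt0 // lnM ?posrE.
  have h2 : ln (W M.+1) <= ln (W M) by rewrite ler_ln ?posrE.
  have h3 : ln (W M) <= ln (W M.+1) + (2 * m%:R)^-1.
    have : W M <= W M.+1 * (1 + M%:R^-1).
      have -> : 1 + M%:R^-1 = M.+1%:R / M%:R :> R.
        by rewrite -natr1; field; exact: lt0r_neq0.
      rewrite mulrA ler_pdivlMr // mulrC [leRHS]mulrC.
      have e := Wr M.-1; have eM : M.-1.+1 = M by rewrite prednK // /M muln_gt0.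
      rewrite eM in e; rewrite e; apply: ler_wpM2l; first exact: ltW.
      by have := Wd M.-1; rewrite eM.
    have r0 : 0 < 1 + M%:R^-1 :> R by have := M0; rewrite -invr_gt0; lra.
    rewrite -ler_ln ?posrE ?mulr_gt0 // lnM ?posrE // => /le_trans; apply.
    rewrite lerD2l; have -> : (2 * m%:R)^-1 = M%:R^-1 :> R by rewrite /M natrM.
    by apply: le_ln1Dx; have := M0; rewrite -invr_gt0; lra.
  rewrite h1 ler_norml; apply/andP; split; last by lra.
  have : 0 <= (2 * m%:R)^-1 :> R by rewrite invr_ge0 mulr_ge0.
  lra.
have main m : (0 < m)%N -> `|ln (2 * pi) - 2 * k| <= 20 / m%:R.
  move=> m0; have s := sq m m0.
  have m0' : 0 < m%:R :> R by rewrite ltr0n.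
  have m1 : 1 <= m%:R :> R by rewrite ler1n.
  have k1 := hk m m0; have k2 := hk (2 * m)%N; rewrite muln_gt0 m0 /= in k2.
  have {}k2 := k2 isT.
  rewrite lnW in s.
  have e2 : (2 * m)%:R = 2 * m%:R :> R by rewrite natrM.
  have e3 : (2 * m).+1%:R = 2 * m%:R + 1 :> R by rewrite -natr1 e2.
  rewrite e2 in k2; rewrite e2 e3 in s.
  set x : R := m%:R in m0' m1 s k1 k2 *.
  have ln2x : ln (2 * x) = ln 2 + ln x by rewrite lnM ?posrE.
  have ln2x1 : 0 <= ln (2 * x + 1) - ln (2 * x) <= (2 * x)^-1.
    have -> : 2 * x + 1 = 2 * x * (1 + (2 * x)^-1) by field; exact: lt0r_neq0.
    have y0 : 0 < (2 * x)^-1 by rewrite invr_gt0; lra.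
    rewrite lnM ?posrE; [|lra|lra].
    have -> : ln (2 * x) + ln (1 + (2 * x)^-1) - ln (2 * x) = ln (1 + (2 * x)^-1) by ring.
    by rewrite ln_ge0 ?le_ln1Dx //; lra.
  have lp : ln (2 * pi) = ln 2 + ln pi :> R by rewrite lnM ?posrE.
  have lp2 : ln (pi / 2) = ln pi - ln 2 :> R by rewrite ln_div ?posrE.
  have xi : x^-1 * x = 1 by rewrite mulVf // lt0r_neq0.
  have xi0 : 0 < x^-1 by rewrite invr_gt0.
  have xi1 : x^-1 <= 1 by rewrite invf_le1.
  have q1 : (x ^+ 2)^-1 <= x^-1 by rewrite -exprVn expr2 ler_piMl // ltW.
  have q2 : ((2 * x) ^+ 2)^-1 <= x^-1.
    by rewrite lef_pV2 ?posrE ?exprn_gt0 //; [rewrite expr2; nra|lra].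
  have q3 : (2 * x)^-1 = x^-1 / 2 by field; exact: lt0r_neq0.
  have q4 : (12 * (2 * x))^-1 = x^-1 / 24 by field; exact: lt0r_neq0.
  have q5 : (12 * x)^-1 = x^-1 / 12 by field; exact: lt0r_neq0.
  move: k1 k2 s ln2x1; rewrite /stirling_main q3 q4 q5 ln2x lp lp2 !ler_norml.
  move: q1 q2 xi0; rewrite -/(20 * x^-1).
  set l1 := lnfact m; set l2 := lnfact (2 * m).
  move=> q1 q2 xi0 /andP[a1 a2] /andP[b1 b2] /andP[c1 c2] /andP[d1 d2].
  by clear -q1 q2 xi0 a1 a2 b1 b2 c1 c2 d1 d2; apply/andP; split; lra.
have z : ln (2 * pi) - 2 * k = 0.
  apply/eqP; rewrite -normr_le0 leNgt; apply/negP => e0.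
  set e := `|_| in e0 main.
  pose m := (Num.truncn (20 / e)).+1.
  have := main m (ltn0Sn _); rewrite ler_pdivlMr ?ltr0n // => h.
  have : 20 / e < m%:R by rewrite /m truncnS_gt.
  by rewrite ltr_pdivrMr // mulrC; lra.
by lra.
Qed.

End Stirling.

(** * A real-valued norm on the complex numbers *)

Section ComplexNorm.
Variable R : realType.
Implicit Types (z x y : Cplx R).
Local Notation Re := (@complex.Re R).
Local Notation Im := (@complex.Im R).

(** The modulus of [Cplx R] takes its values in [Cplx R] itself; the sum norm is real
and spares square roots. *)
Definition nrm z : R := `|Re z| + `|Im z|.

Lemma ReD x y : Re (x + y) = Re x + Re y. Proof. by case: x; case: y. Qed.
Lemma ImD x y : Im (x + y) = Im x + Im y. Proof. by case: x; case: y. Qed.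
Lemma ReN x : Re (- x) = - Re x. Proof. by case: x. Qed.
Lemma ImN x : Im (- x) = - Im x. Proof. by case: x. Qed.
Lemma ReM x y : Re (x * y) = Re x * Re y - Im x * Im y. Proof. by case: x; case: y. Qed.
Lemma ImM x y : Im (x * y) = Re x * Im y + Im x * Re y.
Proof. by case: x => a b; case: y => c d. Qed.
Lemma cplx_eq x y : Re x = Re y -> Im x = Im y -> x = y.
Proof. by case: x => a b; case: y => c d /= -> ->. Qed.

Definition rc (a : R) : Cplx R := Complex a 0.

Lemma nrm_ge0 z : 0 <= nrm z. Proof. exact: addr_ge0. Qed.
Lemma nrm0 : nrm 0 = 0. Proof. by rewrite /nrm /= normr0 addr0. Qed.
Lemma nrmN z : nrm (- z) = nrm z. Proof. by rewrite /nrm ReN ImN !normrN. Qed.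

Lemma nrmD x y : nrm (x + y) <= nrm x + nrm y.
Proof.
rewrite /nrm ReD ImD; have := ler_normD (Re x) (Re y).
by have := ler_normD (Im x) (Im y); lra.
Qed.

Lemma nrmB x y : nrm (x - y) <= nrm x + nrm y.
Proof. by apply: le_trans (nrmD _ _) _; rewrite nrmN. Qed.

Lemma nrmM x y : nrm (x * y) <= nrm x * nrm y.
Proof.
rewrite /nrm ReM ImM.
have := ler_normB (Re x * Re y) (Im x * Im y); have := ler_normD (Re x * Im y) (Im x * Re y).
by rewrite !normrM; lra.
Qed.

Lemma nrm_rcM a z : nrm (rc a * z) = `|a| * nrm z.
Proof.
by rewrite /nrm ReM ImM /= !mul0r subr0 addr0 !normrM mulrDr.
Qed.

Lemma nrm_rc a : nrm (rc a) = `|a|. Proof. by rewrite /nrm /= normr0 addr0. Qed.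

Lemma nrm_eq0 z : nrm z = 0 -> z = 0.
Proof.
rewrite /nrm => h; apply: cplx_eq; apply/eqP; rewrite -normr_le0;
by have := normr_ge0 (Re z); have := normr_ge0 (Im z); lra.
Qed.

Lemma rcD a b : rc (a + b) = rc a + rc b. Proof. by apply: cplx_eq; rewrite /= ?addr0. Qed.
Lemma rcM a b : rc (a * b) = rc a * rc b.
Proof. by apply: cplx_eq; rewrite ?ReM ?ImM /=; ring. Qed.
Lemma rcX a n : rc (a ^+ n) = rc a ^+ n.
Proof. by elim: n => [|n IH] //; rewrite !exprS rcM IH. Qed.
Lemma rc1 : rc 1 = 1. Proof. by []. Qed.
Lemma rc0 : rc 0 = 0. Proof. by []. Qed.

Lemma nrmX z n : nrm (z ^+ n) <= nrm z ^+ n.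
Proof.
elim: n => [|n IH]; first by rewrite !expr0 nrm_rc normr1.
rewrite !exprS; apply: le_trans (nrmM _ _) _.
by apply: ler_wpM2l => //; exact: nrm_ge0.
Qed.

Lemma nrm_sum n (f : nat -> Cplx R) : nrm (\sum_(i < n) f i) <= \sum_(i < n) nrm (f i).
Proof.
elim: n => [|n IH]; first by rewrite !big_ord0 nrm0.
by rewrite !big_ord_recr /=; apply: le_trans (nrmD _ _) _; rewrite lerD2r.
Qed.

Lemma nrm_norm z : (`|z| <= rc (nrm z)) /\ nrm z <= 2 * Re `|z|.
Proof.
case: z => a b; rewrite normc_def /rc /nrm /= lecE /= eqxx /=.
have h : 0 <= a ^+ 2 + b ^+ 2 by rewrite addr_ge0 ?sqr_ge0.
have sa : Num.sqrt (a ^+ 2 + b ^+ 2) ^+ 2 = a ^+ 2 + b ^+ 2 by rewrite sqr_sqrtr.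
have ge := sqrtr_ge0 (a ^+ 2 + b ^+ 2).
have na := normr_ge0 a; have nb := normr_ge0 b.
have a2 : `|a| ^+ 2 = a ^+ 2 by rewrite real_normK ?num_real.
have b2 : `|b| ^+ 2 = b ^+ 2 by rewrite real_normK ?num_real.
split.
  by rewrite -(@ler_pXn2r _ 2) ?nnegrE ?addr_ge0 // sa -a2 -b2; nra.
have : `|a| <= Num.sqrt (a ^+ 2 + b ^+ 2).
  by rewrite -(@ler_pXn2r _ 2) ?nnegrE // sa -a2 -b2; nra.
have : `|b| <= Num.sqrt (a ^+ 2 + b ^+ 2).
  by rewrite -(@ler_pXn2r _ 2) ?nnegrE // sa -a2 -b2; nra.
lra.
Qed.

Lemma norm_real z : `|z| = rc (Re `|z|).
Proof. by case: z => a b; rewrite normc_def. Qed.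

(** Convergence in terms of [nrm]; [cvg_ctends] relates it to the topology of the
modulus. *)
Definition ctends (u : nat -> Cplx R) (l : Cplx R) :=
  forall e : R, 0 < e -> exists N, forall n, (N <= n)%N -> nrm (u n - l) <= e.

Lemma cvg_ctends (u : nat -> Cplx R) (l : Cplx R) : u @ \oo --> l -> ctends u l.
Proof.
move=> /cvgrPdist_lt ul e e0.
have e2 : (0 : Cplx R) < rc (e / 2) by rewrite ltcE /= eqxx /= divr_gt0.
have [N _ hN] := ul _ e2; exists N => n Nn.
have := hN n Nn; rewrite /= distrC ltcE => /andP[_ h].
have {}h : Re `|u n - l| < e / 2 := h.
by have [_] := nrm_norm (u n - l); lra.
Qed.

Lemma near_cplx (P : Cplx R -> Prop) (z0 : Cplx R) :
  (\forall z \near z0, P z) -> exists2 r : R, 0 < r & forall z, nrm (z - z0) < r -> P z.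
Proof.
move=> /nbhs_ballP[e /= e0 he].
exists (Re e).
  by move: e0; rewrite ltcE => /andP[].
move=> z hz; apply: he; rewrite /ball /= distrC.
have [h _] := nrm_norm (z - z0); apply: le_lt_trans h _.
by move: e0; rewrite !ltcE /= => /andP[/eqP -> _]; rewrite eqxx.
Qed.

End ComplexNorm.

(** * Power series along a line *)

Section PowerSeries.
Variable R : realType.
Local Notation C := (Cplx R).
Local Notation Re := (@complex.Re R).
Local Notation Im := (@complex.Im R).
Implicit Types (c d : nat -> C) (t : R) (z : C).

Lemma ctendsD u v (x y : C) : ctends u x -> ctends v y -> ctends (fun n => u n + v n) (x + y).
Proof.
move=> ux vy e e0; have e2 : 0 < e / 2 by lra.
have [N hN] := ux _ e2; have [M hM] := vy _ e2; exists (maxn N M) => n.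
rewrite geq_max => /andP[/hN h1 /hM h2].
have -> : u n + v n - (x + y) = (u n - x) + (v n - y) by ring.
by apply: le_trans (nrmD _ _) _; lra.
Qed.

Lemma ctendsZ u (a x : C) : ctends u x -> ctends (fun n => a * u n) (a * x).
Proof.
move=> ux e e0; have e2 : 0 < e / (nrm a + 1).
  by rewrite divr_gt0 //; have := nrm_ge0 a; lra.
have [N hN] := ux _ e2; exists N => n /hN h.
rewrite -mulrBr; apply: le_trans (nrmM _ _) _.
apply: le_trans (_ : (nrm a + 1) * (e / (nrm a + 1)) <= _).
  by apply: ler_pM => //; rewrite ?nrm_ge0 //; have := nrm_ge0 a; lra.
by rewrite mulrC divfK //; apply: lt0r_neq0; have := nrm_ge0 a; lra.
Qed.

Lemma ctends_unique u (x y : C) : ctends u x -> ctends u y -> x = y.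
Proof.
move=> ux uy; apply/eqP; rewrite -subr_eq0; apply/eqP; apply: nrm_eq0.
apply/eqP; rewrite eq_le nrm_ge0 andbT leNgt; apply/negP => e0.
have e3 : 0 < nrm (x - y) / 3 by rewrite divr_gt0.
have [N hN] := ux _ e3; have [M hM] := uy _ e3.
have h1 := hN _ (leq_maxl N M); have h2 := hM _ (leq_maxr N M).
have : nrm (x - y) <= nrm (u (maxn N M) - y) + nrm (u (maxn N M) - x).
  have {1}-> : x - y = (u (maxn N M) - y) - (u (maxn N M) - x) by ring.
  exact: nrmB.
lra.
Qed.

Lemma ctends_ext u v (x : C) : (forall n, u n = v n) -> ctends u x -> ctends v x.
Proof. by move=> e; have -> : v = u by apply/funext => n; rewrite e. Qed.

Lemma ctends_cst (x : C) : ctends (fun=> x) x.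
Proof. by move=> e e0; exists 0%N => n _; rewrite subrr nrm0 ltW. Qed.

Definition psum c t n : C := \sum_(k < n) c k * rc t ^+ k.

Lemma psumS c t n : psum c t n.+1 = psum c t n + c n * rc t ^+ n.
Proof. by rewrite /psum big_ord_recr. Qed.

(** Real arguments suffice, since all expansions are taken along a straight line: a
function [f] near [z0] is expanded as [t -> f (z0 + w t)]. *)
Definition sums c t z := ctends (psum c t) z.

Lemma sums_term c t z : sums c t z -> ctends (fun n => c n * rc t ^+ n) 0.
Proof.
move=> h e e0; have e2 : 0 < e / 2 by lra.
have [N hN] := h _ e2; exists N => n Nn.
have h1 := hN n Nn; have h2 := hN n.+1 (leq_trans Nn (leqnSn _)).
have -> : c n * rc t ^+ n - 0 = (psum c t n.+1 - z) - (psum c t n - z).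
  by rewrite /psum big_ord_recr /=; ring.
by apply: le_trans (nrmB _ _) _; lra.
Qed.

Lemma sums_coef_bounded c t z : 0 < t -> sums c t z ->
  exists2 B : R, 0 <= B & forall k, nrm (c k) * t ^+ k <= B.
Proof.
move=> t0 cz; have [N hN] := sums_term cz ltr01.
have ge0 k : 0 <= nrm (c k) * t ^+ k.
  by rewrite mulr_ge0 ?nrm_ge0 // exprn_ge0 // ltW.
exists (1 + \sum_(k < N) nrm (c k) * t ^+ k); first by rewrite addr_ge0 // sumr_ge0.
move=> k; have [Nk|kN] := leqP N k.
  have := hN k Nk; rewrite subr0 mulrC -rcX nrm_rcM ger0_norm ?exprn_ge0 ?(ltW t0) // mulrC => h.
  by apply: le_trans h _; rewrite lerDl sumr_ge0.
rewrite (bigD1 (Ordinal kN)) //=.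
have : 0 <= \sum_(i < N | i != Ordinal kN) nrm (c i) * t ^+ i by rewrite sumr_ge0.
by lra.
Qed.

Lemma sumsD c d t x y : sums c t x -> sums d t y -> sums (fun k => c k + d k) t (x + y).
Proof.
move=> cx dy; apply: ctends_ext (ctendsD cx dy) => n.
by rewrite /psum -big_split /=; apply: eq_bigr => i _; ring.
Qed.

Lemma sumsZ c t z (a : C) : sums c t z -> sums (fun k => a * c k) t (a * z).
Proof.
move=> cz; apply: ctends_ext (ctendsZ a cz) => n.
by rewrite /psum big_distrr /=; apply: eq_bigr => i _; ring.
Qed.

Variable w : C.

(** The coefficients of the product of [a - w t] and the series with coefficients
[c]. *)
Definition lin (a : C) c : nat -> C := fun k => a * c k - (if k is j.+1 then w * c j else 0).

Lemma sums_lin c t z (a : C) : sums c t z -> sums (lin a c) t ((a - w * rc t) * z).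
Proof.
move=> cz; have tz := sums_term cz.
have e n : psum (lin a c) t n.+1 =
   (a - w * rc t) * psum c t n.+1 + (w * rc t) * (c n * rc t ^+ n).
  elim: n => [|n IH].
    by rewrite /psum !big_ord_recr !big_ord0 /= /lin expr0; ring.
  rewrite psumS IH [in RHS]psumS /lin exprS.
  by ring.
have h := ctendsD (ctendsZ (a - w * rc t) cz) (ctendsZ (w * rc t) tz).
rewrite mulr0 addr0 in h.
move=> e0 e00; have [N hN] := h e0 e00.
have h2 : ctends (fun n => (a - w * rc t) * psum c t n.+1 + (w * rc t) * (c n * rc t ^+ n)) ((a - w * rc t) * z).
  have h3 : ctends (fun n => psum c t n.+1) z.
    by move=> e1 e10; have [N1 hN1] := cz e1 e10; exists N1 => n nN; apply: hN1; exact: leq_trans (leqnSn _).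
  by have := ctendsD (ctendsZ (a - w * rc t) h3) (ctendsZ (w * rc t) tz); rewrite mulr0 addr0.
have [M hM] := h2 e0 e00; exists M.+1 => -[|n] // nM.
by rewrite e; apply: hM.
Qed.

(** Identity principle from one side.  The coefficients are geometrically bounded, so
that for small [t] the first nonzero term would dominate the rest of the series. *)
Lemma sums_zero c (r : R) : 0 < r -> (forall t, 0 < t -> t < r -> sums c t 0) -> forall k, c k = 0.
Proof.
move=> r0 hz.
pose r1 := r / 2.
have r10 : 0 < r1 by rewrite divr_gt0.
have [B B0 hB] := sums_coef_bounded r10 (hz r1 r10 (ltac:(rewrite /r1; lra))).
move=> k; elim/ltn_ind: k => m IH.
apply: nrm_eq0; apply/eqP; rewrite eq_le nrm_ge0 andbT leNgt; apply/negP => cm.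
(* The terms after the one of order [m] are a geometric tail of ratio
   [t / r1 <= 1/2]; since the sum is 0, they bound the term of order [m]. *)
have key t : 0 < t -> t <= r1 / 2 -> nrm (c m) <= 2 * B / r1 ^+ m.+1 * t.
  move=> t0 tr.
  have hs := hz t t0 (ltac:(rewrite /r1 in tr; lra)).
  have q0 : 0 <= t / r1 by rewrite divr_ge0 ?ltW.
  have q1 : t / r1 <= 1/2 by rewrite ler_pdivrMr //; lra.
  have tail n : nrm (psum c t (m.+1 + n) - c m * rc t ^+ m) <=
      B * (t / r1) ^+ m.+1 * (2 - 2 * (t / r1) ^+ n).
    elim: n => [|n IHn].
      rewrite addn0 /psum big_ord_recr /= big1 ?add0r ?subrr ?nrm0.
        by rewrite expr0 mulr1 subrr mulr0.
      by move=> i _; rewrite IH // mul0r.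
    rewrite addnS /psum big_ord_recr -/(psum _ _ _) /= addrAC.
    apply: le_trans (nrmD _ _) _.
    have e1 : nrm (c (m.+1 + n)%N * rc t ^+ (m.+1 + n)) <= B * (t / r1) ^+ m.+1 * (t / r1) ^+ n.
      rewrite mulrC -rcX nrm_rcM ger0_norm ?exprn_ge0 ?(ltW t0) // -mulrA -exprD.
      rewrite expr_div_n mulrA ler_pdivlMr ?exprn_gt0 // mulrAC -mulrA [leRHS]mulrC mulrC.
      rewrite [leRHS]mulrC; apply: ler_wpM2l; first exact: exprn_ge0 (ltW t0).
      by rewrite mulrC.
    have Bq : 0 <= B * (t / r1) ^+ m.+1 * (t / r1) ^+ n by rewrite !mulr_ge0 ?exprn_ge0.
    apply: le_trans (lerD IHn e1) _.
    rewrite [(t / r1) ^+ n.+1]exprS.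
    have : B * (t / r1) ^+ m.+1 * (t / r1) ^+ n * (t / r1) <= B * (t / r1) ^+ m.+1 * (t / r1) ^+ n * (1/2).
      exact: ler_wpM2l.
    by lra.
  have bound : nrm (c m) * t ^+ m <= B * (t / r1) ^+ m.+1 * 2.
    have -> : nrm (c m) * t ^+ m = nrm (c m * rc t ^+ m).
      by rewrite [c m * _]mulrC -rcX nrm_rcM ger0_norm ?exprn_ge0 ?(ltW t0) // mulrC.
    apply/ler_addgt0Pr => e e0; have [N hN] := hs e e0.
    have h1 := hN (m.+1 + N)%N (leq_addl _ _); rewrite subr0 in h1.
    have h2 := tail N.
    have -> : c m * rc t ^+ m = psum c t (m.+1 + N) - (psum c t (m.+1 + N) - c m * rc t ^+ m) by ring.
    apply: le_trans (nrmB _ _) _.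
    have : 0 <= B * (t / r1) ^+ m.+1 * (t / r1) ^+ N by rewrite !mulr_ge0 ?exprn_ge0.
    by lra.
  rewrite -(ler_pM2r (exprn_gt0 m t0)); apply: le_trans bound _.
  rewrite expr_div_n [t ^+ m.+1]exprS; rewrite le_eqVlt; apply/orP; left; apply/eqP.
  by field; apply: lt0r_neq0; exact: exprn_gt0.
pose K := 2 * B / r1 ^+ m.+1.
have K0 : 0 <= K by rewrite divr_ge0 ?mulr_ge0 // exprn_ge0 // ltW.
pose t := Num.min (r1 / 2) (nrm (c m) / (2 * (K + 1))).
have t0 : 0 < t.
  by rewrite lt_min !divr_gt0 //; lra.
have tr : t <= r1 / 2 by rewrite ge_min lexx.
have tK : t <= nrm (c m) / (2 * (K + 1)) by rewrite ge_min lexx orbT.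
have := key t t0 tr; rewrite -/K => h1.
have h2 : K * t <= (K + 1) * (nrm (c m) / (2 * (K + 1))).
  by apply: ler_pM => //; [exact: ltW|lra].
have h3 : (K + 1) * (nrm (c m) / (2 * (K + 1))) = nrm (c m) / 2.
  by field; apply: lt0r_neq0; lra.
lra.
Qed.

End PowerSeries.

(** * Limits of power series, coefficient by coefficient *)

Section CoefficientLimits.
Variable R : realType.
Local Notation C := (Cplx R).
Local Notation Re := (@complex.Re R).
Local Notation Im := (@complex.Im R).
Implicit Types (c d : nat -> C) (t : R) (z : C).

Lemma ctends_ReIm (u : nat -> C) (a b : R) :
  (fun n => Re (u n)) @ \oo --> a -> (fun n => Im (u n)) @ \oo --> b ->
  ctends u (Complex a b).
Proof.
move=> /cvgrPdist_le ua /cvgrPdist_le ub e e0; have e2 : 0 < e / 2 by lra.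
have [N _ hN] := ua _ e2; have [M _ hM] := ub _ e2; exists (maxn N M) => n.
rewrite geq_max => /andP[/hN /= h1 /hM /= h2].
rewrite /nrm ReD ImD ReN ImN /=.
by rewrite distrC in h1; rewrite distrC in h2; lra.
Qed.

Lemma ctends_le (u : nat -> C) (z : C) (B : R) n0 :
  ctends u z -> (forall n, (n0 <= n)%N -> nrm (u n) <= B) -> nrm z <= B.
Proof.
move=> uz hB; apply/ler_addgt0Pr => e e0; have [N hN] := uz e e0.
have h1 := hN _ (leq_maxl N n0); have h2 := hB _ (leq_maxr N n0).
have -> : z = u (maxn N n0) - (u (maxn N n0) - z) by ring.
by apply: le_trans (nrmB _ _) _; lra.
Qed.

Lemma ctends_telescope (u : nat -> C) (b : nat -> R) n0 :
  (forall n, (n0 <= n)%N -> nrm (u n.+1 - u n) <= b n - b n.+1) ->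
  b @ \oo --> (0 : R) -> exists z, ctends u z.
Proof.
move=> hu b0.
have H1 n : (n0 <= n)%N -> `|Re (u n.+1) - Re (u n)| <= b n - b n.+1.
  move=> nn; apply: le_trans (hu n nn); rewrite -ReN -ReD /nrm.
  by have := normr_ge0 (Im (u n.+1 - u n)); lra.
have [a ha _] := cvg_telescope H1 b0.
have H2 n : (n0 <= n)%N -> `|Im (u n.+1) - Im (u n)| <= b n - b n.+1.
  move=> nn; apply: le_trans (hu n nn); rewrite -ImN -ImD /nrm.
  by have := normr_ge0 (Re (u n.+1 - u n)); lra.
have [a' ha' _] := cvg_telescope H2 b0.
by exists (Complex a a'); exact: ctends_ReIm.
Qed.

Lemma psum_le c t (rho : R) n : `|t| <= rho -> nrm (psum c t n) <= \sum_(k < n) nrm (c k) * rho ^+ k.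
Proof.
move=> tr; apply: le_trans (nrm_sum n (fun k => c k * rc t ^+ k)) _; apply: ler_sum => i _.
rewrite mulrC -rcX nrm_rcM mulrC; apply: ler_wpM2l; first exact: nrm_ge0.
by rewrite normrX lerXn2r ?nnegrE //; exact: le_trans tr.
Qed.

Lemma psumB c d t n : psum c t n - psum d t n = psum (fun k => c k - d k) t n.
Proof. by rewrite /psum -sumrB; apply: eq_bigr => i _; ring. Qed.

Lemma ctends_big (u : nat -> nat -> C) (l : nat -> C) n :
  (forall k, ctends (u^~ k) (l k)) -> ctends (fun N => \sum_(k < n) u N k) (\sum_(k < n) l k).
Proof.
move=> h; elim: n => [|n IH].
  by apply: ctends_ext (@ctends_cst R _) => N; rewrite !big_ord0.
rewrite big_ord_recr /=; apply: ctends_ext (ctendsD IH (h n)) => N.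
by rewrite big_ord_recr.
Qed.

(** The increments of the coefficients are dominated, in the weighted sum norm of
radius [rho], by those of a null sequence.  Each coefficient then converges, and
the partial sums of the limit series are within [b N] of those of the [N]-th
series, uniformly in their length. *)
Lemma coef_limit (CN : nat -> nat -> C) (rho : R) (b : nat -> R) n0 : 0 < rho ->
  (forall N, (n0 <= N)%N -> forall n,
     \sum_(k < n) nrm (CN N.+1 k - CN N k) * rho ^+ k <= b N - b N.+1) ->
  b @ \oo --> (0 : R) ->
  exists c, (forall k, ctends (CN^~ k) (c k)) /\
    forall t (g : nat -> C), `|t| <= rho -> (forall N, sums (CN N) t (g N)) ->
      exists2 z, ctends g z & sums c t z.
Proof.
move=> r0 hC b0.
have ex k : exists z, ctends (CN^~ k) z.
  apply: (@ctends_telescope _ (fun n => b n / rho ^+ k) n0).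
    move=> n nn; rewrite -mulrBl ler_pdivlMr ?exprn_gt0 //.
    apply: le_trans (hC n nn k.+1); rewrite big_ord_recr /= lerDr.
    by rewrite sumr_ge0 // => i _; rewrite mulr_ge0 ?nrm_ge0 // exprn_ge0 // ltW.
  have -> : (0 : R) = 0 / rho ^+ k by rewrite mul0r.
  by apply: cvgM => //; exact: cvg_cst.
pose c k := projT1 (cid (ex k)).
have hc k : ctends (CN^~ k) (c k) by rewrite /c; case: cid.
exists c; split=> // t g tr hg.
have [z gz] : exists z, ctends g z.
  apply: (@ctends_telescope _ b n0) => // N NN.
  have h : sums (fun k => CN N.+1 k - CN N k) t (g N.+1 - g N).
    have := sumsD (hg N.+1) (sumsZ (-1) (hg N)).
    rewrite mulN1r; apply: ctends_ext => n; apply: eq_bigr => i _; ring.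
  apply: (ctends_le (n0 := 0) h) => n _.
  by apply: le_trans (psum_le _ n tr) (hC N NN n).
exists z => //.
have tele N M n : (n0 <= N)%N -> \sum_(k < n) nrm (CN (N + M)%N k - CN N k) * rho ^+ k <= b N - b (N + M)%N.
  move=> NN; elim: M => [|M IH].
    rewrite addn0 subrr big1 // => i _; by rewrite subrr nrm0 mul0r.
  rewrite addnS; have := hC (N + M)%N (leq_trans NN (leq_addr _ _)) n => h.
  have : \sum_(k < n) nrm (CN (N + M).+1 k - CN N k) * rho ^+ k <=
    \sum_(k < n) nrm (CN (N + M).+1 k - CN (N + M)%N k) * rho ^+ k +
    \sum_(k < n) nrm (CN (N + M)%N k - CN N k) * rho ^+ k.
    rewrite -big_split /=; apply: ler_sum => i _; rewrite -mulrDl.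
    apply: ler_wpM2r; first by rewrite exprn_ge0 // ltW.
    have -> : CN (N + M).+1 i - CN N i = (CN (N + M).+1 i - CN (N + M)%N i) + (CN (N + M)%N i - CN N i) by ring.
    exact: nrmD.
  by lra.
have b_ge N : (n0 <= N)%N -> 0 <= b N.
  move=> NN; apply: (cvgr_to_le (cvg_comp (addn N) b (cvg_addnl N) b0)); exists 0%N => // M _.
  by have h := tele N M 0%N NN; rewrite big_ord0 in h; rewrite /=; lra.
have unif N n : (n0 <= N)%N -> nrm (psum c t n - psum (CN N) t n) <= b N.
  move=> NN.
  have h : ctends (fun M => psum (CN M) t n - psum (CN N) t n) (psum c t n - psum (CN N) t n).
    apply: ctendsD; last exact: ctends_cst.
    apply: (@ctends_big (fun M k => CN M k * rc t ^+ k) (fun k => c k * rc t ^+ k)) => k.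
    apply: (@ctends_ext R (fun M => rc t ^+ k * CN M k)); first by move=> M; ring.
    have -> : c k * rc t ^+ k = rc t ^+ k * c k by ring.
    exact: ctendsZ.
  apply: (ctends_le (n0 := N) h) => M NM; rewrite psumB.
  apply: le_trans (psum_le _ n tr) _.
  have -> : M = (N + (M - N))%N by rewrite subnKC.
  apply: le_trans (tele N (M - N)%N n NN) _.
  by have := b_ge (N + (M - N))%N (leq_trans NN (leq_addr _ _)); lra.
move=> e e0; have e3 : 0 < e / 3 by lra.
have [N1 hN1] := gz _ e3.
move/cvgrPdist_le : b0 => /(_ _ e3)[N2 _ hN2].
pose N := maxn n0 (maxn N1 N2).
have NN : (n0 <= N)%N by rewrite leq_max leqnn.
have n1 : nrm (g N - z) <= e / 3 by apply: hN1; rewrite /N !leq_max leqnn orbT.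
have n2 : b N <= e / 3.
  have := hN2 N; rewrite /= sub0r normrN ger0_norm ?b_ge //; apply.
  by rewrite /N !leq_max leqnn !orbT.
have [K hK] := hg N _ e3; exists K => n Kn.
have h1 := hK n Kn; have h2 := unif N n NN.
have -> : psum c t n - z = (psum c t n - psum (CN N) t n) + (psum (CN N) t n - g N) + (g N - z) by ring.
apply: le_trans (nrmD _ _) _; apply: le_trans (lerD (nrmD _ _) (lexx _)) _.
lra.
Qed.

End CoefficientLimits.

(** * Complex powers of a real variable *)

Section ComplexPower.
Variable R : realType.
Local Notation C := (Cplx R).
Local Notation Re := (@complex.Re R).
Local Notation Im := (@complex.Im R).
Implicit Types (a b z : C) (v x t : R).

Definition cpow a v : C :=
  Complex (expR (Re a * ln v) * cos (Im a * ln v)) (expR (Re a * ln v) * sin (Im a * ln v)).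

Lemma natpowNE n a : natpowN n a = cpow (- a) n%:R.
Proof. by rewrite /natpowN /cpow ReN ImN. Qed.

Lemma cpowD a b v : cpow (a + b) v = cpow a v * cpow b v.
Proof.
apply: cplx_eq; rewrite ?ReM ?ImM /= ReD ImD !mulrDl expRD ?cosD ?sinD; ring.
Qed.

Lemma cpow_rc x v : cpow (rc x) v = rc (expR (x * ln v)).
Proof. by apply: cplx_eq; rewrite /= mul0r ?cos0 ?sin0 ?mulr1 ?mulr0. Qed.

Lemma cpowB1 a v : 0 < v -> cpow (a - 1) v = rc v^-1 * cpow a v.
Proof.
move=> v0; rewrite cpowD mulrC; congr (_ * _).
have -> : -1 = rc (-1) :> C by apply: cplx_eq; rewrite /= ?oppr0.
by rewrite cpow_rc mulN1r expRN lnK ?posrE.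
Qed.

Lemma nrm_cpow a v : nrm (cpow a v) <= 2 * expR (Re a * ln v).
Proof.
rewrite /nrm /= !normrM (ger0_norm (expR_ge0 _)).
have c1 : `|cos (Im a * ln v)| <= 1 by rewrite ler_norml cos_geN1 cos_le1.
have s1 : `|sin (Im a * ln v)| <= 1 by rewrite ler_norml sin_geN1 sin_le1.
by have := expR_ge0 (Re a * ln v); nra.
Qed.

(** Derivative with respect to a real variable, taken on the two components. *)
Definition cdv (f : R -> C) v z := dv (fun u => Re (f u)) v (Re z) /\ dv (fun u => Im (f u)) v (Im z).

Lemma cdv_eq f v z z' : cdv f v z -> z = z' -> cdv f v z'.
Proof. by move=> h <-. Qed.

Lemma cdvZ f v z a : cdv f v z -> cdv (fun u => a * f u) v (a * z).
Proof.
move=> [h1 h2]; split; rewrite ?ReM ?ImM.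
  rewrite (_ : (fun _ => _) = fun u => Re a * Re (f u) + - (Im a * Im (f u))); last first.
    by apply/funext => u; rewrite ReM.
  by apply: dv_eq; first exact: (dvD (dvM (dvC v (Re a)) h1) (dvN (dvM (dvC v (Im a)) h2))); ring.
rewrite (_ : (fun _ => _) = fun u => Re a * Im (f u) + Im a * Re (f u)); last first.
  by apply/funext => u; rewrite ImM.
by apply: dv_eq; first exact: (dvD (dvM (dvC v (Re a)) h2) (dvM (dvC v (Im a)) h1)); ring.
Qed.

Lemma cdvD f g v z z' : cdv f v z -> cdv g v z' -> cdv (fun u => f u + g u) v (z + z').
Proof.
move=> [h1 h2] [h3 h4]; split; rewrite ?ReD ?ImD.
  by rewrite (_ : (fun _ => _) = fun u => Re (f u) + Re (g u)); [exact: dvD|apply/funext => u; rewrite ReD].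
by rewrite (_ : (fun _ => _) = fun u => Im (f u) + Im (g u)); [exact: dvD|apply/funext => u; rewrite ImD].
Qed.

Lemma cdvMr (f : R -> C) (g : R -> R) v z x : cdv f v z -> dv g v x ->
  cdv (fun u => rc (g u) * f u) v (rc x * f v + rc (g v) * z).
Proof.
move=> [h1 h2] hg; split; rewrite ?ReD ?ImD ?ReM ?ImM /= !mul0r ?subr0 ?addr0.
  rewrite (_ : (fun _ => _) = fun u => g u * Re (f u)); first exact: dvM.
  by apply/funext => u; rewrite ReM /= mul0r subr0.
rewrite (_ : (fun _ => _) = fun u => g u * Im (f u)); first exact: dvM.
by apply/funext => u; rewrite ImM /= mul0r addr0.
Qed.

Lemma cdv_cst v a : cdv (fun=> a) v 0.
Proof. by split; exact: dvC. Qed.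

Lemma cdv_cpow a v : 0 < v -> cdv (cpow a) v (rc v^-1 * (a * cpow a v)).
Proof.
move=> v0; have dl (b : R) := dvM (dvC v b) (dv_ln v0).
split; apply: dv_eq.
- exact: (dvM (dvE (dl (Re a))) (dvcos (dl (Im a)))).
- by rewrite !(ReM, ImM) /=; ring.
- exact: (dvM (dvE (dl (Re a))) (dvsin (dl (Im a)))).
- by rewrite !(ReM, ImM) /=; ring.
Qed.

(** Exponential series of [a ln v] in the real variable [t]: Taylor's estimate for the
real and imaginary parts, all derivatives being [z^i] times the function. *)
Lemma sums_cpow a v t : sums (fun k => (a * rc (ln v)) ^+ k * rc k`!%:R^-1) t (cpow (rc t * a) v).
Proof.
pose l := ln v; pose z := a * rc l.
pose B := 2 * expR (`|Re a * l| * `|t|).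
pose f (x : R) : C := cpow (rc x * a) v.
have df x : cdv f x (z * f x).
  have -> : f = fun y => Complex (expR (y * Re a * l) * cos (y * Im a * l)) (expR (y * Re a * l) * sin (y * Im a * l)).
    by apply/funext => y; rewrite /f /cpow ReM ImM /= !mul0r subr0 addr0.
  have d (p : R) : dv (fun y : R => y * p * l) x (p * l).
    apply: dv_eq; first exact: (dvM (dvM (dvI x) (dvC x p)) (dvC x l)).
    rewrite /=; ring.
  split; apply: dv_eq.
  - exact: (dvM (dvE (d (Re a))) (dvcos (d (Im a)))).
  - by rewrite /z !(ReM, ImM) /=; ring.
  - exact: (dvM (dvE (d (Re a))) (dvsin (d (Im a)))).
  - by rewrite /z !(ReM, ImM) /=; ring.
have dfi i x : cdv (fun y => z ^+ i * f y) x (z ^+ i.+1 * f x).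
  by apply: cdv_eq; first exact: (cdvZ _ (df x)); rewrite exprSr mulrA.
have bf n x : `|x - 0| <= `|t| -> nrm (z ^+ n * f x) <= nrm z ^+ n * B.
  rewrite subr0 => xt; apply: le_trans (nrmM _ _) _; apply: ler_pM; rewrite ?nrm_ge0 ?nrmX //.
  apply: le_trans (nrm_cpow _ _) _; rewrite /B ler_pM2l // ler_expR ReM /= mul0r subr0.
  apply: le_trans (ler_norm _) _; rewrite -mulrA normrM mulrC.
  by apply: ler_wpM2l.
have key n : nrm (psum (fun k => z ^+ k * rc k`!%:R^-1) t n - cpow (rc t * a) v) <=
    2 * B * exp_coeff (nrm z * `|t|) n.
  have f0 : f 0 = 1.
    by rewrite /f rc0 mul0r; apply: cplx_eq; rewrite /= !mul0r ?cos0 ?sin0 expR0 ?mulr1 ?mulr0.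
  have h1 := @taylor R (fun i x => Re (z ^+ i * f x)) n 0 (nrm z ^+ n * B) t
    (fun i x _ _ => (dfi i x).1).
  have h2 := @taylor R (fun i x => Im (z ^+ i * f x)) n 0 (nrm z ^+ n * B) t
    (fun i x _ _ => (dfi i x).2).
  have {}h1 := h1 (fun x xt => le_trans (ler_wpDr (normr_ge0 (Im (z ^+ n * f x))) (lexx _)) (bf n x xt)).
  have {}h2 := h2 (fun x xt => le_trans (ler_wpDl (normr_ge0 (Re (z ^+ n * f x))) (lexx _)) (bf n x xt)).
  rewrite add0r expr0 mul1r in h1; rewrite add0r expr0 mul1r in h2.
  rewrite -nrmN opprB /nrm ReD ImD ReN ImN.
  have -> : Re (psum (fun k => z ^+ k * rc k`!%:R^-1) t n) = \sum_(i < n) Re (z ^+ i * f 0) * t ^+ i / i`!%:R.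
    elim: n {h1 h2 bf} => [|n IH]; first by rewrite /psum !big_ord0.
    by rewrite psumS ReD IH big_ord_recr /= f0 mulr1 -rcX !(ReM, ImM) /=; ring.
  have -> : Im (psum (fun k => z ^+ k * rc k`!%:R^-1) t n) = \sum_(i < n) Im (z ^+ i * f 0) * t ^+ i / i`!%:R.
    elim: n {h1 h2 bf} => [|n IH]; first by rewrite /psum !big_ord0.
    by rewrite psumS ImD IH big_ord_recr /= f0 mulr1 -rcX !(ReM, ImM) /=; ring.
  rewrite /exp_coeff /= exprMn; rewrite /f in h1 h2.
  have -> : 2 * B * (nrm z ^+ n * `|t| ^+ n / n`!%:R) = nrm z ^+ n * B * `|t| ^+ n / n`!%:R + nrm z ^+ n * B * `|t| ^+ n / n`!%:R by ring.
  exact: lerD h1 h2.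
move=> e e0.
have B0 : 0 < 2 * B by rewrite mulr_gt0 // mulr_gt0 // expR_gt0.
have /cvgrPdist_le/(_ (e / (2 * B)))[|N _ hN] := @cvg_series_cvg_0 _ _ _ (@is_cvg_series_exp_coeff R (nrm z * `|t|)).
  by rewrite divr_gt0.
exists N => n /hN /=; rewrite sub0r normrN => h.
apply: le_trans (key n) _; rewrite mulrC -ler_pdivlMr //.
exact: le_trans (ler_norm _) h.
Qed.

End ComplexPower.

(** * Expansion of the derivatives of the power function *)

Section ZetaCoefficients.
Variable R : realType.
Local Notation C := (Cplx R).
Local Notation Re := (@complex.Re R).
Local Notation Im := (@complex.Im R).
Variables (w s0 : C).
Implicit Types (s : C) (v t : R).

(** Coefficients in [t] of [bval i v (s0 + w t)]. *)
Fixpoint bcoef (i : nat) v : nat -> C := match i with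
  | 0 => fun k => cpow (1 - s0) v * ((- w * rc (ln v)) ^+ k * rc k`!%:R^-1)
  | j.+1 => fun k => rc v^-1 * lin w (1 - s0 - j%:R) (bcoef j v) k
  end.

(** The [i]-th derivative of [v^(1 - s)] with respect to [v]: each derivation
multiplies by [(1 - s - i) / v]. *)
Fixpoint bval (i : nat) v s : C := match i with
  | 0 => cpow (1 - s) v
  | j.+1 => rc v^-1 * ((1 - s - j%:R) * bval j v s)
  end.

Lemma bcoefS i v k : bcoef i.+1 v k = rc v^-1 * lin w (1 - s0 - i%:R) (bcoef i v) k.
Proof. by []. Qed.

Lemma sums_bcoef i v t : sums (bcoef i v) t (bval i v (s0 + w * rc t)).
Proof.
elim: i => [|i IH] /=.
  have -> : 1 - (s0 + w * rc t) = (1 - s0) + rc t * - w by ring.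
  by rewrite (cpowD (1 - s0)); exact: sumsZ (sums_cpow _ _ _).
have -> : 1 - (s0 + w * rc t) - i%:R = (1 - s0 - i%:R) - w * rc t by ring.
exact: sumsZ (sums_lin _ _ IH).
Qed.

(** Expansion in [t] commutes with derivation in [v]. *)
Lemma cdv_bcoef i v k : 0 < v -> cdv (fun u => bcoef i u k) v (bcoef i.+1 v k).
Proof.
move=> v0; elim: i k => [|i IH] k.
  have e1 := cdv_cpow (1 - s0) v0.
  have -> : (fun u => bcoef 0 u k) = fun u => (- w) ^+ k * (rc (ln u ^+ k / k`!%:R) * cpow (1 - s0) u).
    by apply/funext => u /=; rewrite rcM exprMn rcX; ring.
  have e2 := cdvMr e1 (dvM (dvX k (dv_ln v0)) (dvC v k`!%:R^-1)).
  apply: cdv_eq; first exact: (cdvZ ((- w) ^+ k) e2).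
  rewrite /= /lin; case: k {e2} => [|k].
    rewrite /= !expr0 fact0 !mul0r mulr0 addr0 divr1 invr1 rc0 rc1; ring.
  rewrite /= factS natrM invfM.
  have -> : (k.+1%:R * ln v ^+ k * v^-1 * (k.+1%:R^-1 / k`!%:R) + ln v ^+ k.+1 * 0) = ln v ^+ k * v^-1 / k`!%:R :> R.
    have h1 : k.+1%:R != 0 :> R by rewrite pnatr_eq0.
    have h2 : k`!%:R != 0 :> R by rewrite pnatr_eq0 -lt0n fact_gt0.
    have h3 := lt0r_neq0 v0; move: (k.+1%:R : R) (k`!%:R : R) h1 h2 => a b h1 h2.
    by field; rewrite h1 h2 h3.
  rewrite !exprMn !rcM !rcX !exprS; ring.
pose k' c : C := if k is j.+1 then w * c j else 0.
pose al := 1 - s0 - i%:R.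
have h1 : cdv (fun u => k' (bcoef i u)) v (k' (bcoef i.+1 v)).
  by rewrite /k'; case: (k) => [|j]; [exact: cdv_cst | exact: cdvZ].
have h2 := cdvD (cdvZ al (IH k)) (cdvZ (-1) h1).
have h3 := cdvMr h2 (dvV (lt0r_neq0 v0) (dvI v)).
have -> : (fun u => bcoef i.+1 u k) = fun u => rc u^-1 * (al * bcoef i u k + -1 * k' (bcoef i u)).
  by apply/funext => u; rewrite mulN1r.
apply: cdv_eq; first exact: h3.
rewrite [in RHS]bcoefS /lin -/(k' (bcoef i.+1 v)) -natr1.
have -> : bcoef i.+1 v k = rc v^-1 * (al * bcoef i v k - k' (bcoef i v)) by [].
move: (k' _) (k' _) => x y.
by rewrite expr2 !rcM (_ : rc (-1) = -1) /al; [ring | apply: cplx_eq; rewrite /= ?oppr0].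
Qed.

(** What [lin] does to majorants of the coefficients. *)
Definition majlin (A W : R) (m : nat -> R) : nat -> R :=
  fun k => A * m k + (if k is j.+1 then W * m j else 0).

Lemma nrm_lin (al : C) (c : nat -> C) (m : nat -> R) A k : nrm al <= A ->
  (forall k, nrm (c k) <= m k) -> nrm (lin w al c k) <= majlin A (nrm w) m k.
Proof.
move=> aA cm; rewrite /lin /majlin; apply: le_trans (nrmB _ _) _; apply: lerD.
  by apply: le_trans (nrmM _ _) _; apply: ler_pM; rewrite ?nrm_ge0.
case: k => [|k]; first by rewrite nrm0.
by apply: le_trans (nrmM _ _) _; apply: ler_wpM2l; rewrite ?nrm_ge0.
Qed.

Lemma majlin_sum A W (m : nat -> R) (rho : R) n : 0 <= rho -> 0 <= A -> 0 <= W ->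
  (forall k, 0 <= m k) ->
  \sum_(k < n) majlin A W m k * rho ^+ k <= (A + W * rho) * \sum_(k < n) m k * rho ^+ k.
Proof.
move=> r0 A0 W0 m0.
pose S m' : R := \sum_(k < m') m k * rho ^+ k.
have SS m' : S m'.+1 = S m' + m m' * rho ^+ m' by rewrite /S big_ord_recr.
have h1 m' : \sum_(k < m') majlin A W m k * rho ^+ k = A * S m' + W * rho * S m'.-1.
  elim: m' => [|m' IH]; first by rewrite /S !big_ord0 !mulr0 addr0.
  rewrite big_ord_recr /= IH /majlin SS; case: m' {IH} => [|m'] /=.
    by rewrite addr0; ring.
  by rewrite !SS exprS; ring.
rewrite h1 -/(S n).
have h2 : S n.-1 <= S n.
  case: n => [|n] //; rewrite /= SS lerDl.
  by rewrite mulr_ge0 // exprn_ge0.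
by have := ler_wpM2l (mulr_ge0 W0 r0) h2; lra.
Qed.

Lemma exp_psum_le (x : R) n : 0 <= x -> \sum_(k < n) x ^+ k / k`!%:R <= expR x.
Proof.
move=> x0; have h := nondecreasing_cvgn_le (_ : nondecreasing_seq (series (exp_coeff x))) (is_cvg_series_exp_coeff x) n.
rewrite -(big_mkord xpredT (fun k => x ^+ k / k`!%:R)); apply: h.
apply/nondecreasing_seqP => k; rewrite seriesEnat /= big_nat_recr //= lerDl /exp_coeff /=.
by rewrite divr_ge0 ?exprn_ge0.
Qed.

Variable A : R.
Hypotheses (s0R : Re (1 - s0) <= 2) (s0A : forall i, (i < 4)%N -> nrm (1 - s0 - i%:R) <= A).

(** The majorants must not depend on [v], as Taylor's formula takes suprema over
[[a, b]].  Without the factors from the derivations their weighted sum is an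
exponential series; each derivation costs a factor [(A + |w| rho) / a]. *)
Lemma bcoef_maj (a b : R) : 1 <= a -> a <= b ->
  exists m : nat -> R, (forall v k, a <= v <= b -> nrm (bcoef 4 v k) <= m k) /\
  forall rho n, 0 <= rho -> \sum_(k < n) m k * rho ^+ k <=
    ((A + nrm w * rho) / a) ^+ 4 * (2 * b ^+ 2 * expR (nrm w * rho * ln b)).
Proof.
move=> a1 ab; have a0 : 0 < a by lra.
have b0 : 0 < b by lra.
have lb : 0 <= ln b by rewrite ln_ge0 //; lra.
have A0 : 0 <= A by apply: le_trans (s0A (isT : (0 < 4)%N)); exact: nrm_ge0.
pose fix m i : nat -> R := match i with
  | 0 => fun k => 2 * b ^+ 2 * ((nrm w * ln b) ^+ k / k`!%:R)
  | j.+1 => fun k => a^-1 * majlin A (nrm w) (m j) k end.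
have m0 i k : 0 <= m i k.
  elim: i k => [|i IH] k /=.
    by rewrite !mulr_ge0 ?exprn_ge0 ?mulr_ge0 ?nrm_ge0 ?invr_ge0 // ltW.
  rewrite mulr_ge0 ?invr_ge0 ?(ltW a0) // /majlin addr_ge0 ?mulr_ge0 //.
  by case: k => // k; rewrite mulr_ge0 ?nrm_ge0.
have hm i v k : (i <= 4)%N -> a <= v <= b -> nrm (bcoef i v k) <= m i k.
  elim: i k => [|i IH] k i4 vab.
    have v0 : 0 < v by lra.
    have lv : 0 <= ln v by rewrite ln_ge0 //; lra.
    have lvb : ln v <= ln b by rewrite ler_ln ?posrE //; lra.
    apply: le_trans (nrmM _ _) _; apply: ler_pM; rewrite ?nrm_ge0 //.
      apply: le_trans (nrm_cpow _ _) _; rewrite ler_pM2l //.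
      have -> : b ^+ 2 = expR (2 * ln b) by rewrite expRM_natl lnK // posrE.
      rewrite ler_expR; apply: le_trans (ler_wpM2r lv s0R) _; lra.
    rewrite mulrC nrm_rcM ger0_norm ?invr_ge0 // mulrC ler_wpM2r ?invr_ge0 //.
    apply: le_trans (nrmX _ _) _; apply: lerXn2r; rewrite ?nnegrE ?mulr_ge0 ?nrm_ge0 //.
    rewrite mulrC nrm_rcM nrmN ger0_norm // mulrC ler_wpM2l ?nrm_ge0 //.
  rewrite bcoefS nrm_rcM /= ger0_norm ?invr_ge0; last lra.
  apply: ler_pM; rewrite ?invr_ge0 ?nrm_ge0 //; first lra.
    by rewrite lef_pV2 ?posrE //; lra.
  apply: nrm_lin => [|k']; first exact: s0A.
  by apply: IH => //; exact: ltnW.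
exists (m 4%N); split=> [v k vab|rho n r0]; first exact: hm.
have W0 := nrm_ge0 w.
have c0 : 0 <= A + nrm w * rho by rewrite addr_ge0 ?mulr_ge0.
have h i : \sum_(k < n) m i k * rho ^+ k <= ((A + nrm w * rho) / a) ^+ i * (2 * b ^+ 2 * expR (nrm w * rho * ln b)).
  elim: i => [|i IH].
    rewrite expr0 mul1r.
    have -> : \sum_(k < n) m 0%N k * rho ^+ k = 2 * b ^+ 2 * \sum_(k < n) (nrm w * rho * ln b) ^+ k / k`!%:R.
      by rewrite big_distrr /=; apply: eq_bigr => k _; rewrite !exprMn; ring.
    rewrite ler_wpM2l ?mulr_ge0 ?exprn_ge0 ?(ltW b0) // exp_psum_le //.
    by rewrite !mulr_ge0.
  have -> : \sum_(k < n) m i.+1 k * rho ^+ k = a^-1 * \sum_(k < n) majlin A (nrm w) (m i) k * rho ^+ k.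
    by rewrite big_distrr /=; apply: eq_bigr => k _; ring.
  apply: le_trans (_ : a^-1 * ((A + nrm w * rho) * \sum_(k < n) m i k * rho ^+ k) <= _).
    by rewrite ler_wpM2l ?invr_ge0 ?(ltW a0) // majlin_sum.
  rewrite exprS -mulrA; apply: le_trans (_ : (A + nrm w * rho) / a * \sum_(k < n) m i k * rho ^+ k <= _).
    by rewrite le_eqVlt; apply/orP; left; apply/eqP; ring.
  by rewrite ler_wpM2l // divr_ge0 // ltW.
exact: h.
Qed.

End ZetaCoefficients.

(** * Euler-Maclaurin truncations of (1 - s) zeta(s) *)

Section TruncatedZeta.
Variable R : realType.
Local Notation C := (Cplx R).
Local Notation Re := (@complex.Re R).
Local Notation Im := (@complex.Im R).
Variables (w : C).
Implicit Types (s : C) (v t : R).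

(** Coefficients in [t] of [emval N (s0 + w t)]. *)
Definition emcoef s0 N k : C := \sum_(n < N) bcoef w s0 1 n.+1%:R k +
  (rc (-1) * bcoef w s0 0 N%:R k + (rc (-(1/2)) * bcoef w s0 1 N%:R k + rc (-(1/12)) * bcoef w s0 2 N%:R k)).

(** With [G v = v^(1 - s)] this is the sum of [G' n] for [n <= N], minus
[G N + G' N / 2 + G'' N / 12]. *)
Definition emval N s : C := \sum_(n < N) bval 1 n.+1%:R s +
  (rc (-1) * bval 0 N%:R s + (rc (-(1/2)) * bval 1 N%:R s + rc (-(1/12)) * bval 2 N%:R s)).

Lemma sums_emcoef s0 N t : sums (emcoef s0 N) t (emval N (s0 + w * rc t)).
Proof.
apply: sumsD; last first.
  apply: sumsD; first by apply: sumsZ; exact: sums_bcoef.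
  by apply: sumsD; apply: sumsZ; exact: sums_bcoef.
elim: N => [|N IH].
  by rewrite big_ord0; apply: ctends_ext (@ctends_cst R _) => n; rewrite /psum big1 // => k _; rewrite big_ord0 mul0r.
rewrite big_ord_recr /=; have h := sumsD IH (sums_bcoef w s0 1 N.+1%:R t).
by apply: ctends_ext h => n; apply: eq_bigr => k _; rewrite big_ord_recr.
Qed.

Lemma emcoef_step s0 N k (B : R) : (0 < N)%N ->
  (forall v, N%:R <= v <= N%:R + 1 -> nrm (bcoef w s0 4 v k) <= B) ->
  nrm (emcoef s0 N.+1 k - emcoef s0 N k) <= B / 3.
Proof.
move=> N0 hB; set a : R := N%:R; have a0 : 0 < a by rewrite ltr0n.
have hd i v : (i < 4)%N -> a <= v <= a + 1 -> cdv (fun u => bcoef w s0 i u k) v (bcoef w s0 i.+1 v k).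
  by move=> _ va; apply: cdv_bcoef; lra.
have h1 := @euler_maclaurin_step R (fun i v => Re (bcoef w s0 i v k)) a B
  (fun i v i4 va => (hd i v i4 va).1).
have h2 := @euler_maclaurin_step R (fun i v => Im (bcoef w s0 i v k)) a B
  (fun i v i4 va => (hd i v i4 va).2).
have {}h1 := h1 (fun x xt => le_trans (ler_wpDr (normr_ge0 (Im _)) (lexx _)) (hB x xt)).
have {}h2 := h2 (fun x xt => le_trans (ler_wpDl (normr_ge0 (Re _)) (lexx _)) (hB x xt)).
have e : emcoef s0 N.+1 k - emcoef s0 N k = rc (1/2) * (bcoef w s0 1 a k + bcoef w s0 1 (a + 1) k)
   + rc (-1) * (bcoef w s0 0 (a + 1) k - bcoef w s0 0 a k) + rc (-(1/12)) * (bcoef w s0 2 (a + 1) k - bcoef w s0 2 a k).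
  have rec (f : nat -> C) M : \sum_(n < M.+1) f n = \sum_(n < M) f n + f M by rewrite big_ord_recr.
  rewrite /emcoef (rec (fun n => bcoef w s0 1 n.+1%:R k)) -natr1 -/a.
  set x0 := bcoef w s0 0 _ _; set x1 := bcoef w s0 1 _ _; set x2 := bcoef w s0 2 _ _.
  set y0 := bcoef w s0 0 _ _; set y1 := bcoef w s0 1 a _; set y2 := bcoef w s0 2 a _.
  set S := \sum_(i < N) _.
  have hh : rc (1/2) + rc (1/2) = 1 :> C by apply: cplx_eq; rewrite /=; lra.
  have -> : S + x1 = S + (rc (1/2) + rc (1/2)) * x1 by rewrite hh mul1r.
  have -> : rc (-(1/2)) = - rc (1/2) :> C by apply: cplx_eq; rewrite /= ?oppr0.
  have -> : rc (-1) = - 1 :> C by apply: cplx_eq; rewrite /= ?oppr0.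
  by move: S x0 x1 x2 y0 y1 y2 => S x0 x1 x2 y0 y1 y2; ring.
have -> : B / 3 = B / 6 + B / 6 by field.
rewrite e /nrm; move: (bcoef w s0 0 a k) (bcoef w s0 1 a k) (bcoef w s0 2 a k) 
  (bcoef w s0 0 (a + 1) k) (bcoef w s0 1 (a + 1) k) (bcoef w s0 2 (a + 1) k) h1 h2 => x0 x1 x2 y0 y1 y2 h1 h2.
apply: lerD.
  apply: le_trans h1; rewrite le_eqVlt; apply/orP; left; apply/eqP; congr `|_|.
  by rewrite !(ReD, ReM, ReN, ImD, ImN) /=; field.
apply: le_trans h2; rewrite le_eqVlt; apply/orP; left; apply/eqP; congr `|_|.
by rewrite !(ImD, ImM, ImN, ReD, ReN) /=; field.
Qed.

(** By [emcoef_step] and [bcoef_maj] with [[a, b] = [N, N + 1]] an increment is of order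
[N^-4 * N^2 * N^(1/2)]: the last two exponents come from [Re (1 - s0) <= 2] and from
[|w| rho <= 1/2].  This is dominated by the increments of [1 / sqrt N]. *)
Lemma emcoef_limit s0 (rho : R) : 0 < rho -> nrm w * rho <= 1 / 2 -> Re (1 - s0) <= 2 ->
  exists c, (forall k, ctends (emcoef s0 ^~ k) (c k)) /\
    forall t, `|t| <= rho -> exists2 z, ctends (emval ^~ (s0 + w * rc t)) z & sums c t z.
Proof.
move=> r0 wr s0R.
pose A := nrm (1 - s0) + nrm (1 - s0 - 1) + nrm (1 - s0 - 2%:R) + nrm (1 - s0 - 3%:R).
have s0A i : (i < 4)%N -> nrm (1 - s0 - i%:R) <= A.
  have := nrm_ge0 (1 - s0); have := nrm_ge0 (1 - s0 - 1).
  have := nrm_ge0 (1 - s0 - 2%:R); have := nrm_ge0 (1 - s0 - 3%:R).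
  by rewrite /A; case: i => [|[|[|[|i]]]] //= *; rewrite ?subr0; lra.
have A0 : 0 <= A by apply: le_trans (s0A 0%N _); rewrite ?nrm_ge0.
have q0 : 0 <= (A + 1 / 2) ^+ 4 by rewrite exprn_ge0 // addr_ge0.
have [K [KE K0]] : exists K : R, K = 2 * 32 * (A + 1 / 2) ^+ 4 / 3 /\ 0 <= K.
  by eexists; split; [reflexivity|lra].
pose sq n : R := expR (1 / 2 * ln n%:R).
have sq2 n : (0 < n)%N -> sq n ^+ 2 = n%:R.
  move=> n0; rewrite /sq -expRM_natl (_ : 2%:R * _ = ln n%:R) ?lnK ?posrE ?ltr0n //.
  by rewrite mulrA; have -> : 2%:R * (1/2) = 1 :> R by [field]; rewrite mul1r.
pose beta n : R := K / sq n.
have beta0 : beta @ \oo --> (0 : R).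
  apply/cvgrPdist_le => e e0; exists (Num.bound ((K / e) ^+ 2)).+1 => // n /= nb.
  rewrite sub0r normrN /beta ger0_norm; last by rewrite divr_ge0 // expR_ge0.
  rewrite ler_pdivrMr ?expR_gt0 // mulrC -ler_pdivrMr //.
  rewrite -(@ler_pXn2r _ 2) ?nnegrE ?expR_ge0 ?divr_ge0 ?(ltW e0) //.
  rewrite sq2; last exact: leq_ltn_trans nb.
  apply: le_trans (ltW (archi_boundP (sqr_ge0 _))) _.
  by rewrite ler_nat; exact: ltnW.
have step N : (1 <= N)%N -> forall n, \sum_(k < n) nrm (emcoef s0 N.+1 k - emcoef s0 N k) * rho ^+ k <= beta N - beta N.+1.
  move=> N1 n; set a : R := N%:R; have a1 : 1 <= a by rewrite ler1n.
  have aa : a <= a + 1 by lra.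
  have [m [hm Sm]] := @bcoef_maj R w s0 A s0R s0A a (a + 1) a1 aa.
  apply: le_trans (_ : 1 / 3 * \sum_(k < n) m k * rho ^+ k <= _).
    rewrite big_distrr /=; apply: ler_sum => k _; rewrite mulrA ler_wpM2r ?exprn_ge0 ?(ltW r0) //.
    have := @emcoef_step s0 N k (m k) N1 (fun v va => hm v k va); lra.
  have S1 := Sm rho n (ltW r0).
  pose x := sq N; pose y := sq N.+1.
  have x2 : x ^+ 2 = a by rewrite /x sq2.
  have y2 : y ^+ 2 = a + 1 by rewrite /y sq2 // -natr1.
  have x0 : 0 < x by exact: expR_gt0.
  have y0 : 0 < y by exact: expR_gt0.
  have xy : x <= y by rewrite -(@ler_pXn2r _ 2) ?nnegrE ?(ltW x0) ?(ltW y0) // x2 y2.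
  have S2 : ((A + nrm w * rho) / a) ^+ 4 * (2 * (a + 1) ^+ 2 * expR (nrm w * rho * ln (a + 1))) <=
     ((A + 1 / 2) / a) ^+ 4 * (2 * (a + 1) ^+ 2 * y).
    have W0 := nrm_ge0 w.
    apply: ler_pM.
    - by rewrite exprn_ge0 // divr_ge0 ?addr_ge0 ?mulr_ge0 // ltW.
    - by rewrite !mulr_ge0 ?expR_ge0 ?exprn_ge0 //; lra.
    - apply: lerXn2r; rewrite ?nnegrE ?divr_ge0 ?addr_ge0 ?mulr_ge0 ?(ltW r0) //; try lra.
      by rewrite ler_wpM2r ?invr_ge0; lra.
    - rewrite ler_wpM2l ?mulr_ge0 ?exprn_ge0 //; try lra.
      rewrite /y /sq -[N.+1%:R]natr1 -/a ler_expR; apply: ler_wpM2r => //.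
      by rewrite ln_ge0 //; lra.
  apply: le_trans (_ : 1 / 3 * (((A + 1 / 2) / a) ^+ 4 * (2 * (a + 1) ^+ 2 * y)) <= _).
    by rewrite ler_wpM2l //; lra.
  rewrite /beta -/x -/y.
  have e1 : K / x - K / y = (A + 1/2) ^+ 4 * (2 / 3) * (32 * (y - x) / (x * y)).
    by rewrite KE; field; rewrite !lt0r_neq0.
  have e2 : 1 / 3 * (((A + 1 / 2) / a) ^+ 4 * (2 * (a + 1) ^+ 2 * y)) = (A + 1/2) ^+ 4 * (2 / 3) * (y ^+ 5 / x ^+ 8).
    by rewrite -y2 -x2; field; rewrite lt0r_neq0.
  rewrite e1 e2 ler_wpM2l //; first by rewrite mulr_ge0 ?exprn_ge0 //; lra.
  rewrite ler_pdivrMr ?exprn_gt0 // mulrAC ler_pdivlMr ?mulr_gt0 //.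
  have yx : (y - x) * (y + x) = 1.
    have -> : (y - x) * (y + x) = y ^+ 2 - x ^+ 2 by ring.
    by rewrite x2 y2; ring.
  have y7 : y ^+ 7 <= 16 * x ^+ 7.
    have -> : y ^+ 7 = (y ^+ 2) ^+ 3 * y by ring.
    have -> : 16 * x ^+ 7 = (2 * x ^+ 2) ^+ 3 * (2 * x) by ring.
    have yx2 : y ^+ 2 <= 2 * x ^+ 2 by rewrite x2 y2; lra.
    apply: ler_pM; rewrite ?exprn_ge0 ?(ltW y0) //.
      by apply: lerXn2r; rewrite ?nnegrE ?mulr_ge0 ?exprn_ge0 ?(ltW x0) ?(ltW y0).
    rewrite -(@ler_pXn2r _ 2) ?nnegrE ?mulr_ge0 ?(ltW x0) ?(ltW y0) // exprMn.
    by have := sqr_ge0 x; lra.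
  rewrite -(@ler_pM2r _ (2 * y)) ?mulr_gt0 //.
  have -> : y ^+ 5 * (x * y) * (2 * y) = 2 * x * y ^+ 7 by ring.
  apply: le_trans (_ : 2 * x * (16 * x ^+ 7) <= _); first by rewrite ler_wpM2l // mulr_ge0 // ltW.
  have -> : 2 * x * (16 * x ^+ 7) = 32 * ((y - x) * (y + x)) * x ^+ 8 by rewrite yx; ring.
  have yx0 : 0 <= y - x by lra.
  have : (y - x) * (y + x) * x ^+ 8 <= (y - x) * (2 * y) * x ^+ 8.
    by rewrite ler_wpM2r ?exprn_ge0 ?(ltW x0) // ler_wpM2l //; lra.
  lra.
have [c [h1 h2]] := coef_limit r0 step beta0.
exists c; split=> // t tr.
by apply: h2 => // N; exact: sums_emcoef.
Qed.

End TruncatedZeta.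

(** * Analytic continuation along a path *)

Section Continuation.
Variable R : realType.
Local Notation C := (Cplx R).
Local Notation Re := (@complex.Re R).
Local Notation Im := (@complex.Im R).
Implicit Types (s : C) (v t : R).

Lemma ctends0_le (u : nat -> C) (b : nat -> R) n0 :
  (forall n, (n0 <= n)%N -> nrm (u n) <= b n) -> b @ \oo --> (0 : R) -> ctends u 0.
Proof.
move=> ub /cvgrPdist_le b0 e e0; have [N _ hN] := b0 e e0.
exists (maxn n0 N) => n; rewrite geq_max => /andP[n1 n2]; rewrite subr0.
have := hN n n2; rewrite /= sub0r normrN => h; apply: le_trans (ub n n1) _.
exact: le_trans (ler_norm _) h.
Qed.

Lemma power_cvg0 (d K : R) : 0 < d -> (fun n : nat => K * expR (- d * ln n%:R)) @ \oo --> (0 : R).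
Proof.
move=> d0; rewrite -(mulr0 K); apply: cvgM; first exact: cvg_cst.
apply/cvgrPdist_le => e e0; exists (Num.bound (expR (- ln e / d))).+1 => // n /= nb.
rewrite sub0r normrN ger0_norm ?expR_ge0 //.
have n0 : 0 < n%:R :> R by rewrite ltr0n; exact: leq_trans nb.
rewrite -[leRHS](lnK (_ : e \is Num.pos)) ?posrE // ler_expR.
have h : - ln e / d <= ln n%:R.
  rewrite -ler_expR lnK ?posrE //.
  apply: le_trans (ltW (archi_boundP (expR_ge0 _))) _.
  by rewrite ler_nat; exact: ltnW.
by move: h; rewrite ler_pdivrMr //; lra.
Qed.

(** In the half-plane of convergence [G' n = (1 - s) n^(-s)], and the boundary terms
vanish. *)
Lemma emval_dirichlet (zeta : C -> C) s : is_riemann_zeta zeta -> 1 < Re s ->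
  ctends (@emval R ^~ s) ((1 - s) * zeta s).
Proof.
move=> [hz _] s1; pose d := Re s - 1; have d0 : 0 < d by rewrite /d; lra.
have b1 n : bval 1 n.+1%:R s = (1 - s) * natpowN n.+1 s.
  have e : (1 - s) - 1 = - s by ring.
  have e2 := cpowB1 (1 - s) (_ : 0 < n.+1%:R :> R).
  by rewrite natpowNE -e e2 ?ltr0n // e [RHS]mulrCA /bval subr0.
have hs : ctends (fun N => \sum_(n < N) bval 1 n.+1%:R s) ((1 - s) * zeta s).
  apply: ctends_ext (ctendsZ (1 - s) (cvg_ctends (hz s s1))) => N.
  by rewrite seriesEord big_distrr; apply: eq_bigr => n _; exact: esym (b1 n).
rewrite -[(1 - s) * zeta s]addr0; apply: ctendsD hs _.
have n0 v : nrm (bval 0 v s) <= 2 * expR (- d * ln v).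
  by apply: le_trans (nrm_cpow _ _) _; rewrite ReD ReN /= (_ : 1 - Re s = - d) // /d; ring.
have nS i n : (0 < n)%N -> nrm (bval i.+1 n%:R s) <= nrm (1 - s - i%:R) * nrm (bval i n%:R s).
  move=> n0'; rewrite /= nrm_rcM; apply: le_trans (_ : 1 * (nrm (1 - s - i%:R) * nrm (bval i n%:R s)) <= _); last by rewrite mul1r.
  apply: ler_pM; rewrite ?nrm_ge0 ?nrmM //.
  by rewrite ger0_norm ?invr_ge0 // invf_le1 ?ltr0n // ler1n.
pose A := nrm (1 - s - 0%:R); pose B := nrm (1 - s - 1%:R).
have A0 : 0 <= A by exact: nrm_ge0.
have B0 : 0 <= B by exact: nrm_ge0.
apply: (@ctends0_le _ (fun n => (2 * (1 + A + A * B)) * expR (- d * ln n%:R)) 1); last exact: power_cvg0.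
move=> n n1; have := n0 n%:R; have := nS 0%N n n1; have := nS 1%N n n1; rewrite -/A -/B => h2 h1 h0.
have e0 := expR_ge0 (- d * ln n%:R).
have x0 := nrm_ge0 (bval 0 n%:R s); have x1 := nrm_ge0 (bval 1 n%:R s).
apply: le_trans (nrmD _ _) _; apply: le_trans (lerD (lexx _) (nrmD _ _)) _.
move: (bval 0 n%:R s) (bval 1 n%:R s) (bval 2 n%:R s) h0 h1 h2 x0 x1 => X Y Z h0 h1 h2 x0 x1.
have n2 : `|- (1 / 2)| = 1 / 2 :> R by rewrite normrN ger0_norm.
have n12 : `|- (1 / 12)| = 1 / 12 :> R by rewrite normrN ger0_norm.
rewrite !nrm_rcM normrN1 n2 n12.
move: (nrm X) (nrm Y) (nrm Z) (expR _) h0 h1 h2 e0 x0 x1 => z y x e h0 h1 h2 e0 x0 x1.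
have : A * z <= A * (2 * e) by exact: ler_wpM2l.
have : B * y <= B * (A * (2 * e)).
  by apply: ler_wpM2l => //; apply: le_trans h1 _; exact: ler_wpM2l.
have : 0 <= A * e by exact: mulr_ge0.
have : 0 <= A * B * e by rewrite !mulr_ge0.
lra.
Qed.

(** A direction in which the path from [-1] reaches real part 2 at time 1 and passes
above the pole. *)
Definition wdir : C := Complex 3 1.
Definition zpath t : C := -1 + wdir * rc t.

Lemma zpathD t t' : zpath (t + t') = zpath t + wdir * rc t'.
Proof. by rewrite /zpath rcD; ring. Qed.

Lemma Re_zpath t : Re (zpath t) = 3 * t - 1.
Proof. by rewrite /zpath ReD ReM /=; ring. Qed.

Lemma zpath_neq1 t : zpath t <> 1.
Proof.
move=> h; have h1 := congr1 Re h; have h2 := congr1 Im h.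
by move: h1 h2; rewrite Re_zpath /zpath ImD ImM /=; lra.
Qed.

Lemma nrm_wdir : nrm wdir = 4.
Proof. by rewrite /nrm /= normr1 ger0_norm //; ring. Qed.

Lemma analytic_sums (f : C -> C) t0 : analytic_on [set s | s <> 1] f ->
  exists (c : nat -> C) (r : R), [/\ 0 < r,
    (forall z, nrm (z - zpath t0) < 4 * r -> series (fun n => c n * (z - zpath t0) ^+ n) @ \oo --> f z) &
    forall t, `|t| < r -> sums (fun n => c n * wdir ^+ n) t (f (zpath (t0 + t)))].
Proof.
move=> /(_ (zpath t0) (@zpath_neq1 t0))[c /near_cplx[r r0 hr]].
exists c, (r / 4); split; first by rewrite divr_gt0.
  by move=> z; rewrite mulrCA divff // mulr1; exact: hr.
move=> t tr.
have e : zpath (t0 + t) - zpath t0 = wdir * rc t by rewrite zpathD; ring.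
have := hr (zpath (t0 + t)); rewrite e => h.
have {}h := cvg_ctends (h _).
apply: ctends_ext (h _) => [n|]; last by rewrite mulrC nrm_rcM nrm_wdir; lra.
by rewrite seriesEord; apply: eq_bigr => k _; rewrite exprMn mulrA.
Qed.

Variable zeta : C -> C.
Hypothesis zetaP : is_riemann_zeta zeta.

Let good t := ctends (@emval R ^~ (zpath t)) ((1 - zpath t) * zeta (zpath t)).

(** If the truncations converge to [(1 - s) zeta(s)] just after a point of the path, the
limit series of [emcoef_limit] and the local expansion of [(1 - s) zeta(s)] have the
same sum there, hence the same coefficients by [sums_zero], and the convergence
holds on both sides of the point. *)
Lemma continuation_step t0 : 0 <= t0 ->
  exists (c d : nat -> C) (r : R), [/\ 0 < r,
    (forall z, nrm (z - zpath t0) < 4 * r -> series (fun n => d n * (z - zpath t0) ^+ n) @ \oo --> zeta z),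
    (forall k, ctends (emcoef wdir (zpath t0) ^~ k) (c k)) &
    forall r' : R, 0 < r' -> (forall t, 0 < t -> t < r' -> good (t0 + t)) ->
      (forall k, lin wdir (1 - zpath t0) (fun n => d n * wdir ^+ n) k = c k) /\
      forall t, `|t| < r -> good (t0 + t)].
Proof.
move=> t00; have [d [r1 [r10 hd hs]]] := analytic_sums t0 (proj2 zetaP).
have r8 : 0 < 1 / 8 :> R by [].
have w8 : nrm wdir * (1 / 8) <= 1 / 2 by rewrite nrm_wdir; lra.
have s2 : Re (1 - zpath t0) <= 2 by rewrite ReD ReN Re_zpath /=; lra.
have [c [hc hl]] := emcoef_limit r8 w8 s2.
pose r := Num.min r1 (1 / 8).
have r0 : 0 < r by rewrite lt_min r10 r8.
have rr1 : r <= r1 by rewrite ge_min lexx.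
have rr2 : r <= 1 / 8 by rewrite ge_min lexx orbT.
exists c, d, r; split=> //; first by move=> z hz; apply: hd; lra.
move=> r' r'0 hg.
pose c' := lin wdir (1 - zpath t0) (fun n => d n * wdir ^+ n).
have hs' t : `|t| < r -> sums c' t ((1 - zpath (t0 + t)) * zeta (zpath (t0 + t))).
  move=> tr; have -> : 1 - zpath (t0 + t) = (1 - zpath t0) - wdir * rc t by rewrite zpathD; ring.
  by apply: sums_lin; apply: hs; lra.
have zz : forall k, c' k + -1 * c k = 0.
  apply: (@sums_zero R (fun k => c' k + -1 * c k) (Num.min r r')); first by rewrite lt_min r0 r'0.
  move=> t t0'; rewrite lt_min => /andP[tr tr'].
  have ta : `|t| < r by rewrite gtr0_norm.
  have [z h1 h2] := hl t (ltW (lt_le_trans ta rr2)).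
  have h3 : good (t0 + t) by apply: hg.
  rewrite -zpathD in h1.
  have h4 := sumsD (hs' t ta) (sumsZ (-1) h2).
  rewrite (ctends_unique h1 h3) in h4.
  by have -> : (0 : C) = (1 - zpath (t0 + t)) * zeta (zpath (t0 + t)) + -1 * ((1 - zpath (t0 + t)) * zeta (zpath (t0 + t))) by ring.
have cc k : c' k = c k by have := zz k; rewrite mulN1r => /eqP; rewrite subr_eq0 => /eqP.
split=> // t tr; have [z h1 h2] := hl t (ltW (lt_le_trans tr rr2)).
rewrite -zpathD in h1; rewrite /good.
have h3 := hs' t tr; have h4 : c' = c by apply/funext.
by rewrite h4 in h3; rewrite (ctends_unique h3 h2).
Qed.

(** Consider the infimum of the times after which the truncations converge to the
right value.  Were it positive, [continuation_step] would extend the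
convergence to its left. *)
Lemma continuation t : 0 < t -> t <= 1 -> good t.
Proof.
move=> t0 t1; pose T := [set u : R | 0 <= u <= 1 /\ forall t, u < t -> t <= 1 -> good t].
have good_end u : 2 / 3 < u -> good u.
  by move=> u1; apply: emval_dirichlet => //; rewrite Re_zpath; lra.
have T1 : T (3/4) by split; [lra|move=> u u1 _; apply: good_end; lra].
have hT : has_inf T.
  by split; [exists (3/4)|exists 0 => u [/andP[]]].
have i0 : 0 <= inf T by apply: lb_le_inf; [exists (3/4)|move=> u [/andP[]]].
have i1 : inf T <= 3/4 by exact: (inf_lbound (proj2 hT) T1).
have gi u : inf T < u -> u <= 1 -> good u.
  move=> iu u1; have := @inf_adherent R T (u - inf T) _ hT; case; first by lra.
  by move=> u' [_ h] hu'; apply: h => //; lra.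
have [c [d [r [r0 _ _ h]]]] := continuation_step i0.
have := h (1 / 4) _ _; case; [lra|by move=> u u0 u1; apply: gi; lra|move=> _ hg].
suff : inf T = 0 by move=> e; apply: gi => //; rewrite e.
apply/eqP; rewrite eq_le i0 andbT leNgt; apply/negP => ip.
pose u := Num.max 0 (inf T - r / 2).
have u0 : 0 <= u by rewrite le_max lexx.
have u1 : inf T - r / 2 <= u by rewrite le_max lexx orbT.
have u2 : u < inf T by rewrite gt_max ip /=; lra.
have Tu : T u.
  split; first by lra.
  move=> v uv v1; have [vi|vi] := ltP (inf T) v; first exact: gi.
  have -> : v = inf T + (v - inf T) by ring.
  by apply: hg; rewrite ler0_norm; lra.
by have := inf_lbound (proj2 hT) Tu; lra.
Qed.

End Continuation.

(** * The derivative of zeta at -1 *)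

Section ZetaPrime.
Variable R : realType.
Local Notation C := (Cplx R).
Local Notation Re := (@complex.Re R).
Local Notation Im := (@complex.Im R).
Variable zeta : C -> C.
Hypothesis zetaP : is_riemann_zeta zeta.

(** The terms of order at least two are a geometric tail, of the order of the square
of the increment. *)
Lemma power_series_derive1 (f : C -> C) (z0 : C) (d : nat -> C) (r : R) : 0 < r ->
  (forall z, nrm (z - z0) < r -> series (fun n => d n * (z - z0) ^+ n) @ \oo --> f z) ->
  derive1 f z0 = d 1%N.
Proof.
move=> r0 hf.
pose r1 := r / 2; have r10 : 0 < r1 by rewrite divr_gt0.
have hs z : nrm z < r -> ctends (fun n => \sum_(k < n) d k * z ^+ k) (f (z0 + z)).
  move=> zr; have := hf (z0 + z); rewrite (_ : z0 + z - z0 = z); last by ring.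
  by move=> /(_ zr)/cvg_ctends; apply: ctends_ext => n; rewrite seriesEord.
have f0 : f z0 = d 0%N.
  have := hs 0; rewrite nrm0 addr0 => /(_ r0) h; apply: ctends_unique h _.
  move=> e e0; exists 1%N => -[|n] // _.
  rewrite big_ord_recl /= expr0 mulr1 big1 ?addr0 ?subrr ?nrm0 ?(ltW e0) //.
  by move=> i _; rewrite expr0n /= mulr0.
have [B B0 hB] : exists2 B : R, 0 <= B & forall k, nrm (d k) * r1 ^+ k <= B.
  have h0 : nrm (rc r1) < r by rewrite nrm_rc gtr0_norm // /r1; lra.
  by apply: (@sums_coef_bounded _ d r1 (f (z0 + rc r1))) => //; exact: hs.
have key z : nrm z <= r1 / 2 -> nrm (f (z0 + z) - d 0%N - d 1%N * z) <= 2 * B * (nrm z / r1) ^+ 2.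
  move=> zr; set x := nrm z / r1.
  have x0 : 0 <= x by rewrite divr_ge0 ?nrm_ge0 // ltW.
  have x1 : x <= 1 / 2 by rewrite ler_pdivrMr //; lra.
  have zr' : nrm z < r by rewrite /r1 in zr; lra.
  have term k : nrm (d k * z ^+ k) <= B * x ^+ k.
    apply: le_trans (nrmM _ _) _.
    apply: le_trans (ler_wpM2l (nrm_ge0 _) (nrmX z k)) _.
    have -> : nrm z ^+ k = r1 ^+ k * x ^+ k by rewrite -exprMn /x mulrC divfK // gt_eqF.
    by rewrite mulrA ler_wpM2r // exprn_ge0.
  have tail n : nrm (\sum_(k < n.+2) d k * z ^+ k - d 0%N - d 1%N * z) <= B * x ^+ 2 * (2 - 2 * x ^+ n).
    elim: n => [|n IH].
      rewrite !big_ord_recr big_ord0 /= !expr0 expr1.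
      have -> : 0 + d 0%N * 1 + d 1%N * z - d 0%N - d 1%N * z = 0 by ring.
      by rewrite nrm0 mulr1 subrr mulr0.
    rewrite big_ord_recr /=; set S := \sum_(i < n.+2) _ in IH *.
    have -> : S + d n.+2 * z ^+ n.+2 - d 0%N - d 1%N * z = (S - d 0%N - d 1%N * z) + d n.+2 * z ^+ n.+2 by ring.
    apply: le_trans (nrmD _ _) _; apply: le_trans (lerD IH (term _)) _.
    have p0 : 0 <= B * x ^+ 2 * x ^+ n by rewrite mulr_ge0 ?exprn_ge0 // mulr_ge0 // exprn_ge0.
    have : B * x ^+ 2 * x ^+ n * x <= B * x ^+ 2 * x ^+ n * (1 / 2) by exact: ler_wpM2l.
    have -> : x ^+ n.+2 = x ^+ 2 * x ^+ n by rewrite -exprD.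
    by rewrite [x ^+ n.+1]exprSr; lra.
  have h := ctendsD (hs z zr') (@ctends_cst R (- d 0%N - d 1%N * z)).
  rewrite addrA in h; apply: (ctends_le (n0 := 2) h) => -[|[|n]] // _; rewrite addrA.
  apply: le_trans (tail n) _.
  have : 0 <= B * x ^+ 2 * x ^+ n by rewrite mulr_ge0 ?exprn_ge0 // mulr_ge0 // exprn_ge0.
  by lra.
rewrite /derive1; apply: cvg_lim; first exact: norm_hausdorff.
apply/cvgrPdist_le => eps eps0.
have [e e0 epsE] : exists2 e : R, 0 < e & eps = rc e.
  move: eps0; case: (eps) => a b; rewrite ltcE /= => /andP[/eqP -> a0].
  by exists a.
pose dl := Num.min (r1 / 4) (e * r1 ^+ 2 / (8 * (B + 1))).
have B1 : 0 < B + 1 by lra.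
have dl0 : 0 < dl by rewrite lt_min !divr_gt0 ?mulr_gt0 ?exprn_gt0.
have dlC : (0 : C) < rc dl by rewrite ltcE /= eqxx.
near=> h.
have h0 : h != 0 by near: h; exact: nbhs_dnbhs_neq.
have hd : `|h| <= rc dl by near: h; exact: dnbhs0_le.
pose m := Re `|h|.
have hm : `|h| = rc m := norm_real h.
have mdl : m <= dl by move: hd; rewrite hm lecE /= => /andP[].
have m0 : 0 < m.
  have : (0 : C) < `|h| by rewrite normr_gt0.
  by rewrite hm ltcE /= => /andP[].
have nh : nrm h <= 2 * m by have [_] := nrm_norm h.
have d1 : dl <= r1 / 4 by rewrite ge_min lexx.
have d2 : dl <= e * r1 ^+ 2 / (8 * (B + 1)) by rewrite ge_min lexx orbT.
set E := f (z0 + h) - d 0%N - d 1%N * h.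
have hE : nrm E <= 2 * B * (nrm h / r1) ^+ 2 by apply: key; lra.
have -> : d 1%N - h^-1 *: (f (h + z0) - f z0) = - (h^-1 * E).
  rewrite /E f0 [h + z0]addrC /GRing.scale /=; field; exact: h0.
rewrite normrN normrM normfV mulrC ler_pdivrMr ?normr_gt0 //.
have [E1 _] := nrm_norm E; apply: le_trans E1 _.
rewrite hm epsE -rcM lecE /= eqxx /=.
apply: le_trans hE _; rewrite expr_div_n mulrA ler_pdivrMr ?exprn_gt0 //.
have nh2 : nrm h ^+ 2 <= (2 * m) ^+ 2.
  by apply: lerXn2r; rewrite ?nnegrE ?nrm_ge0 ?mulr_ge0 ?(ltW m0).
apply: le_trans (_ : 2 * B * (2 * m) ^+ 2 <= _); first by apply: ler_wpM2l => //; exact: mulr_ge0.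
have h3 : m * (8 * (B + 1)) <= e * r1 ^+ 2.
  by rewrite -ler_pdivlMr ?mulr_gt0 //; exact: le_trans d2.
have h4 : m * (m * (8 * (B + 1))) <= m * (e * r1 ^+ 2) by rewrite ler_wpM2l // ltW.
have : 0 <= m * m by rewrite mulr_ge0 // ltW.
have -> : 2 * B * (2 * m) ^+ 2 = 8 * B * (m * m) by ring.
lra.
Unshelve. all: by end_near.
Qed.

Section AtMinusOne.
Variable w : C.

Let bigsumS (f : nat -> C) M : \sum_(n < M.+1) f n = \sum_(n < M) f n + f M.
Proof. by rewrite big_ord_recr. Qed.

Let two : 1 - - 1 = rc 2 :> C.
Proof. by rewrite opprK (_ : (1 : C) = rc 1) // -rcD. Qed.

Let eqD (v : R) : cpow (1 - - 1) v = rc (expR (2 * ln v)).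
Proof. by rewrite two cpow_rc. Qed.

Let b0E k (v : R) : 0 < v -> bcoef w (-1) 0 v k = (- w) ^+ k * rc (v ^+ 2 * ln v ^+ k / k`!%:R).
Proof.
move=> v0; rewrite /bcoef eqD expRM_natl lnK ?posrE // exprMn !rcM !rcX; ring.
Qed.

Let sub1 : 1 - - 1 - 0%:R = rc 2 :> C.
Proof. by rewrite subr0 two. Qed.

Let sub2 : 1 - - 1 - 1%:R = 1 :> C.
Proof. by ring. Qed.

Let b1E (v : R) : 0 < v -> bcoef w (-1) 1 v 0 = rc (2 * v) /\ bcoef w (-1) 1 v 1 = - w * rc (2 * (v * ln v) + v).
Proof.
move=> v0; have vn := lt0r_neq0 v0; rewrite !bcoefS /lin sub1 !b0E // fact0 !divr1 !expr0 !expr1 !mulr1 !mul1r subr0.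
split; first by rewrite -!rcM; congr rc; field.
have -> : rc (2 * (v * ln v) + v) = rc v^-1 * (rc 2 * rc (v ^+ 2 * ln v) + rc (v ^+ 2)).
  by rewrite -!rcM -rcD -rcM; congr rc; field.
by ring.
Qed.

Let b2E (v : R) : 0 < v -> bcoef w (-1) 2 v 0 = rc 2 /\ bcoef w (-1) 2 v 1 = - w * rc (2 * ln v + 3).
Proof.
move=> v0; have vn := lt0r_neq0 v0; have [e1 e2] := b1E v0.
rewrite ![bcoef w (-1) 2 v _]bcoefS /lin sub2 e1 e2 subr0 !mul1r.
split; first by rewrite -!rcM; congr rc; field.
have -> : rc (2 * ln v + 3) = rc v^-1 * (rc (2 * (v * ln v) + v) + rc (2 * v)).
  by rewrite -rcD -rcM; congr rc; field.
by ring.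
Qed.

(** Constant in [N]: the Euler-Maclaurin formula is exact for [v^2]. *)
Lemma emcoef0 N : (0 < N)%N -> emcoef w (-1) N 0 = rc (- (1 / 6)).
Proof.
move=> N0; have v0 : 0 < N%:R :> R by rewrite ltr0n.
rewrite /emcoef (b1E v0).1 (b2E v0).1 b0E // fact0 expr0 expr0 mul1r mulr1 divr1.
have -> : \sum_(n < N) bcoef w (-1) 1 n.+1%:R 0 = rc (N%:R * (N%:R + 1)).
  elim: N {N0 v0} => [|N IH]; first by rewrite big_ord0 mul0r.
  have p : 0 < N.+1%:R :> R by rewrite ltr0n.
  rewrite (bigsumS (fun n => bcoef w (-1) 1 n.+1%:R 0)) IH (b1E p).1 -[N.+1%:R]natr1 -rcD.
  by congr rc; ring.
by rewrite -!rcM -!rcD; congr rc; field.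
Qed.

(** The derivative of [n^(- s)] in [s] produces [n ln n] at [s = -1]. *)
Lemma emcoef1 N : (0 < N)%N ->
  emcoef w (-1) N 1 = - w * rc (2 * (sumilni R N - glaisher_main N%:R) - 1 / 4).
Proof.
move=> N0; have v0 : 0 < N%:R :> R by rewrite ltr0n.
rewrite /emcoef (b1E v0).2 (b2E v0).2 b0E // (_ : 1`!%:R = 1 :> R) // divr1 !expr1.
have -> : \sum_(n < N) bcoef w (-1) 1 n.+1%:R 1 = - w * rc (2 * sumilni R N + N%:R * (N%:R + 1) / 2).
  elim: N {N0 v0} => [|N IH].
    by rewrite big_ord0 /sumilni big_ord0 (_ : 2 * 0 + _ = 0) ?rc0 ?mulr0 //; ring.
  have p : 0 < N.+1%:R :> R by rewrite ltr0n.
  rewrite (bigsumS (fun n => bcoef w (-1) 1 n.+1%:R 1)) IH (b1E p).2 -mulrDr -rcD; congr (_ * rc _).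
  rewrite /sumilni big_ord_recr /=; move: (\sum_(_ < _) _) (ln _) => x y.
  by rewrite -[N.+1%:R]natr1; field.
rewrite (mulrCA (rc (-1))) (mulrCA (rc (- (1 / 2)))) (mulrCA (rc (- (1 / 12)))).
rewrite -!mulrDr -!rcM -!rcD; congr (_ * rc _).
by rewrite /glaisher_main; move: (sumilni R N) (ln _) => x y; field.
Qed.
End AtMinusOne.

(** Compare the coefficients of order 0 and 1 at [-1]: they are [2 zeta(-1) = - 1/6]
and [w (2 zeta'(-1) - zeta(-1)) = - w (2 kappa - 1/4)]. *)
Lemma zeta_prime (kappa : R) :
  (fun n => sumilni R n - glaisher_main n%:R) @ \oo --> kappa ->
  Re (derive1 zeta (- 1)) = 1 / 12 - kappa.
Proof.
move=> hk.
have [c [d [r [r0 hd hc h]]]] := continuation_step zetaP (lexx 0).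
have p0 : zpath 0 = -1 :> C by rewrite /zpath rc0 mulr0 addr0.
have [] := h 1 ltr01.
  by move=> t t0 t1; rewrite add0r; apply: continuation => //; exact: ltW.
move=> hl _.
have r40 : 0 < 4 * r by rewrite mulr_gt0.
have := power_series_derive1 r40 hd; rewrite p0 => ->.
rewrite p0 in hc hl.
have c0 : c 0%N = rc (- (1 / 6)).
  apply: ctends_unique (hc 0%N) _ => e e0; exists 1%N => N N1.
  by rewrite emcoef0 // subrr nrm0 ltW.
have c1 : c 1%N = - wdir R * rc (2 * kappa - 1 / 4).
  apply: ctends_unique (hc 1%N) _.
  have hx : ctends (fun N => rc (2 * (sumilni R N - glaisher_main N%:R) - 1 / 4)) (rc (2 * kappa - 1 / 4)).
    apply: ctends_ReIm; last exact: cvg_cst.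
    by apply: cvgB; [apply: cvgM => //; exact: cvg_cst | exact: cvg_cst].
  have := ctendsZ (- wdir R) hx; move=> hx2 e e0; have [N hN] := hx2 e e0.
  exists (maxn 1 N) => n; rewrite geq_max => /andP[n1 Nn].
  by rewrite emcoef1 //; exact: hN.
have e2 : 1 - - 1 = rc 2 :> C by rewrite opprK (_ : (1 : C) = rc 1) // -rcD.
have := hl 0%N; have := hl 1%N; rewrite /lin e2 c0 c1 expr0 expr1 mulr1 subr0 => h1 h0.
have w0 : wdir R != 0.
  by apply/eqP => /(congr1 Re) /= /eqP; rewrite pnatr_eq0.
have h2 : wdir R * (rc 2 * d 1%N - d 0%N) = wdir R * - rc (2 * kappa - 1 / 4).
  by rewrite mulrN -mulNr -h1; ring.
have /(congr1 Re) := mulfI w0 h2; have /(congr1 Re) := h0.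
by rewrite ReD !ReN !ReM /= !mul0r !subr0; lra.
Qed.

End ZetaPrime.

(** * Incomplete gamma functions and the Poisson distribution *)

Section PoissonTail.
Variable R : realType.
Implicit Types (x t : R) (k n : nat).

(** The probability that a Poisson variable of mean [x] is smaller than [k]; [poisw] is
the mass at [k]. *)
Definition pois x k : R := expR (- x) * \sum_(j < k) x ^+ j / j`!%:R.
Definition poisw x k : R := expR (- x) * (x ^+ k / k`!%:R).

Lemma poisS x k : pois x k.+1 = pois x k + poisw x k.
Proof. by rewrite /pois big_ord_recr /= mulrDr. Qed.

Lemma pois1 x : pois x 1 = expR (- x).
Proof. by rewrite /pois big_ord_recr big_ord0 /= add0r fact0 divr1 mulr1. Qed.

Lemma dv_pois t k : dv (pois ^~ k.+1) t (- poisw t k).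
Proof.
elim: k => [|k IH].
  rewrite (_ : pois ^~ 1%N = fun t => expR (- t)); last by apply/funext => u; rewrite pois1.
  apply: dv_eq; first exact: (dvE (dvN (dvI t))).
  by rewrite /poisw expr0 fact0 divr1; ring.
rewrite (_ : pois ^~ k.+2 = fun t => pois t k.+1 + expR (- t) * (t ^+ k.+1 / k.+1`!%:R)); last first.
  by apply/funext => u; rewrite poisS.
apply: dv_eq.
  exact: (dvD IH (dvM (dvE (dvN (dvI t))) (dvM (dvX k.+1 (dvI t)) (dvC t k.+1`!%:R^-1)))).
rewrite /poisw /= factS natrM invfM.
have h1 : k.+1%:R != 0 :> R by rewrite pnatr_eq0.
have h2 : k`!%:R != 0 :> R by rewrite pnatr_eq0 -lt0n fact_gt0.
move: (k.+1%:R : R) (k`!%:R : R) h1 h2 => a b h1 h2.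
by field; rewrite h1 h2.
Qed.

Lemma pois_0 k : pois 0 k.+1 = 1.
Proof.
rewrite /pois oppr0 expR0 mul1r big_ord_recl /= expr0 fact0 divr1 big1 ?addr0 // => i _.
by rewrite expr0n /= mul0r.
Qed.

Lemma poisw_cvg0 k : (fun n : nat => poisw n%:R k) @ \oo --> (0 : R).
Proof.
have h := inv_cvg0 k.+1%:R 0.
apply: (@squeeze_cvgr _ _ _ _ (fun=> 0) (fun n : nat => k.+1%:R * n%:R^-1 ^+ 1)); last 2 first.
- exact: cvg_cst.
- exact: h.
exists 1%N => // n /= n1.
have n0 : 0 < n%:R :> R by rewrite ltr0n.
apply/andP; split; first by rewrite /poisw mulr_ge0 ?expR_ge0 // divr_ge0 ?exprn_ge0.
have h2 := expR_ge_pow k.+1 (ltW n0).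
rewrite /poisw expRN mulrC ler_pdivrMr ?expR_gt0 // mulrC expr1.
apply: le_trans (_ : n%:R ^+ k.+1 / k.+1`!%:R * (k.+1%:R / n%:R) <= _); last first.
  by rewrite [leRHS]mulrC ler_wpM2r // divr_ge0.
rewrite factS natrM invfM exprS.
have h3 : k.+1%:R != 0 :> R by rewrite pnatr_eq0.
have h4 : k`!%:R != 0 :> R by rewrite pnatr_eq0 -lt0n fact_gt0.
have h5 := lt0r_neq0 n0.
rewrite le_eqVlt; apply/orP; left; apply/eqP.
move: (k.+1%:R : R) (k`!%:R : R) (n%:R : R) h3 h4 h5 => a b c h3 h4 h5.
by field; rewrite h3 h4 h5.
Qed.

Lemma pois_cvg0 k : (fun n : nat => pois n%:R k) @ \oo --> (0 : R).
Proof.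
elim: k => [|k IH].
  by under eq_fun do rewrite /pois big_ord0 mulr0; exact: cvg_cst.
under eq_fun do rewrite poisS.
by rewrite -[0]addr0; apply: cvgD => //; exact: poisw_cvg0.
Qed.

(** [t^k e^(- t)] has the antiderivative [- k! pois t k.+1], which vanishes at
infinity. *)
Lemma upper_gammaE k x : 0 <= x -> upper_gamma k.+1 x = k`!%:R * pois x k.+1.
Proof.
move=> x0.
have k0 : k`!%:R != 0 :> R by rewrite pnatr_eq0 -lt0n fact_gt0.
pose b := Num.bound x.
have xb : x < b%:R := archi_boundP x0.
have int : (\int[lebesgue_measure]_(t in `[x, +oo[) (t ^+ k * expR (- t))%:E)%E = (k`!%:R * pois x k.+1)%:E.
  apply: (@ge0_integral_exhaust _ _ (fun=> x) (fun n => (b.+1 + n)%:R) _ (fun t => k`!%:R * - pois t k.+1)).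
  - exact: measurable_itv.
  - by move=> n; apply: lt_le_trans xb _; rewrite ler_nat addSnnS leq_addr.
  - by move=> m n mn; rewrite lexx ler_nat leq_add2l.
  - move=> t; rewrite /= in_itv /= andbT; split=> [xt|[n /andP[]//]].
    exists (Num.bound t); rewrite xt /=.
    apply: le_trans (ltW (archi_boundP _)) _; first exact: le_trans xt.
    by rewrite ler_nat leq_addl.
  - move=> t _; apply: dv_eq; first exact: (dvM (dvC t k`!%:R) (dvN (dv_pois t k))).
    by rewrite /poisw opprK mul0r add0r; field.
  - move=> t _; apply: (dv_cont (a := k%:R * t ^+ k.-1 * 1 * expR (- t) + t ^+ k * (expR (- t) * -1))).
    exact: (dvM (dvX k (dvI t)) (dvE (dvN (dvI t)))).
  - move=> t; rewrite /= in_itv /= andbT => xt; rewrite mulr_ge0 ?expR_ge0 // exprn_ge0 //.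
    exact: le_trans xt.
  - have -> : k`!%:R * pois x k.+1 = k`!%:R * - 0 - k`!%:R * - pois x k.+1 by ring.
    apply: cvgB; last exact: cvg_cst.
    apply: cvgM; first exact: cvg_cst.
    apply: cvgN; exact: (cvg_comp (addn b.+1) (fun n => pois n%:R k.+1) (cvg_addnl b.+1) (pois_cvg0 k.+1)).
by rewrite /upper_gamma /Rintegral int.
Qed.

Lemma gamma_ratio k x : 0 <= x -> (0 < k)%N -> upper_gamma k x / gamma R k = pois x k.
Proof.
case: k => // k x0 _; rewrite /gamma !upper_gammaE // pois_0 mulr1.
by rewrite mulrAC divff ?mul1r // pnatr_eq0 -lt0n fact_gt0.
Qed.

Lemma pois_cvg1 x : pois x @ \oo --> (1 : R).
Proof.
have -> : (1 : R) = expR (- x) * expR x by rewrite -expRD addNr expR0.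
rewrite /pois; apply: cvgM; first exact: cvg_cst.
have -> : (fun k => \sum_(j < k) x ^+ j / j`!%:R) = series (exp_coeff x).
  by apply/funext => k; rewrite seriesEord.
exact: is_cvg_series_exp_coeff.
Qed.

Lemma pois_gt0 x k : 0 < x -> 0 < pois x k.+1.
Proof.
move=> x0; rewrite /pois mulr_gt0 ?expR_gt0 // big_ord_recl /= expr0 fact0 divr1.
rewrite ltr_wpDr // sumr_ge0 // => i _; rewrite divr_ge0 ?exprn_ge0 //; exact: ltW.
Qed.

Lemma pois_nondecr x k : 0 < x -> pois x k <= pois x k.+1.
Proof.
move=> x0; rewrite poisS lerDl /poisw mulr_ge0 ?expR_ge0 // divr_ge0 ?exprn_ge0 //; exact: ltW.
Qed.

Lemma pois_le1 x k : 0 < x -> pois x k <= 1.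
Proof.
move=> x0; have nd : nondecreasing_seq (pois x) by apply/nondecreasing_seqP => n; exact: pois_nondecr.
have c := pois_cvg1 x; rewrite -(cvg_lim (@Rhausdorff R) c).
by apply: nondecreasing_cvgn_le => //; exact: (cvgP _ c).
Qed.

End PoissonTail.

(** * The integrals over the negative half-line *)

Section LeftTail.
Variable R : realType.
Implicit Types (f g : R -> R) (y t : R).
Local Notation sp := (Num.sqrt (pi : R)).

(** [erfc y / 2 = 1 - erfc (- y) / 2] and [erfc (- y)] is Gaussian. *)
Lemma lnerfc_decay n : exists2 C : R, 0 <= C & forall y, y <= 0 -> `|y ^+ n * lnerfc y| <= C * D y.
Proof.
have [b b0 hb] := decays_bound (decays_gauss R n).
have s0 : 0 < sp := sqrtpi_gt0 R.
exists (2 / sp * b); first by rewrite mulr_ge0 // divr_ge0 // ltW.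
move=> y y0.
have ny : 0 <= - y by lra.
have en := E_le2 ny; have e0 := E_gt0 (- y); have g0 := gauss_gt0 y.
have er := erfc_gt0 (- y).
have eb : erfc (- y) <= 1.
  rewrite -(erfc0 R); move: ny; rewrite le_eqVlt => /orP[/eqP <-//|/erfc_decr/ltW].
  by [].
pose u := - (erfc (- y) / 2).
have ee : erfc y = 2 - erfc (- y) by rewrite erfcN; ring.
have Fu : lnerfc y = ln (1 + u) by rewrite /lnerfc /u ee; congr ln; field.
have hu : `|u| <= 1/2 by rewrite normrN ger0_norm; lra.
have l := ln1D_approx hu.
have Fb : `|lnerfc y| <= 2 / sp * gauss y.
  apply: le_trans (_ : erfc (- y) <= _).
    rewrite Fu; have -> : ln (1 + u) = (ln (1 + u) - u) + u by ring.
    apply: le_trans (ler_normD _ _) _.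
    have -> : `|u| = erfc (- y) / 2 by rewrite normrN ger0_norm; lra.
    have : u ^+ 2 <= erfc (- y) / 2 by rewrite /u sqrrN expr2; nra.
    by move: l; lra.
  rewrite erfcE {1}/gauss sqrrN -/(gauss y).
  have -> : 2 / sp * gauss y = gauss y * 2 / sp by ring.
  by rewrite ler_pM2r ?invr_gt0 // ler_wpM2l // ltW.
rewrite normrM; apply: le_trans (ler_wpM2l (normr_ge0 _) Fb) _.
have := hb y; rewrite normrM (ger0_norm (ltW g0)) => hg.
have -> : `|y ^+ n| * (2 / sp * gauss y) = 2 / sp * (`|y ^+ n| * gauss y) by ring.
by rewrite -[leRHS]mulrA ler_wpM2l // divr_ge0 // ltW.
Qed.

Lemma dv_neg (G g : R -> R) : (forall y, dv G y (g y)) -> forall t, dv (fun t => G (- t)) t (- g (- t)).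
Proof. by move=> h t; apply: dv_eq; first exact: (dvcomp (h (- t)) (dvN (dvI t))); ring. Qed.

Lemma neg_tail (G g : R -> R) (C : R) : 0 <= C -> (forall y, dv G y (g y)) ->
  (forall y, y <= 0 -> `|g y| <= C * D y) -> exists l, tends (fun t => G (- t)) l.
Proof.
move=> C0 dG hg.
have [||||l hl _] := @tends_dominated R (fun t => G (- t)) (fun t => - g (- t)) (fun t => C * atan t) (fun t => C * D t) 0 (C * (pi / 2)).
- by move=> t _; exact: dv_neg.
- move=> t _; apply: dv_eq; first exact: (dvM (dvC t C) (is_derive1_atan t)).
  by rewrite /D; ring.
- move=> t t0; rewrite normrN; have := hg (- t); rewrite oppr_le0 => /(_ t0).
  by rewrite /D sqrrN.
- by move=> t _; rewrite ler_wpM2l // ltW // atan_ltpi2.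
by exists l.
Qed.

Lemma neg_integral (G g K k : R -> R) (l l' : R) :
  (forall y, dv G y (g y)) -> continuous g -> (forall y, dv K y (k y)) -> continuous k ->
  (forall y, y <= 0 -> `|g y| <= k y) ->
  tends (fun t => G (- t)) l -> tends (fun t => K (- t)) l' ->
  \int[lebesgue_measure]_(y in `]-oo, 0]) g y = G 0 - l.
Proof.
move=> dG cg dK ck gk hl hl'.
apply: (@Rintegral_exhaust R `]-oo, 0] (fun n => - n.+1%:R) (fun=> 0) g G k K _ (K 0 - l')).
- exact: measurable_itv.
- by move=> n; rewrite oppr_lt0.
- by move=> m n mn; rewrite lexx lerN2 ler_nat.
- move=> y; rewrite /= in_itv /=; split=> [y0|[n /andP[]//]].
  exists (Num.bound (- y)); rewrite y0 andbT lerNl.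
  by apply: le_trans (ltW (archi_boundP _)) _; rewrite ?ler_nat //; lra.
- by move=> y _; exact: dG.
- by move=> y _; exact: cg.
- by move=> y _; exact: dK.
- by move=> y _; exact: ck.
- by move=> y; rewrite /= in_itv /=; exact: gk.
- apply: cvgB; first exact: cvg_cst.
  by apply: (@tends_seq R (fun t => G (- t)) l (fun n => n.+1%:R) 0) => // n; rewrite addr0 ler_nat.
- apply: cvgB; first exact: cvg_cst.
  by apply: (@tends_seq R (fun t => K (- t)) l' (fun n => n.+1%:R) 0) => // n; rewrite addr0 ler_nat.
Qed.

Lemma tendsN (f : R -> R) (l : R) : tends f l -> tends (fun t => - f t) (- l).
Proof.
move=> h e e0; have [a ha] := h e e0; exists a => x xa.
by rewrite -opprD normrN; exact: ha.
Qed.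

Lemma lnerfc_le0 y : lnerfc y <= 0.
Proof.
apply: ln_le0; have := erfc_lt2 y; lra.
Qed.

Lemma gauss_erfc y : gauss y / (sp * erfc y) = (E y)^-1.
Proof.
have s0 := sqrtpi_gt0 R; have e0 := erfc_gt0 y; have g := expR_gt0 (y ^+ 2).
rewrite /E /gauss expRN; field.
by rewrite !lt0r_neq0.
Qed.

(** The integrand of [J-] is the derivative of [y^2 lnerfc - IC / 2], where the first
term vanishes at both ends. *)
Lemma neg_constants (IF IC : R -> R) :
  (forall y, dv IF y (lnerfc y)) -> (forall y, dv IC y (corrR y)) -> IF 0 = 0 -> IC 0 = 0 ->
  exists lF lC : R, [/\ tends (fun t => IF (- t)) lF, tends (fun t => IC (- t)) lC,
    \int[lebesgue_measure]_(y in `]-oo, (0 : R)]) ln (erfc y / 2) = - lF & Jminus R = lC / 2].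
Proof.
move=> dIF dIC F0 C0.
have [C0' hC0 hF] := lnerfc_decay 0.
have [lF hlF] : exists l, tends (fun t => IF (- t)) l.
  by apply: (neg_tail hC0 dIF) => y /hF; rewrite expr0 mul1r.
have [C1 C10 hC] := right_bounds R.
have [lC hlC] : exists l, tends (fun t => IC (- t)) l.
  by apply: (neg_tail C10 dIC) => y y0; have [|_ ->] := hC y; first lra.
exists lF, lC; split=> //.
  rewrite (@neg_integral IF (@lnerfc R) (fun y => - IF y) (fun y => - lnerfc y) lF (- lF)) //.
  - by rewrite F0 sub0r.
  - by move=> y; exact: (dv_cont (dv_lnerfc y)).
  - by move=> y; exact: (dvN (dIF y)).
  - by move=> y; exact: (dv_cont (dvN (dv_lnerfc y))).
  - by move=> y _; rewrite ler0_norm // lnerfc_le0.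
  - exact: tendsN.
(* On the negative half-line [y lnerfc >= 0], so [2 y lnerfc + (1 + 5 y^2) / (3 E)]
   dominates the integrand.  It is the derivative of [y^2 lnerfc] plus an
   antiderivative of [Bn], as [(1 + 11 y^2) / 3 - 2 y^2 = (1 + 5 y^2) / 3]. *)
pose Bn y := (1 + 11 * y ^+ 2) / 3 * (E y)^-1.
have dE y := dvV (lt0r_neq0 (E_gt0 y)) (dv_E y).
have cB : continuous Bn.
  move=> y; apply: dv_cont.
  exact: (dvM (dvM (dvD (dvC y 1) (dvM (dvC y 11) (dvX 2 (dvI y)))) (dvC y 3^-1)) (dE y)).
have [IB IB0 dIB] := antiderivative cB.
have [lB hlB] : exists l, tends (fun t => IB (- t)) l.
  apply: (neg_tail (C := 11 / 2 * C1) _ dIB) => [|y y0]; first by lra.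
  have [|_ h _] := hC y; first lra.
  have e0 := E_gt0 y.
  have i0 : 0 < (E y)^-1 by rewrite invr_gt0.
  have := sqr_ge0 y; move: h; rewrite /Bn /corrR => h y2.
  have h1 : - (2 / 3) * ((1 + y ^+ 2) / E y) <= 0.
    by have := mulr_ge0 (addr_ge0 ler01 y2) (ltW i0); lra.
  rewrite ler0_norm // in h.
  rewrite ger0_norm; last by rewrite mulr_ge0 ?(ltW i0) //; lra.
  have h2 : 0 <= 10 * (E y)^-1 by rewrite mulr_ge0 // ltW.
  by move: h h2 i0; move: (E y)^-1 => v; nra.
have y2F : tends (fun t => (- t) ^+ 2 * lnerfc (- t)) 0.
  have [C4 C40 h4] := lnerfc_decay 4.
  apply: (@tends_inv R _ 0 C4) => t t1; rewrite subr0.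
  have t0 : 0 < t by lra.
  have nt : - t <= 0 by lra.
  have := h4 (- t) nt; have -> : (- t) ^+ 4 = t ^+ 2 * (- t) ^+ 2 by ring.
  rewrite -mulrA normrM (ger0_norm (sqr_ge0 t)) => h.
  have D1 : D (- t) <= 1 by exact: D_le1.
  have h5 : C4 * D (- t) <= C4 * 1 by exact: ler_wpM2l.
  rewrite ler_pdivlMr // mulrC; have := normr_ge0 ((- t) ^+ 2 * lnerfc (- t)).
  move: (`|_|) h => z h z0.
  have : t * z <= t ^+ 2 * z by rewrite ler_wpM2r // expr2; nra.
  lra.
pose H y := y ^+ 2 * lnerfc y - 1 / 2 * IC y.
rewrite /Jminus.
have dy2F y := dvM (dvX 2 (dvI y)) (dv_lnerfc y).
rewrite (_ : (fun y : R => _) = fun y => 2 * y * lnerfc y + (1 - 5 * y ^+ 2) / 3 * (E y)^-1); last first.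
  apply/funext => y; rewrite -gauss_erfc /lnerfc /gauss; congr (_ + _).
  have s0 := sqrtpi_gt0 R; have e0 := erfc_gt0 y.
  by field; rewrite !lt0r_neq0.
rewrite (@neg_integral H _ (fun y => y ^+ 2 * lnerfc y + IB y) (fun y => 2 * y * lnerfc y + (1 + 5 * y ^+ 2) / 3 * (E y)^-1) (0 - 1 / 2 * lC) (0 + lB)) //.
- by rewrite /H C0 expr0n /=; field.
- move=> y; apply: dv_eq; first exact: (dvD (dy2F y) (dvN (dvM (dvC y (1/2)) (dIC y)))).
  by rewrite /lnerfc1 /corrR; field; rewrite lt0r_neq0 // E_gt0.
- move=> y; apply: dv_cont.
  exact: (dvD (dvM (dvM (dvC y 2) (dvI y)) (dv_lnerfc y)) (dvM (dvM (dvD (dvC y 1) (dvN (dvM (dvC y 5) (dvX 2 (dvI y))))) (dvC y 3^-1)) (dE y))).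
- move=> y; apply: dv_eq; first exact: (dvD (dy2F y) (dIB y)).
  by rewrite /lnerfc1 /Bn; field; rewrite lt0r_neq0 // E_gt0.
- move=> y; apply: dv_cont.
  exact: (dvD (dvM (dvM (dvC y 2) (dvI y)) (dv_lnerfc y)) (dvM (dvM (dvD (dvC y 1) ((dvM (dvC y 5) (dvX 2 (dvI y))))) (dvC y 3^-1)) (dE y))).
- move=> y y0; have f0 := lnerfc_le0 y.
  have i0 : 0 < (E y)^-1 by rewrite invr_gt0 E_gt0.
  have h : 0 <= 2 * y * lnerfc y by rewrite mulr_le0 //; lra.
  rewrite ler_norml; have := sqr_ge0 y; move: (E y)^-1 i0 => v i0 y2.
  have : 0 <= y ^+ 2 * v by rewrite mulr_ge0 // ltW.
  by move=> ?; apply/andP; split; lra.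
- exact: (tendsD y2F (tendsN (tendsZ (1/2) hlC))).
- exact: (tendsD y2F hlB).
Qed.

End LeftTail.

(** * The integrals over the positive half-line *)

Section RightTail.
Variable R : realType.
Implicit Types (f g : R -> R) (y t : R).
Local Notation sp := (Num.sqrt (pi : R)).

(** [psi = 2 E A1 - A2] satisfies [psi' = (2 E + 2 y) psi - 4 E^2 A1].  Multiplied by the
inverse of the exponential of an antiderivative of [2 E + 2 y] it is therefore
nonincreasing, and it is bounded below by a function that tends to 0.  Together
with [ln u <= u - 1] the inequality makes [y^2 ln (y E)] nonincreasing. *)
Lemma A2_le_EA1 y : 0 <= y -> A 2 y <= 2 * E y * A 1 y.
Proof.
move=> y0.
have cE : continuous (@E R) by move=> u; exact: (dv_cont (dv_E u)).
have [IE IE0 dIE] := antiderivative cE.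
have IE_ge u : 0 <= u -> 0 <= IE u.
  by move=> u0; rewrite -IE0; apply: (dv_nondecr u0 (fun t _ => dIE t)) => t _; exact: ltW (E_gt0 t).
pose psi (u : R) := 2 * E u * A 1 u - A 2 u.
pose W u := 2 * IE u + u ^+ 2.
pose H u := psi u * expR (- W u).
have dH u : dv H u (- (4 * E u ^+ 2 * A 1 u * expR (- W u))).
  apply: dv_eq.
    exact: (dvM (dvD (dvM (dvM (dvC u 2) (dv_E' u)) (dv_A 1 u)) (dvN (dv_A 2 u)))
      (dvE (dvN (dvD (dvM (dvC u 2) (dIE u)) (dvX 2 (dvI u)))))).
  by rewrite /psi /W A3E !A2E !A1E /=; ring.
have [B B0 hB] : exists2 B : R, 0 <= B & forall u, 0 <= u -> - B <= psi u.
  exists (45 * 2 ^+ 3) => [|u u0]; first by lra.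
  have e0 := E_gt0 u; have a1 := A_gt0 1 u.
  have := A2_le u0; have := E_le2 u0 => e2 a2.
  have : E u ^+ 3 <= 2 ^+ 3 by apply: lerXn2r; rewrite ?nnegrE ?(ltW e0).
  have : 0 <= 2 * E u * A 1 u by apply: mulr_ge0; [apply: mulr_ge0 => //|]; exact: ltW.
  by rewrite /psi; lra.
have H_ge0 : 0 <= H y.
  rewrite leNgt; apply/negP => Hy.
  pose z := Num.max (y + 1) ((B + 1) / - H y).
  have zy : y + 1 <= z by rewrite le_max lexx.
  have zB : (B + 1) / - H y <= z by rewrite le_max lexx orbT.
  have yz : y <= z by lra.
  have z1 : 1 <= z by lra.
  have hz : H z <= H y.
    have := @dv_nondecr R (fun u => - H u) (fun u => 4 * E u ^+ 2 * A 1 u * expR (- W u)) y z yz.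
    rewrite lerN2; apply=> u _; first by rewrite -[X in dv _ _ X]opprK; exact: dvN.
    apply: mulr_ge0; last exact: expR_ge0.
    apply: mulr_ge0; last exact: ltW (A_gt0 1 u).
    by apply: mulr_ge0 => //; exact: sqr_ge0.
  have ew : expR (- W z) <= z^-1.
    rewrite expRN lef_pV2 ?posrE ?expR_gt0 //; last by lra.
    apply: le_trans (_ : expR z <= _); first by have := expR_ge1Dx z; lra.
    rewrite ler_expR /W; have := IE_ge z; have : z <= z ^+ 2 by rewrite expr2; nra.
    by lra.
  have e0 := expR_ge0 (- W z).
  have z0 : 0 < z by lra.
  have h1 : - B * expR (- W z) <= H z.
    by rewrite /H ler_wpM2r // hB //; lra.
  have h2 : B * expR (- W z) <= B * z^-1 by exact: ler_wpM2l.
  have nH : 0 < - H y by rewrite oppr_gt0.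
  move: zB; rewrite ler_pdivrMr // => zB.
  have h3 : B * z^-1 < - H y.
    rewrite -(@ltr_pM2r _ z) // divfK ?gt_eqF // mulrC; lra.
  lra.
have : 0 <= psi y by have := H_ge0; rewrite /H pmulr_lge0 // expR_gt0.
by rewrite /psi; lra.
Qed.

(** Positivity of [A 2] and of [A 3], with [1 - 1 / u <= ln u <= u - 1]. *)
Lemma ln_yE y : 0 < y -> 0 <= ln (y * E y) + 1 / (2 * y ^+ 2) <= 3 / (4 * y ^+ 4).
Proof.
move=> y0; have e0 := E_gt0 y.
have t0 : 0 < y * E y by exact: mulr_gt0.
have y20 : 0 < y ^+ 2 by exact: exprn_gt0.
apply/andP; split.
  have := A_gt0 2 y; rewrite A2E A1E => h.
  have h1 : 1 - (y * E y)^-1 <= ln (y * E y).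
    have := @le_ln1Dx R ((y * E y)^-1 - 1).
    have -> : 1 + ((y * E y)^-1 - 1) = (y * E y)^-1 by ring.
    rewrite lnV ?posrE // => h2.
    have : -1 < (y * E y)^-1 - 1 by rewrite ltrBrDr addNr invr_gt0.
    by move=> /h2; lra.
  have : (y * E y)^-1 <= 1 + 1 / (2 * y ^+ 2).
    rewrite -(@ler_pM2r _ (y * E y)) // mulVf ?gt_eqF //.
    have -> : (1 + 1 / (2 * y ^+ 2)) * (y * E y) = (2 * y ^+ 2 + 1) * E y / (2 * y).
      by field; rewrite lt0r_neq0.
    by rewrite ler_pdivlMr ?mulr_gt0 //; lra.
  by lra.
have h1 : ln (y * E y) <= y * E y - 1.
  have := @le_ln1Dx R (y * E y - 1); have -> : 1 + (y * E y - 1) = y * E y by ring.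
  by apply; lra.
have h2 := A1_lower (ltW y0); rewrite A1E in h2.
have d0 : 0 < 3 + 2 * y ^+ 2 by lra.
have h3 : y * E y - 1 <= - (1 / (3 + 2 * y ^+ 2)).
  by rewrite -(@ler_pM2r _ (3 + 2 * y ^+ 2)) // mulNr divfK ?gt_eqF //; lra.
have h4 : 1 / (2 * y ^+ 2) - 1 / (3 + 2 * y ^+ 2) <= 3 / (4 * y ^+ 4).
  rewrite -subr_ge0.
  have -> : 3 / (4 * y ^+ 4) - (1 / (2 * y ^+ 2) - 1 / (3 + 2 * y ^+ 2)) = 9 / (4 * y ^+ 4 * (3 + 2 * y ^+ 2)).
    by field; rewrite !lt0r_neq0.
  by rewrite divr_ge0 // ltW // !mulr_gt0 // exprn_gt0.
lra.
Qed.

Lemma dv_xlnx y : 0 < y -> dv (fun y => y * ln y - y) y (ln y).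
Proof.
move=> y0; apply: dv_eq; first exact: (dvD (dvM (dvI y) (dv_ln y0)) (dvN (dvI y))).
by rewrite /=; field; exact: lt0r_neq0.
Qed.

Lemma xlnx_cvg0 : (fun n : nat => expR (- n%:R) * ln (expR (- n%:R))) @ \oo --> (0 : R).
Proof.
have h := @poisw_cvg0 R 1.
have -> : (0 : R) = - 0 by rewrite oppr0.
rewrite (_ : (fun n => _) = fun n : nat => - poisw n%:R 1); first exact: cvgN.
by apply/funext => n; rewrite expRK /poisw expr1 (_ : 1`!%:R = 1 :> R) // divr1; ring.
Qed.

Lemma expn_cvg0 : (fun n : nat => expR (- n%:R)) @ \oo --> (0 : R).
Proof.
have h := @poisw_cvg0 R 0.
by rewrite (_ : (fun n => _) = fun n : nat => poisw n%:R 0) //; apply/funext => n; rewrite /poisw expr0 fact0 divr1 mulr1.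
Qed.

(** The left end is open: the interval is exhausted from [e^(- n)]. *)
Lemma pos_integral (G g K k : R -> R) (a l b l' : R) :
  (forall y, 0 < y -> dv G y (g y)) -> (forall y, 0 < y -> {for y, continuous g}) ->
  (forall y, 0 < y -> dv K y (k y)) -> (forall y, 0 < y -> {for y, continuous k}) ->
  (forall y, 0 < y -> `|g y| <= k y) ->
  (fun n : nat => G (expR (- n%:R))) @ \oo --> a -> tends G l ->
  (fun n : nat => K (expR (- n%:R))) @ \oo --> b -> tends K l' ->
  \int[lebesgue_measure]_(y in `]0, +oo[) g y = l - a.
Proof.
move=> dG cg dK ck gk hl hl' kl kl'.
have pos n : 0 < expR (- n%:R) :> R by exact: expR_gt0.
apply: (@Rintegral_exhaust R `]0, +oo[ (fun n => expR (- n%:R)) (fun n => n%:R + 2) g G k K _ (l' - b)).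
- exact: measurable_itv.
- move=> n; apply: le_lt_trans (_ : 1 < _); first by rewrite expR_le1 oppr_le0.
  by have : 0 <= n%:R :> R by []; lra.
- by move=> m n mn; rewrite ler_expR lerN2 ler_nat lerD2r ler_nat.
- move=> y; rewrite /= in_itv /= andbT; split=> [y0|[n /andP[h _]]]; last exact: lt_le_trans h.
  pose n := (Num.bound y + Num.bound y^-1)%N.
  have b1 : y < (Num.bound y)%:R by apply: archi_boundP; exact: ltW.
  have b2 : y^-1 < (Num.bound y^-1)%:R by apply: archi_boundP; rewrite invr_ge0 ltW.
  exists n; rewrite /n natrD; apply/andP; split; last first.
    by have : 0 <= (Num.bound y^-1)%:R :> R by []; lra.
  rewrite expRN -[leRHS]invrK lef_pV2 ?posrE ?expR_gt0 ?invr_gt0 //.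
  apply: le_trans (expR_ge1Dx _).
  by have : 0 <= (Num.bound y)%:R :> R by []; lra.
- by move=> y; rewrite /= in_itv /= andbT; exact: dG.
- by move=> y; rewrite /= in_itv /= andbT; exact: cg.
- by move=> y; rewrite /= in_itv /= andbT; exact: dK.
- by move=> y; rewrite /= in_itv /= andbT; exact: ck.
- by move=> y; rewrite /= in_itv /= andbT; exact: gk.
- by apply: cvgB => //; apply: (tends_seq (c := 0) hl') => n; lra.
- by apply: cvgB => //; apply: (tends_seq (c := 0) kl') => n; lra.
Qed.

Lemma ln_mulE y : 0 < y -> ln (y * E y) = lnE y + ln y.
Proof. by move=> y0; rewrite lnM ?posrE ?E_gt0 // addrC. Qed.

(** The integrand of [J+] is the derivative of [y^2 ln (y E) - IQ / 2], and [y^2 ln (y E)]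
decreases from 0 to [- 1/2]. *)
Lemma pos_constants (IL IQ : R -> R) :
  (forall y, dv IL y (lnE y)) -> (forall y, dv IQ y (corrL y)) -> IL 0 = 0 -> IQ 0 = 0 ->
  exists lA lQ : R, [/\
    \int[lebesgue_measure]_(y in `]0, +oo[) (ln (erfc y / 2) + y ^+ 2 + ln y + ln (2 * sp)) = lA,
    Jplus R = - (1 / 2) - lQ / 2,
    forall y, 1 <= y -> `|lA - (IL y + y * ln y - y - 1 / (2 * y))| <= 1 / (4 * y ^+ 3) &
    forall y, 1 <= y -> `|lQ - IQ y| <= 84 / y].
Proof.
move=> dIL dIQ L0 Q0.
have [lA hA bA] : exists2 l, tends (fun y => IL y + (y * ln y - y) - 1 / 2 * y^-1) l &
    forall y, 1 <= y -> `|l - (IL y + (y * ln y - y) - 1 / 2 * y^-1)| <= 0 - (- (1 / 4) * y^-1 ^+ 3).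
  apply: (@tends_dominated R _ (fun y => ln (y * E y) + 1 / (2 * y ^+ 2)) _ (fun y => 3 / (4 * y ^+ 4))).
  - move=> y y1; have y0 : 0 < y by lra.
    apply: dv_eq; first exact: (dvD (dvD (dIL y) (dv_xlnx y0)) (dvN (dvM (dvC y (1/2)) (dvV (lt0r_neq0 y0) (dvI y))))).
    by rewrite ln_mulE //; field; exact: lt0r_neq0.
  - move=> y y1; have y0 : 0 < y by lra.
    apply: dv_eq; first exact: (dvM (dvC y (- (1/4))) (dvX 3 (dvV (lt0r_neq0 y0) (dvI y)))).
    by rewrite /=; field; exact: lt0r_neq0.
  - by move=> y y1; have y0 : 0 < y by [lra]; have /andP[h1 h2] := ln_yE y0; rewrite ger0_norm.
  - by move=> y y1; rewrite mulNr oppr_le0 mulr_ge0 // exprn_ge0 // invr_ge0; lra.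
have [lQ hQ bQ] : exists2 l, tends IQ l & forall y, 0 <= y -> `|l - IQ y| <= 0 - - 84 * E y.
  apply: (@tends_dominated R _ (@corrL R) _ (fun y => 84 * A 1 y)).
  - by move=> y _.
  - by move=> y _; apply: dv_eq; first exact: (dvM (dvC y (- 84)) (dv_E' y)); rewrite mul0r add0r mulrN mulNr opprK.
  - move=> y y0; apply: le_trans (corrL_bound y0) _.
    by have := A1_ge y0; lra.
  - by move=> y _; have := E_gt0 y; lra.
exists lA, lQ.
have ILc : (fun n : nat => IL (expR (- n%:R))) @ \oo --> (0 : R).
  rewrite -L0; apply: (@cvg_comp _ _ _ (fun n : nat => expR (- n%:R)) IL _ (nbhs (0 : R))); first exact: expn_cvg0.
  exact: (dv_cont (dIL 0)).
have IQc : (fun n : nat => IQ (expR (- n%:R))) @ \oo --> (0 : R).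
  rewrite -Q0; apply: (@cvg_comp _ _ _ (fun n : nat => expR (- n%:R)) IQ _ (nbhs (0 : R))); first exact: expn_cvg0.
  exact: (dv_cont (dIQ 0)).
have hA' : tends (fun y => IL y + (y * ln y - y)) lA.
  have hi : tends (fun y => 1 / 2 * y^-1) (0 : R).
    by apply: (@tends_inv R _ 0 (1/2)) => y y1; rewrite subr0 ger0_norm // mulr_ge0 // invr_ge0; lra.
  have := tendsD hA hi; rewrite addr0 => h e e0; have [a ha] := h e e0.
  by exists a => y ya; have := ha y ya; rewrite subrK.
have A0c : (fun n : nat => IL (expR (- n%:R)) + (expR (- n%:R) * ln (expR (- n%:R)) - expR (- n%:R))) @ \oo --> (0 : R).
  rewrite [X in _ --> X](_ : 0 = 0 + (0 - 0)); last by ring.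
  by apply: cvgD ILc _; apply: cvgB; [exact: xlnx_cvg0 | exact: expn_cvg0].
split.
- rewrite (_ : (fun y : R => _) = fun y => lnE y + ln y); last first.
    by apply/funext => y; rewrite -/(lnerfc y) lnerfcE; ring.
  rewrite (@pos_integral (fun y => IL y + (y * ln y - y)) _ (fun y => - (IL y + (y * ln y - y))) (fun y => - (lnE y + ln y)) 0 lA (- 0) (- lA)) ?subr0 //.
  + by move=> y y0; exact: (dvD (dIL y) (dv_xlnx y0)).
  + by move=> y y0; exact: (dv_cont (dvD (dv_lnE y) (dv_ln y0))).
  + by move=> y y0; exact: (dvN (dvD (dIL y) (dv_xlnx y0))).
  + by move=> y y0; exact: (dv_cont (dvN (dvD (dv_lnE y) (dv_ln y0)))).
  + move=> y y0; rewrite -ln_mulE // ler0_norm //; apply: ln_le0; exact: ltW (yE_lt1 y).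
  + exact: cvgN.
  + exact: tendsN.
- have y2E : tends (fun y => y ^+ 2 * (lnE y + ln y)) (- (1 / 2)).
    apply: (@tends_inv R _ _ (3 / 4)) => y y1; have y0 : 0 < y by lra.
    have /andP[h1 h2] := ln_yE y0; rewrite -ln_mulE //.
    have y20 : 0 < y ^+ 2 by exact: exprn_gt0.
    have -> : y ^+ 2 * ln (y * E y) - - (1 / 2) = y ^+ 2 * (ln (y * E y) + 1 / (2 * y ^+ 2)).
      by field; exact: lt0r_neq0.
    rewrite ger0_norm; last by apply: mulr_ge0 => //; exact: ltW.
    apply: le_trans (ler_wpM2l (ltW y20) h2) _.
    have -> : y ^+ 2 * (3 / (4 * y ^+ 4)) = 3 / 4 * y^-1 * y^-1 by field; exact: lt0r_neq0.
    have i0 : 0 <= y^-1 by rewrite invr_ge0 ltW.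
    have i1 : y^-1 <= 1 by rewrite invf_le1.
    by rewrite -[leRHS]mulr1 ler_wpM2l // mulr_ge0.
  have y2E0 : (fun n : nat => expR (- n%:R) ^+ 2 * (lnE (expR (- n%:R)) + ln (expR (- n%:R)))) @ \oo --> (0 : R).
    rewrite (_ : (fun n => _) = fun n : nat => expR (- n%:R) * (expR (- n%:R) * lnE (expR (- n%:R)) + expR (- n%:R) * ln (expR (- n%:R)))); last first.
      by apply/funext => n; ring.
    rewrite [X in _ --> X](_ : 0 = 0 * (0 * lnE 0 + 0)); last by ring.
    apply: cvgM; first exact: expn_cvg0.
    apply: cvgD; last exact: xlnx_cvg0.
    apply: cvgM; first exact: expn_cvg0.
    apply: (@cvg_comp _ _ _ (fun n : nat => expR (- n%:R)) (@lnE R) _ (nbhs (0 : R))); first exact: expn_cvg0.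
    exact: (dv_cont (dv_lnE 0)).
  have dE y := dvV (lt0r_neq0 (E_gt0 y)) (dv_E y).
  have dy2 y (y0 : 0 < y) := dvM (dvX 2 (dvI y)) (dvD (dv_lnE y) (dv_ln y0)).
  pose g y := 2 * y * (lnE y + ln y) + y + 2 * y ^+ 3 - 2 * y ^+ 2 * (E y)^-1 - 1 / 2 * corrL y.
  rewrite /Jplus (_ : (fun y : R => _) = g); last first.
    apply/funext => y; rewrite -/(lnerfc y) lnerfcE /g /corrL A3E A2E A1E.
    have -> : expR (- y ^+ 2) * (1 - 5 * y ^+ 2) / (3 * sp * erfc y) = (1 - 5 * y ^+ 2) / 3 * (E y)^-1.
      rewrite -gauss_erfc /gauss; have s0 := sqrtpi_gt0 R; have er := erfc_gt0 y.
      by field; rewrite !lt0r_neq0.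
    by field; exact: lt0r_neq0 (E_gt0 y).
  have dg y : 0 < y -> dv (fun y => y ^+ 2 * (lnE y + ln y) - 1 / 2 * IQ y) y (g y).
    move=> y0; apply: dv_eq; first exact: (dvD (dy2 y y0) (dvN (dvM (dvC y (1/2)) (dIQ y)))).
    have e0 := E_gt0 y.
    by rewrite /g /lnE1 A1E /=; field; rewrite !lt0r_neq0.
  (* Both parts of [g] have a constant sign, the first by [A2_le_EA1]; changing the sign
     of the first gives a dominating function with an explicit antiderivative. *)
  pose k y := - (2 * y * (lnE y + ln y) + y + 2 * y ^+ 3 - 2 * y ^+ 2 * (E y)^-1) - 1 / 2 * corrL y.
  have dk y : 0 < y -> dv (fun y => - (y ^+ 2 * (lnE y + ln y)) - 1 / 2 * IQ y) y (k y).
    move=> y0; apply: dv_eq; first exact: (dvD (dvN (dy2 y y0)) (dvN (dvM (dvC y (1/2)) (dIQ y)))).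
    have e0 := E_gt0 y.
    by rewrite /k /lnE1 A1E /=; field; rewrite !lt0r_neq0.
  have cg y : 0 < y -> {for y, continuous g}.
    move=> y0; apply: dv_cont.
    exact: (dvD (dvD (dvD (dvD (dvM (dvM (dvC y 2) (dvI y)) (dvD (dv_lnE y) (dv_ln y0))) (dvI y)) (dvM (dvC y 2) (dvX 3 (dvI y))))
       (dvN (dvM (dvM (dvC y 2) (dvX 2 (dvI y))) (dE y)))) (dvN (dvM (dvC y (1/2)) (dv_corrL y)))).
  rewrite (@pos_integral _ g _ k (0 - 1 / 2 * 0) (- (1 / 2) - 1 / 2 * lQ) (- 0 - 1/2 * 0) (- - (1/2) - 1/2 * lQ) dg cg dk) //.
  + by field.
  + move=> y y0; apply: dv_cont.
    exact: (dvD (dvN (dvD (dvD (dvD (dvM (dvM (dvC y 2) (dvI y)) (dvD (dv_lnE y) (dv_ln y0))) (dvI y)) (dvM (dvC y 2) (dvX 3 (dvI y))))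
       (dvN (dvM (dvM (dvC y 2) (dvX 2 (dvI y))) (dE y))))) (dvN (dvM (dvC y (1/2)) (dv_corrL y)))).
  + move=> y y0; have e0 := E_gt0 y.
    have qn : corrL y <= 0.
      rewrite /corrL oppr_le0; apply: divr_ge0; first exact: ltW (A_gt0 3 y).
      by apply: mulr_ge0 => //; exact: ltW.
    have nn : 2 * y * (lnE y + ln y) + y + 2 * y ^+ 3 - 2 * y ^+ 2 * (E y)^-1 <= 0.
      have := @le_ln1Dx R (y * E y - 1); have -> : 1 + (y * E y - 1) = y * E y by ring.
      rewrite ln_mulE // => h1.
      have {}h1 : lnE y + ln y <= y * E y - 1 by apply: h1; have := mulr_gt0 y0 e0; lra.
      have {}h1 : 2 * y * (lnE y + ln y) <= 2 * y * (y * E y - 1) by rewrite ler_wpM2l // mulr_ge0 // ltW.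
      have := A2_le_EA1 (ltW y0); rewrite A2E A1E => h2.
      have : (2 * y * (y * E y - 1) + y + 2 * y ^+ 3 - 2 * y ^+ 2 * (E y)^-1) * E y <= 0.
        have -> : (2 * y * (y * E y - 1) + y + 2 * y ^+ 3 - 2 * y ^+ 2 * (E y)^-1) * E y =
          y * ((2 * E y - 2 * y * (2 - 2 * y * E y) - 2 * E y * (2 - 2 * y * E y)) / 2).
          by field; exact: lt0r_neq0.
        by rewrite pmulr_rle0 //; lra.
      by rewrite pmulr_lle0 //; lra.
    rewrite /g /k; move: (_ + _ + _ - _) nn => m nn.
    by rewrite ler_norml; apply/andP; split; lra.
  + by apply: cvgB y2E0 _; apply: cvgM => //; exact: cvg_cst.
  + exact: (tendsD y2E (tendsN (tendsZ (1/2) hQ))).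
  + by apply: cvgB; [exact: cvgN | apply: cvgM => //; exact: cvg_cst].
  + exact: (tendsD (tendsN y2E) (tendsN (tendsZ (1/2) hQ))).
- move=> y y1; have y0 : 0 < y by lra.
  have -> : 1 / (2 * y) = 1 / 2 * y^-1 by field; exact: lt0r_neq0.
  have -> : 1 / (4 * y ^+ 3) = 0 - (- (1 / 4) * y^-1 ^+ 3) by field; exact: lt0r_neq0.
  by have := bA y y1; rewrite addrA.
- move=> y y1; have y0 : 0 < y by lra.
  apply: le_trans (bQ y (ltW y0)) _.
  have := yE_lt1 y => h; rewrite ler_pdivlMr //; lra.
Qed.

End RightTail.

(** * The value at the cut *)

Section Junction.
Variable R : realType.
Implicit Types (x h t : R) (k N : nat).
Local Notation sp := (Num.sqrt (pi : R)).

Lemma poisw_gt0 x k : 0 < x -> 0 < poisw x k.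
Proof.
by move=> x0; rewrite /poisw mulr_gt0 ?expR_gt0 // divr_gt0 ?exprn_gt0 // ltr0n fact_gt0.
Qed.

Lemma ln_poisw x k : 0 < x -> ln (poisw x k) = - x + k%:R * ln x - lnfact R k.
Proof.
move=> x0; have f0 : 0 < k`!%:R :> R by rewrite ltr0n fact_gt0.
rewrite /poisw lnM ?posrE ?expR_gt0 ?divr_gt0 ?exprn_gt0 // expRK.
by rewrite ln_div ?posrE ?exprn_gt0 // lnXn // lnfactE mulr_natl addrA.
Qed.

(** Distribution function over its last mass, scaled so as to be comparable with [E]. *)
Definition mills x h k : R := 2 * h * pois x k / poisw x k.-1.

Lemma mills_rec x h k : 0 < x -> 2 * h ^+ 2 * x = 1 ->
  mills x h k.+1 = 2 * h + 2 * k%:R * h ^+ 2 * mills x h k.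
Proof.
move=> x0 hx; have xn := lt0r_neq0 x0.
case: k => [|k].
  rewrite /mills /= pois1 /poisw expr0 fact0 divr1 mulr1 mulr0 !mul0r addr0.
  by rewrite -mulrA divff ?mulr1 // gt_eqF // expR_gt0.
have w0 := lt0r_neq0 (poisw_gt0 k x0).
have wS : poisw x k.+1 = poisw x k * x / k.+1%:R.
  rewrite /poisw factS natrM invfM exprSr.
  have h1 : k.+1%:R != 0 :> R by rewrite pnatr_eq0.
  have h2 : k`!%:R != 0 :> R by rewrite pnatr_eq0 -lt0n fact_gt0.
  by move: (k.+1%:R : R) (k`!%:R : R) h1 h2 => a b h1 h2; field; rewrite h1 h2.
have h1 : k.+1%:R != 0 :> R by rewrite pnatr_eq0.
rewrite /mills /= poisS wS.
have -> : 2 * k.+1%:R * h ^+ 2 = k.+1%:R / x.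
  apply: (mulIf xn); rewrite divfK //.
  have -> : 2 * k.+1%:R * h ^+ 2 * x = k.+1%:R * (2 * h ^+ 2 * x) by ring.
  by rewrite hx mulr1.
move: (k.+1%:R : R) (pois x k.+1) (poisw x k) h1 w0 => a b c h1 w0.
by field; rewrite h1 w0 xn.
Qed.

Lemma expR_near0 (d : R) : `|d| <= 1 / 2 -> `|expR d - 1| <= 2 * `|d|.
Proof.
move=> hd; have h1 := expR_ge1Dx d; have h2 := expR_ge1Dx (- d).
have e0 := expR_gt0 d.
have h3 : expR d * expR (- d) = 1 by rewrite -expRD subrr expR0.
have h4 : expR d * (1 - d) <= 1.
  apply: le_trans (_ : expR d * expR (- d) <= 1); last by rewrite h3.
  by rewrite ler_wpM2l // ltW.
move: hd; rewrite ler_norml => /andP[d1 d2].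
have [d0|d0] := leP 0 d.
  have e2 : expR d <= 2.
    have : expR d * (1 / 2) <= expR d * (1 - d) by rewrite ler_wpM2l ?(ltW e0) //; lra.
    lra.
  have : expR d * d <= 2 * d by rewrite ler_wpM2r.
  by rewrite (ger0_norm d0) ger0_norm; lra.
have h5 : 0 <= expR d * (- d) by rewrite mulr_ge0 ?(ltW e0) //; lra.
by rewrite (ltr0_norm d0) ler0_norm; lra.
Qed.

Lemma ln_ratio x N t : (0 < N)%N -> 0 < x -> x = N%:R + t -> 0 <= t ->
  t / x <= ln x - ln N%:R <= t / N%:R.
Proof.
move=> N0 x0 xN t0; have n0 : 0 < N%:R :> R by rewrite ltr0n.
rewrite -ln_div ?posrE //; apply/andP; split.
  have := @le_ln1Dx R (N%:R / x - 1); have -> : 1 + (N%:R / x - 1) = N%:R / x by ring.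
  have -> : N%:R / x - 1 = - (t / x) by rewrite xN; field; rewrite -xN gt_eqF.
  rewrite -[ln (N%:R / x)]opprK -lnV ?posrE ?divr_gt0 // invf_div => h.
  suff : - 1 < - (t / x) by move=> /h; lra.
  by rewrite ltrN2 ltr_pdivrMr // mul1r xN ltrDr.
have := @le_ln1Dx R (x / N%:R - 1); have -> : 1 + (x / N%:R - 1) = x / N%:R by ring.
have -> : x / N%:R - 1 = t / N%:R by rewrite xN; field; rewrite gt_eqF.
by apply; apply: lt_le_trans (_ : 0 <= _) => //; rewrite divr_ge0 // ltW.
Qed.

(** Stirling's formula: at distance at most three from the mean the mass is
[h / sqrt pi] up to a relative error [O(1/x)]. *)
Lemma poisw_at_split x h N t : 0 < h -> 2 * h ^+ 2 * x = 1 -> x = N%:R + t -> 2 <= t -> t <= 3 -> 52 <= x ->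
  `|poisw x N.-1 / (2 * h) - 1 / (2 * sp)| <= 60 * h ^+ 2.
Proof.
move=> h0 hx xN t2 t3 x52.
have x0 : 0 < x by lra.
have n0 : 0 < N%:R :> R by lra.
have N0 : (0 < N)%N by move: n0; rewrite ltr0n.
have s0 : 0 < sp := sqrtpi_gt0 R.
have xV : x^-1 = 2 * h ^+ 2 by apply: (mulIf (lt0r_neq0 x0)); rewrite mulVf ?gt_eqF.
pose d := ln (poisw x N.-1) - ln (h / sp).
have /andP[r1 r2] := ln_ratio N0 x0 xN (ltac:(lra)).
have st := stirling R N0.
have hd : `|d| <= 13 / x.
  have l2 : ln (2 * pi) = ln 2 + 2 * ln sp :> R.
    have -> : 2 * ln sp = ln (pi : R).
      by rewrite mulr_natl -lnXn // sqr_sqrtr // pi_ge0.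
    by rewrite lnM ?posrE ?pi_gt0.
  have lh : 2 * ln h = - ln 2 - ln x.
    have : ln (2 * h ^+ 2 * x) = 0 by rewrite hx ln1.
    by rewrite !lnM ?posrE ?mulr_gt0 ?exprn_gt0 //; lra.
  have lw : ln (poisw x N.-1) = - x + N%:R * ln x - lnfact R N + ln N%:R - ln x.
    rewrite ln_poisw //; case: (N) N0 => // n _ /=.
    by rewrite /lnfact big_ord_recr /= -[n.+1%:R in X in _ = _ + X * _ - _ + _ - _]natr1; lra.
  have ed : d = - t + (N%:R - 1 / 2) * (ln x - ln N%:R) - (12 * N%:R)^-1
      - (lnfact R N - stirling_main N%:R - ln (2 * pi) / 2).
    rewrite /d lw ln_div ?posrE // /stirling_main l2.
    have -> : ln h = (- ln 2 - ln x) / 2 by rewrite -lh; field.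
    by rewrite [x in - x + _]xN; field; rewrite gt_eqF.
  have Nx : x / 2 <= N%:R by lra.
  have i1 : N%:R^-1 <= 2 / x.
    by rewrite -[2 / x]invrK lef_pV2 ?posrE ?invr_gt0 ?divr_gt0 // invf_div.
  have i0 : 0 < N%:R^-1 :> R by rewrite invr_gt0.
  have i2 : N%:R ^- 2 <= N%:R^-1 / 25 :> R.
    rewrite -exprVn expr2 ler_wpM2l ?(ltW i0) //.
    by rewrite lef_pV2 ?posrE //; lra.
  have i12 : (12 * N%:R)^-1 = N%:R^-1 / 12 :> R by rewrite invfM mulrC.
  have c0 : 0 < N%:R - 1 / 2 :> R by lra.
  have m1 : (N%:R - 1 / 2) * (t / x) <= (N%:R - 1 / 2) * (ln x - ln N%:R).
    by rewrite ler_wpM2l // ltW.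
  have m2 : (N%:R - 1 / 2) * (ln x - ln N%:R) <= (N%:R - 1 / 2) * (t / N%:R).
    by rewrite ler_wpM2l // ltW.
  have e1 : (N%:R - 1 / 2) * (t / x) = t - t * (t + 1 / 2) / x.
    by rewrite xN; field; rewrite -xN gt_eqF.
  have e2 : (N%:R - 1 / 2) * (t / N%:R) = t - t / 2 * N%:R^-1.
    by field; rewrite gt_eqF.
  have tt : t * (t + 1 / 2) / x <= (21 / 2) / x.
    by rewrite ler_wpM2r ?invr_ge0 ?(ltW x0) //; clear -t2 t3; nra.
  have tn : 0 <= t / 2 * N%:R^-1 by rewrite mulr_ge0 ?(ltW i0) //; clear -t2; lra.
  rewrite ed; move: st; rewrite i12; set e := lnfact R N - _ - _ => st.
  rewrite ler_norml in st; move/andP: st => [st1 st2].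
  have xp : 0 < x^-1 by rewrite invr_gt0.
  by rewrite ler_norml; clear -m1 m2 e1 e2 tt tn i0 i1 i2 st1 st2 xp; apply/andP; split; lra.
have dx : 13 / x <= 1 / 4 by rewrite ler_pdivrMr //; lra.
have hd2 : `|d| <= 1 / 2 by lra.
have ee := expR_near0 hd2.
have w0 := poisw_gt0 N.-1 x0.
have -> : poisw x N.-1 / (2 * h) - 1 / (2 * sp) = 1 / (2 * sp) * (expR d - 1).
  rewrite /d expRB !lnK ?posrE ?divr_gt0 //.
  by field; rewrite !lt0r_neq0.
have s1 : 1 <= sp.
  rewrite -(@ler_pXn2r _ 2) ?nnegrE ?(ltW s0) // sqr_sqrtr ?pi_ge0 // expr1n.
  by have := pi_ge2 R; lra.
have q0 : 0 <= 1 / (2 * sp) by rewrite divr_ge0 // mulr_ge0 // ltW.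
rewrite normrM (ger0_norm q0).
have s2 : 1 / (2 * sp) <= 1 by rewrite ler_pdivrMr ?mulr_gt0 //; lra.
have : 1 / (2 * sp) * `|expR d - 1| <= 1 * (2 * (13 * x^-1)).
  by apply: ler_pM => //; apply: le_trans ee _; lra.
by have := sqr_ge0 h; rewrite xV; lra.
Qed.

(** Mass times Mills ratio.  Near [y = 0] the correction [h A3 / 12] of the Mills ratio
is [2 h / 3] since [A 3 0 = 8], which is the correction of the Edgeworth
approximation there. *)
Lemma pois_at_split : exists K hs : R, [/\ 0 <= K, 0 < hs & forall x h N t, 0 < h -> h <= hs ->
  2 * h ^+ 2 * x = 1 -> x = N%:R + t -> 2 <= t -> t <= 3 ->
  `|pois x N - edgeworth h (t * h)| <= K * h ^+ 2].
Proof.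
have s0 : 0 < sp := sqrtpi_gt0 R.
have s1 : 1 <= sp.
  rewrite -(@ler_pXn2r _ 2) ?nnegrE ?(ltW s0) // sqr_sqrtr ?pi_ge0 // expr1n.
  by have := pi_ge2 R; lra.
have [c6 c60 LC] : exists2 c : R, 0 <= c & forall (h : R) (M : nat -> R), 0 < h -> h <= 1 / 36 ->
   (forall k, M k.+1 = 2 * h + 2 * k%:R * h ^+ 2 * M k) ->
   forall k, k%:R * h + h <= 1 / (2 * h) -> let y := 1 / (2 * h) - k.+1%:R * h in
   `|M k.+1 - (E y - h * A 3 y / 12)| <= c * h ^+ 2 * E y ^+ 3.
  by exists 600; [exact: ler0n | exact: left_comparison].
have [c4 c40 hc4] : exists2 c : R, 0 <= c & forall y, 0 <= y -> A 2 y <= c.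
  exists (45 * 2 ^+ 3) => [|y y0]; first by rewrite mulr_ge0 // exprn_ge0.
  apply: le_trans (A2_le y0) _; rewrite ler_wpM2l //.
  by apply: lerXn2r; rewrite ?nnegrE ?(ltW (E_gt0 y)) ?E_le2.
have [K1 [K10 K1E]] : exists K1 : R, 0 <= K1 /\ K1 = c6 * 8 + 3 / 12 * (16 + 2 * c4) + 6.
  by eexists; split; last reflexivity; lra.
have [K2 [K20 K2E]] : exists K2 : R, 0 <= K2 /\ K2 = 69.
  by eexists; split; last reflexivity; lra.
exists (K2 * 22 + (1 + K2) * K1), (1 / 36); split=> //.
  by have := mulr_ge0 K20 K10; lra.
move=> x h N t h0 hs hx xN t2 t3.
have hs' : h <= 1 / 36 by [].
have hV : x * h = 1 / (2 * h).
  by apply: (mulIf (lt0r_neq0 h0)); rewrite -[1 / _ * h](_ : 1 / 2 = _); [lra|field; rewrite gt_eqF].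
have x52 : 52 <= x by nra.
have x0 : 0 < x by lra.
have n0 : 0 < N%:R :> R by lra.
have N0 : (0 < N)%N by move: n0; rewrite ltr0n.
set y := t * h.
have y0 : 0 <= y by rewrite mulr_ge0 ?(ltW h0) //; lra.
have y3 : y <= 3 * h by rewrite ler_wpM2r ?(ltW h0).
have y1 : y <= 1 by lra.
have e0 := E_gt0 y; have e2 := E_le2 y0.
have e3 : E y ^+ 3 <= 8.
  by have -> : 8 = 2 ^+ 3 :> R by [ring]; apply: lerXn2r; rewrite ?nnegrE ?(ltW e0).
pose M := mills x h N.
pose Ma := E y - 2 / 3 * h * (1 + y ^+ 2).
have h2 := sqr_ge0 h.
have hM : `|M - Ma| <= K1 * h ^+ 2.
  have := @LC h (mills x h) h0 hs' (fun k => mills_rec k x0 hx) N.-1.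
  rewrite prednK // -/M.
  have -> : N.-1%:R * h + h = N%:R * h by rewrite -[in RHS](prednK N0) -natr1; ring.
  rewrite -hV => /(_ (ltac:(rewrite xN; nra))) /=.
  have -> : x * h - N%:R * h = y by rewrite /y xN; ring.
  move=> h1.
  have a2 := hc4 y y0.
  have a20 := A_gt0 2 y.
  have hA : `|A 3 y - 8| <= 3 * h * (16 + 2 * c4).
    have -> : A 3 y - 8 = - (y * (8 * E y + 2 * A 2 y)) by rewrite A3E A1E; ring.
    rewrite normrN ger0_norm; last by rewrite mulr_ge0 //; clear -e0 a20; lra.
    by apply: ler_pM => //; clear -e0 e2 a2 a20; lra.
  have E3 : c6 * h ^+ 2 * E y ^+ 3 <= c6 * h ^+ 2 * 8 by rewrite ler_wpM2l // mulr_ge0.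
  have y2 : y ^+ 2 <= 9 * h by clear -y0 y3 y1 h0; nra.
  have y20 := sqr_ge0 y.
  have -> : M - Ma = (M - (E y - h * A 3 y / 12)) - h / 12 * (A 3 y - 8) + 2 / 3 * h * y ^+ 2.
    by rewrite /Ma; field.
  have n1 : `|h / 12 * (A 3 y - 8)| <= h / 12 * (3 * h * (16 + 2 * c4)).
    by rewrite normrM ger0_norm ?divr_ge0 ?(ltW h0) // ler_wpM2l // divr_ge0 // ltW.
  have n2 : `|2 / 3 * h * y ^+ 2| <= 2 / 3 * h * (9 * h).
    have p0 : 0 <= 2 / 3 * h by rewrite mulr_ge0 // ltW.
    rewrite ger0_norm; first exact: ler_wpM2l.
    exact: mulr_ge0.
  apply: le_trans (ler_normD _ _) _.
  apply: le_trans (lerD (ler_normB _ _) (lexx _)) _.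
  by rewrite K1E; clear -h1 E3 n1 n2; lra.
pose a := poisw x N.-1 / (2 * h).
pose g := gauss y / (2 * sp).
have ha : `|a - 1 / (2 * sp)| <= 60 * h ^+ 2 by exact: poisw_at_split xN t2 t3 x52.
have g1 : `|gauss y - 1| <= 9 * h ^+ 2.
  have u := expR_ge1Dx (- y ^+ 2); rewrite -/(gauss y) in u.
  have v : gauss y <= 1 by rewrite /gauss expR_le1 oppr_le0 sqr_ge0.
  have w : y ^+ 2 <= 9 * h ^+ 2 by have := lerXn2r 2 y0 (mulr_ge0 (ler0n _ 3) (ltW h0)) y3; rewrite exprMn; clear; lra.
  by rewrite ler0_norm; clear -u v w; lra.
have s2 : 0 < 1 / (2 * sp) <= 1.
  by rewrite divr_gt0 ?mulr_gt0 // ler_pdivrMr ?mulr_gt0 //; clear -s1; lra.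
move/andP: s2 => [s20 s21].
have ga : `|a - g| <= K2 * h ^+ 2.
  have -> : a - g = (a - 1 / (2 * sp)) - 1 / (2 * sp) * (gauss y - 1).
    by rewrite /g; field; rewrite gt_eqF.
  apply: le_trans (ler_normB _ _) _; rewrite [`|1 / _ * _|]normrM ger0_norm ?(ltW s20) //.
  have : 1 / (2 * sp) * `|gauss y - 1| <= 1 * (9 * h ^+ 2) by apply: ler_pM => //; exact: ltW.
  by rewrite K2E; clear -ha; lra.
have pE : pois x N = a * M.
  rewrite /a /M /mills; field; rewrite !lt0r_neq0 // poisw_gt0 //.
have PE : edgeworth h y = g * Ma.
  rewrite edgeworthE erfcE /corrR /g /Ma; field; by rewrite !lt0r_neq0.
rewrite pE PE; have -> : a * M - g * Ma = (a - g) * Ma + a * (M - Ma) by ring.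
have g0 := gauss_gt0 y.
have g2 : gauss y <= 1 by rewrite /gauss expR_le1 oppr_le0 sqr_ge0.
have hg : `|g| <= 1.
  rewrite /g ger0_norm; last by rewrite divr_ge0 ?(ltW g0) // mulr_ge0 // ltW.
  by rewrite ler_pdivrMr ?mulr_gt0 //; clear -g0 g2 s1; lra.
have h21 : h ^+ 2 <= 1 by clear -h0 hs; nra.
have na : `|a| <= 1 + K2.
  have -> : a = (a - g) + g by ring.
  apply: le_trans (ler_normD _ _) _.
  have : K2 * h ^+ 2 <= K2 * 1 by rewrite ler_wpM2l.
  by clear -ga hg; lra.
have nM : `|Ma| <= 22.
  have y2 : y ^+ 2 <= 1 by rewrite expr_le1.
  have y20 := sqr_ge0 y.
  have b1 : h * (1 + y ^+ 2) <= 1 * 2 by clear -h0 hs y2 y20; apply: ler_pM; lra.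
  have b0 : 0 <= h * (1 + y ^+ 2) by rewrite mulr_ge0 ?(ltW h0) // addr_ge0.
  clear -e0 e2 b0 b1.
  by rewrite /Ma ler_norml; apply/andP; split; lra.
apply: le_trans (ler_normD _ _) _; rewrite (normrM (a - g)) (normrM a).
have : `|a - g| * `|Ma| <= (K2 * h ^+ 2) * 22 by apply: ler_pM.
have : `|a| * `|M - Ma| <= (1 + K2) * (K1 * h ^+ 2) by apply: ler_pM.
by clear; lra.
Qed.

End Junction.

(** * The elementary part of the expansion *)

Section Bookkeeping.
Variable R : realType.
Implicit Types (x h t : R) (N : nat).
Local Notation sp := (Num.sqrt (pi : R)).

Lemma ln1B_approx3 (u : R) : 0 <= u -> u <= 1 / 2 -> `|ln (1 - u) + u + u ^+ 2 / 2| <= 3 * u ^+ 3.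
Proof.
move=> u0 u2.
pose G i (v : R) := match i with 0 => ln v | 1 => v^-1 | 2 => - v^-1 ^+ 2 | _ => 2 * v^-1 ^+ 3 end.
have dG i v : (i < 3)%N -> `|v - 1| <= `|- u| -> dv (G i) v (G i.+1 v).
  rewrite normrN (ger0_norm u0) ler_norml => i3 /andP[v1 _]; have v0 : 0 < v by lra.
  have vn := lt0r_neq0 v0.
  case: i i3 => [|[|[|i]]] i3 //.
  - exact: dv_ln.
  - by apply: dv_eq; first exact: (dvV vn (dvI v)); rewrite /G; ring.
  - apply: dv_eq; first exact: (dvN (dvX 2 (dvV vn (dvI v)))).
    by rewrite /G /=; ring.
have bG v : `|v - 1| <= `|- u| -> `|G 3 v| <= 16.
  rewrite normrN (ger0_norm u0) ler_norml => /andP[v1 _]; have v0 : 1 / 2 <= v by lra.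
  have i2 : v^-1 <= 2 by rewrite -[2 in leRHS]invrK lef_pV2 ?posrE; lra.
  have i0 : 0 <= v^-1 by rewrite invr_ge0; lra.
  rewrite /G ger0_norm; last by rewrite mulr_ge0 // exprn_ge0.
  have : v^-1 ^+ 3 <= 2 ^+ 3 by apply: lerXn2r; rewrite ?nnegrE.
  by clear; lra.
have := taylor dG bG.
rewrite !big_ord_recr big_ord0 /= ln1 normrN (ger0_norm u0) invr1 !expr1n.
have -> : 2`!%:R = 2 :> R by [].
have -> : 3`!%:R = 6 :> R by [].
have -> : ln (1 - u) - (0 + 0 * (- u) ^+ 0 * 1 + 1 * (- u) ^+ 1 * 1 + -1 * (- u) ^+ 2 / 2) = ln (1 - u) + u + u ^+ 2 / 2.
  by field.
by have := exprn_ge0 3 u0; lra.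
Qed.

(** All terms of the sum that do not come from the integrals: the masses, the end [Y]
of the grid, and the difference between [ln E] and [ln (erfc / 2)] at the cut.  After
expansion of [ln N] and [ln Y] around [ln x] everything above [O(1/x)] cancels,
and [1/x = 2 h^2]. *)
Lemma bookkeeping (kappa : R) :
  (forall n, (0 < n)%N -> `|sumilni R n - glaisher_main n%:R - kappa| <= n%:R^-1) ->
  forall x h N t Y, 0 < h -> 2 * h ^+ 2 * x = 1 -> x = N%:R + t -> 2 <= t -> t <= 3 -> 52 <= x ->
  Y = 1 / (2 * h) - h / 2 ->
  `|(x - x * N%:R + N%:R * (N%:R - 1) / 2 * ln x - N%:R * lnfact R N + sumilni R N
      - N%:R * ln (2 * h) + (1 / (2 * Y) - Y * ln Y + Y) / h - ln (2 * sp) * (t - 1 / 2))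
    - (- (x ^+ 2 / 4) - x * ln x / 2 + (2 - ln (2 * pi) / 2) * x + ln x / 3 + ln (2 * pi) / 4
       + kappa - 1 / 12 + 1)| <= 240 * h ^+ 2.
Proof.
move=> hk x h N t Y h0 hx xN t2 t3 x52 Yd.
have x0 : 0 < x by lra.
have n0 : 0 < N%:R :> R by lra.
have N0 : (0 < N)%N by move: n0; rewrite ltr0n.
have s0 : 0 < sp := sqrtpi_gt0 R.
have xV : x^-1 = 2 * h ^+ 2 by apply: (mulIf (lt0r_neq0 x0)); rewrite mulVf ?gt_eqF.
have l2p : ln (2 * pi) = ln 2 + 2 * ln sp :> R.
  have -> : 2 * ln sp = ln (pi : R).
    by rewrite mulr_natl -lnXn // sqr_sqrtr // pi_ge0.
  by rewrite lnM ?posrE ?pi_gt0.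
have lh : ln h = (- ln 2 - ln x) / 2.
  have : ln (2 * h ^+ 2 * x) = 0 by rewrite hx ln1.
  by rewrite !lnM ?posrE ?mulr_gt0 ?exprn_gt0 //; lra.
have l2h : ln (2 * h) = ln 2 + ln h by rewrite lnM ?posrE.
have l2s : ln (2 * sp) = ln 2 + ln sp by rewrite lnM ?posrE.
have YE : Y = x * h * (1 - 1 / (2 * x)).
  have -> : x * h * (1 - 1 / (2 * x)) = x * h - h / 2 by field; rewrite gt_eqF.
  rewrite Yd; congr (_ - _); apply: (mulIf (lt0r_neq0 h0)).
  rewrite -[1 / _ * h](_ : 1 / 2 = _); first lra.
  by field; rewrite gt_eqF.
have v1 : 1 / (2 * x) <= 1 / 2 by rewrite ler_pdivrMr ?mulr_gt0 //; lra.
have v0 : 0 < 1 / (2 * x) by rewrite divr_gt0 ?mulr_gt0.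
pose e4 := ln (1 - 1 / (2 * x)) + 1 / (2 * x).
have he4 : `|e4| <= (1 / (2 * x)) ^+ 2.
  have := @ln1D_approx R (- (1 / (2 * x))); rewrite normrN (gtr0_norm v0) => /(_ v1).
  by rewrite opprK sqrrN.
have lY : ln Y = ln x + ln h + e4 - 1 / (2 * x).
  rewrite YE lnM ?posrE ?mulr_gt0 //; last by lra.
  by rewrite lnM ?posrE // /e4; ring.
pose u := t / x.
have u0 : 0 <= u by rewrite divr_ge0 ?(ltW x0) //; lra.
have u2 : u <= 1 / 2 by rewrite /u ler_pdivrMr //; lra.
pose e3 := ln (1 - u) + u + u ^+ 2 / 2.
have he3 : `|e3| <= 3 * u ^+ 3 by exact: ln1B_approx3.
have lN : ln N%:R = ln x - t / x - t ^+ 2 / (2 * x ^+ 2) + e3.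
  have -> : N%:R = x * (1 - u) by rewrite /u xN; field; rewrite -xN gt_eqF.
  rewrite lnM ?posrE //; last lra.
  by rewrite /e3 /u; field; rewrite gt_eqF.
pose e1 := lnfact R N - stirling_main N%:R - ln (2 * pi) / 2.
have he1 : `|e1| <= N%:R ^- 2 := stirling R N0.
pose e2 := sumilni R N - glaisher_main N%:R - kappa.
have he2 : `|e2| <= N%:R^-1 := hk N N0.
have lf : lnfact R N = stirling_main N%:R + ln (2 * pi) / 2 + e1 by rewrite /e1; ring.
have sg : sumilni R N = glaisher_main N%:R + kappa + e2 by rewrite /e2; ring.
have NE : N%:R = x - t by rewrite xN; ring.
(* An identity between rational functions in [x], [t] and the logarithms; [e1]-[e4] are
   the remainders of Stirling's formula, of the sum of [i ln i], of [ln N] and of [ln Y]. *)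
have main : (x - x * N%:R + N%:R * (N%:R - 1) / 2 * ln x - N%:R * lnfact R N + sumilni R N
      - N%:R * ln (2 * h) + (1 / (2 * Y) - Y * ln Y + Y) / h - ln (2 * sp) * (t - 1 / 2))
    - (- (x ^+ 2 / 4) - x * ln x / 2 + (2 - ln (2 * pi) / 2) * x + ln x / 3 + ln (2 * pi) / 4
       + kappa - 1 / 12 + 1) =
   (t ^+ 4 / 4 - t ^+ 2 / 24) * x^-1 ^+ 2 - (t / 12 + 1 / 4) * x^-1 + (2 * x - 1)^-1
   + (- N%:R * e1) + e2 + (1 / 12 - N%:R ^+ 2 / 2) * e3 - (x - 1 / 2) * e4.
  have Yh : (1 / (2 * Y) - Y * ln Y + Y) / h = x / (x - 1 / 2) - (x - 1 / 2) * ln Y + (x - 1 / 2).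
    have xm : x - 1 / 2 != 0 by clear -x52; rewrite gt_eqF //; lra.
    have yh : Y = (x - 1 / 2) * h by rewrite YE; field; rewrite gt_eqF.
    have -> : x / (x - 1 / 2) = (2 * h ^+ 2)^-1 / (x - 1 / 2) by rewrite -xV invrK.
    have x2 : x * 2 - 1 != 0 by clear -x52; rewrite gt_eqF //; lra.
    by move: (ln Y) => l; rewrite yh; field; rewrite x2 gt_eqF.
  rewrite Yh lf sg /stirling_main /glaisher_main lY lN l2h lh l2s l2p NE.
  move: (ln x) (ln 2) (ln sp) => a b s; clear -x0 x52 t2 t3.
  have x2 : x * 2 - 1 != 0 by rewrite gt_eqF //; lra.
  have xt : x - t != 0 by rewrite gt_eqF //; lra.
  have xn : x != 0 by rewrite gt_eqF //; lra.
  clearbody e1 e2 e3 e4.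
  by field; rewrite [2 * x]mulrC x2 xn xt.
rewrite main; clear main lf sg lN l2h l2s lh l2p YE lY Yd hk.
have xp : 0 < x^-1 by rewrite invr_gt0.
have i52 : x^-1 <= 1 / 52 by rewrite -[1 / 52](invrK) lef_pV2 ?posrE ?invr_gt0 ?divr_gt0 // invf_div divr1.
have Nx : x / 2 <= N%:R by lra.
have i1 : N%:R^-1 <= 2 * x^-1.
  have -> : 2 * x^-1 = (x / 2)^-1 by rewrite invf_div.
  by rewrite lef_pV2 ?posrE ?divr_gt0.
have b1 : `|- N%:R * e1| <= 2 * x^-1.
  rewrite normrM normrN (gtr0_norm n0); apply: le_trans (ler_wpM2l (ltW n0) he1) _.
  by apply: le_trans i1; rewrite expr2 invfM mulrA divff ?mul1r ?gt_eqF.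
have b2 : `|e2| <= 2 * x^-1 by exact: le_trans he2 i1.
have b3 : `|(1 / 12 - N%:R ^+ 2 / 2) * e3| <= 81 * x^-1.
  have NN : N%:R ^+ 2 <= x ^+ 2 by apply: lerXn2r; rewrite ?nnegrE ?(ltW n0) ?(ltW x0) //; lra.
  have x2 : 1 <= x ^+ 2 by rewrite exprn_ege1 //; lra.
  have p : `|1 / 12 - N%:R ^+ 2 / 2| <= x ^+ 2.
    by have := sqr_ge0 (N%:R : R); rewrite ler_norml; clear -NN x2 => n2; apply/andP; split; lra.
  have u3 : 3 * u ^+ 3 <= 81 * x^-1 ^+ 3.
    have : u ^+ 3 <= (3 * x^-1) ^+ 3.
      apply: lerXn2r; rewrite ?nnegrE ?u0 ?mulr_ge0 ?(ltW xp) //.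
      by rewrite /u ler_wpM2r // ltW.
    by rewrite exprMn; clear; lra.
  rewrite normrM; apply: le_trans (ler_pM _ _ p (le_trans he3 u3)) _ => //.
  rewrite le_eqVlt; apply/orP; left; apply/eqP.
  by field; rewrite gt_eqF.
have b4 : `|(x - 1 / 2) * e4| <= x^-1.
  rewrite normrM ger0_norm; last by clear -x52; lra.
  apply: le_trans (_ : x * (1 / (2 * x)) ^+ 2 <= _).
    by apply: ler_pM => //; clear -x52; lra.
  have -> : x * (1 / (2 * x)) ^+ 2 = x^-1 / 4 by field; rewrite gt_eqF.
  by lra.
have b5 : 0 <= (2 * x - 1)^-1 <= x^-1.
  by clear -x52; rewrite invr_ge0 lef_pV2 ?posrE; lra.
have b6 : `|(t ^+ 4 / 4 - t ^+ 2 / 24) * x^-1 ^+ 2| <= 21 * x^-1.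
  have t22 : t ^+ 2 <= 9 by clear -t2 t3; nra.
  have t20 : 4 <= t ^+ 2 by clear -t2 t3; nra.
  have t44 : t ^+ 4 <= 81 by have -> : t ^+ 4 = t ^+ 2 * t ^+ 2 by [ring]; clear -t20 t22; nra.
  have t40 : 16 <= t ^+ 4 by have -> : t ^+ 4 = t ^+ 2 * t ^+ 2 by [ring]; clear -t20 t22; nra.
  rewrite normrM [`|x^-1 ^+ 2|]ger0_norm ?sqr_ge0 //; apply: ler_pM; rewrite ?sqr_ge0 //.
    by rewrite ler_norml; clear -t22 t20 t44 t40; apply/andP; split; lra.
  by rewrite expr2 -[leRHS]mulr1 ler_wpM2l ?(ltW xp) //; clear -i52; lra.
have b7 : 0 <= (t / 12 + 1 / 4) * x^-1 <= x^-1.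
  rewrite mulr_ge0 ?(ltW xp) //=; last by clear -t2; lra.
  by rewrite -[leRHS]mul1r ler_wpM2r ?(ltW xp) //; clear -t3; lra.
have -> : 240 * h ^+ 2 = 120 * x^-1 by rewrite xV; ring.
move: b1 b2 b3 b4 b5 b6 b7 xp; clear; rewrite !ler_norml.
by move=> /andP[? ?] /andP[? ?] /andP[? ?] /andP[? ?] /andP[? ?] /andP[? ?] /andP[? ?] ?; apply/andP; split; lra.
Qed.

End Bookkeeping.

(** * The sum of logarithms *)

Section LogSum.
Variable R : realType.
Implicit Types (x h t : R) (N n : nat).
Local Notation sp := (Num.sqrt (pi : R)).

Lemma lipschitz0 (G g : R -> R) (B a : R) : 0 <= a -> (forall y, dv G y (g y)) ->
  (forall y, 0 <= y -> y <= a -> `|g y| <= B) -> `|G a - G 0| <= B * a.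
Proof.
move=> a0 dG hg.
have dB y : dv (fun y => B * y) y B.
  by apply: dv_eq; [exact: (dvM (dvC y B) (dvI y)) | rewrite mul0r add0r mulr1].
have h1 := dv_le a0 (fun y _ => dG y) (fun y _ => dB y).
have h2 := dv_le a0 (fun y _ => dvN (dB y)) (fun y _ => dG y).
rewrite ler_norml; apply/andP; split.
  have := h2 _; rewrite mulr0 oppr0 subr0; apply=> y /andP[y0 ya].
  by have := hg y y0 ya; rewrite ler_norml => /andP[].
have := h1 _; rewrite mulr0 subr0; apply=> y /andP[y0 ya].
by have := hg y y0 ya; rewrite ler_norml => /andP[].
Qed.

Lemma sum_lnfact N : \sum_(i < N) lnfact R i = N%:R * lnfact R N - sumilni R N.
Proof.
elim: N => [|N IH]; first by rewrite big_ord0 /sumilni big_ord0 mul0r subrr.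
rewrite big_ord_recr /= IH /sumilni /lnfact !big_ord_recr /= -[N.+1%:R in RHS]natr1.
by move: (\sum_(i < N) ln _) (\sum_(i < N) (_ * _)) (ln _) => a b c; ring.
Qed.

Lemma sum_ln_poisw x N : 0 < x ->
  \sum_(i < N) ln (poisw x i) = - x * N%:R + N%:R * (N%:R - 1) / 2 * ln x - N%:R * lnfact R N + sumilni R N.
Proof.
move=> x0; rewrite (_ : _ + sumilni R N = - x * N%:R + N%:R * (N%:R - 1) / 2 * ln x - \sum_(i < N) lnfact R i); last first.
  by rewrite sum_lnfact; ring.
elim: N => [|N IH]; first by rewrite !big_ord0 mulr0 !mul0r addr0 subr0.
by rewrite !big_ord_recr /= IH ln_poisw // -[N.+1%:R]natr1; field.
Qed.

Lemma poisw_rec x h k : 0 < x -> 2 * h ^+ 2 * x = 1 -> 2 * k.+1%:R * h ^+ 2 * poisw x k.+1 = poisw x k.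
Proof.
move=> x0 hx; rewrite /poisw factS natrM invfM [x ^+ k.+1]exprSr.
have h1 : k.+1%:R != 0 :> R by rewrite pnatr_eq0.
have -> : 2 * k.+1%:R * h ^+ 2 * (expR (- x) * (x ^+ k * x * (k.+1%:R^-1 / k`!%:R))) =
  (2 * h ^+ 2 * x) * (k.+1%:R / k.+1%:R) * (expR (- x) * (x ^+ k / k`!%:R)) by ring.
by rewrite hx divff // !mul1r.
Qed.

(** The antiderivatives [IL], [IQ] describe the part left of the cut and [IF], [IC] the
part right of it; their values at the cut nearly cancel and their values at
infinity are the integrals in the constants. *)
Lemma log_sum (kappa : R) :
  (forall n, (0 < n)%N -> `|sumilni R n - glaisher_main n%:R - kappa| <= n%:R^-1) ->
  forall IL IQ IF IC : R -> R,
  (forall y, dv IL y (lnE y)) -> (forall y, dv IQ y (corrL y)) ->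
  (forall y, dv IF y (lnerfc y)) -> (forall y, dv IC y (corrR y)) ->
  IL 0 = 0 -> IQ 0 = 0 -> IF 0 = 0 -> IC 0 = 0 ->
  forall lF lC lA lQ : R, tends (fun t => IF (- t)) lF -> tends (fun t => IC (- t)) lC ->
  (forall y, 1 <= y -> `|lA - (IL y + y * ln y - y - 1 / (2 * y))| <= 1 / (4 * y ^+ 3)) ->
  (forall y, 1 <= y -> `|lQ - IQ y| <= 84 / y) ->
  exists C hs : R, [/\ 0 <= C, 0 < hs & forall x h, 0 < h -> h <= hs -> 2 * h ^+ 2 * x = 1 ->
   exists2 l, (fun n => \sum_(i < n) ln (pois x i.+1)) @ \oo --> l &
   `|x + l - (- (x ^+ 2 / 4) - x * ln x / 2 + (2 - ln (2 * pi) / 2) * x + ln x / 3 + ln (2 * pi) / 4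
       + kappa - 1 / 12 + 1 + (lA - lF) / h + lQ - lC)| <= C * h].
Proof.
move=> hk IL IQ IF IC dIL dIQ dIF dIC L0 Q0 F0 C0 lF lC lA lQ hF hC hA hQ.
have [C1 [s1 [C10 s10 s11 LS]]] := left_sum R.
have [Kj [sj [Kj0 sj0 JN]]] := pois_at_split R.
have [s2 [C2 [s20 s21 C20 RC]]] := right_comparison R.
have K'0 : 0 <= C2 + 2 * Kj by lra.
have [C3 [s3 [C30 s30 s31 RS]]] := right_sum K'0.
have [C4 C40 RB] := right_bounds R.
pose sm := Num.min (Num.min s1 sj) (Num.min (Num.min s2 s3) (1 / 11)).
have sm0 : 0 < sm by rewrite !lt_min s10 sj0 s20 s30 /=.
have [c [c0 c9 c16 c144 [c240 c336]]] : exists c : R, [/\ 0 <= c, 9 <= c, 16 <= c, 144 <= c & 240 <= c /\ 336 <= c].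
  by exists 336; clear; split; [lra|lra|lra|lra|split; lra].
exists (C1 + C3 + 3 * C4 + 5 * c), sm; split=> //; first by clear -C10 C30 C40 c0; lra.
move=> x h h0 hs hx.
have [l1 l2 l3 l4 l5] : [/\ h <= s1, h <= sj, h <= s2, h <= s3 & h <= 1 / 11].
  move: hs; rewrite !le_min => /andP[/andP[-> ->] /andP[/andP[-> ->] ->]] //.
have x52 : 52 <= x.
  clear -l5 h0 hx; have e : h * (h * x) = 1 / 2.
    have -> : h * (h * x) = 1 / 2 * (2 * h ^+ 2 * x) by field.
    by rewrite hx mulr1.
  have hx0 : 0 < h * x by rewrite -(pmulr_rgt0 _ h0) e.
  have e1 : 11 / 2 <= h * x.
    have : 1 / 11 * (h * x) >= 1 / 2 by rewrite -e ler_wpM2r // ltW.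
    lra.
  have x0 : 0 < x by rewrite -(pmulr_rgt0 _ h0).
  have : h * x <= 1 / 11 * x by rewrite ler_wpM2r // ltW.
  lra.
have x0 : 0 < x by clear -x52; lra.
have hV : x * h = 1 / (2 * h).
  by apply: (mulIf (lt0r_neq0 h0)); rewrite -[1 / _ * h](_ : 1 / 2 = _); [clear -hx; lra|field; rewrite gt_eqF].
(* Two units between [N] and [x] are the room that [left_sum] needs. *)
have [N [t [xN t2 t3]]] : exists N t, [/\ x = N%:R + t, 2 <= t & t <= 3].
  have /andP[f1 f2] : (Num.truncn x)%:R <= x < (Num.truncn x).+1%:R by apply: truncn_itv; exact: ltW.
  have T2 : (2 <= Num.truncn x)%N.
    rewrite leqNgt; apply/negP => T1; have : (Num.truncn x).+1%:R <= 2%:R :> R by rewrite ler_nat.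
    by clear -f2 x52; lra.
  exists (Num.truncn x - 2)%N, (x - (Num.truncn x)%:R + 2); rewrite natrB //; split; [ring|clear -f1; lra|].
  by move: f2; rewrite -natr1; clear; lra.
pose Y := 1 / (2 * h) - h / 2.
pose y := Y - N%:R * h.
have yE : y = (t - 1 / 2) * h by rewrite /y /Y -hV xN; ring.
have y0 : 0 <= y by rewrite yE mulr_ge0 ?(ltW h0) //; clear -t2; lra.
have y3 : y <= 3 * h by rewrite yE ler_wpM2r ?(ltW h0) //; clear -t3; lra.
have y12 : y <= 1 / 2 by clear -y3 l5; lra.
have [Mpos LS1] : (forall k, (k < N)%N -> 0 < mills x h k.+1) /\
   `|\sum_(k < N) ln (mills x h k.+1) - ((IL Y - IL y) / h + (IQ Y - IQ y))| <= C1 * h.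
  apply: (LS h (mills x h) IL IQ) => // [k|]; first exact: mills_rec.
  by rewrite -hV [X in _ <= X * h]xN; have := ler_wpM2r (ltW h0) t2; clear; lra.
(* Each factor is mass times Mills ratio divided by [2 h]. *)
have left_part : \sum_(i < N) ln (pois x i.+1) = \sum_(i < N) ln (poisw x i)
    + \sum_(k < N) ln (mills x h k.+1) - N%:R * ln (2 * h).
  have -> : N%:R * ln (2 * h) = \sum_(i < N) ln (2 * h) by rewrite sumr_const card_ord mulr_natl.
  rewrite -big_split -sumrB /=; apply: eq_bigr => i _.
  have m0 := Mpos i (ltn_ord i); have w0 := poisw_gt0 i x0; have p0 := pois_gt0 i x0.
  have hh : 0 < 2 * h by rewrite mulr_gt0.
  have -> : pois x i.+1 = poisw x i * mills x h i.+1 / (2 * h).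
    by rewrite /mills /=; field; rewrite !gt_eqF.
  have pm : 0 < poisw x i * mills x h i.+1 := mulr_gt0 w0 m0.
  by rewrite ln_div ?posrE // lnM ?posrE.
have pd j : pois x j.+1 - pois x j = poisw x j by rewrite poisS addrAC subrr add0r.
have yN : 1 / (2 * h) - N%:R * h = t * h by rewrite -hV xN; ring.
have right_pw k : (N <= k)%N -> `|pois x k - edgeworth h (1 / (2 * h) - k%:R * h)| <= (C2 + 2 * Kj) * h ^+ 2 * D (1 / (2 * h) - k%:R * h).
  apply: (RC h (pois x) N Kj) => //.
  - by move=> j; rewrite !pd poisw_rec.
  - exact: pois_cvg1.
  - rewrite yN ger0_norm ?mulr_ge0 ?(ltW h0) //; last by clear -t2; lra.
    have : t * h <= 3 * h by rewrite ler_wpM2r ?(ltW h0).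
    by clear -l5; lra.
  - by rewrite yN; apply: JN.
have [rpos RS1] := RS h y (fun i => pois x (N.+1 + i)%N) IF IC h0 l4 dIF dIC y12
  (ltac:(move=> i; have := right_pw (N.+1 + i)%N (leq_trans (leqnSn _) (leq_addr _ _));
    (have -> : 1 / (2 * h) - (N.+1 + i)%:R * h = y - h / 2 - i%:R * h by rewrite /y /Y natrD -[N.+1%:R]natr1; field; rewrite gt_eqF); exact)).
pose S n := \sum_(i < n) ln (pois x (N.+1 + i)%N).
pose lim_main := (IF y - lF) / h + (IC y - lC).
have main_cvg : (fun n : nat => (IF y - IF (y - n%:R * h)) / h + (IC y - IC (y - n%:R * h))) @ \oo --> lim_main.
  have seq_cvg (G : R -> R) (l : R) : tends (fun t => G (- t)) l -> (fun n : nat => G (y - n%:R * h)) @ \oo --> l.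
    move=> hl; apply/cvgrPdist_le => e e0; have [a ha] := hl e e0.
    pose b : R := `|a| + 1.
    exists (Num.bound (b / h)) => // n /= bn.
    have -> : y - n%:R * h = - (n%:R * h - y) by ring.
    rewrite distrC; apply: ha.
    have b0 : 0 <= b / h by rewrite divr_ge0 ?(ltW h0) // addr_ge0.
    have h1 := archi_boundP b0.
    have h2 : b / h < n%:R by apply: lt_le_trans h1 _; rewrite ler_nat.
    move: h2; rewrite ltr_pdivrMr // /b => h2.
    by have := ler_norm a; clear -h2 y12; lra.
  apply: cvgD; last by apply: cvgB; [exact: cvg_cst | exact: seq_cvg].
  by apply: cvgM; last exact: cvg_cst; apply: cvgB; [exact: cvg_cst | exact: seq_cvg].
have Sdec : nonincreasing_seq S.
  apply/nonincreasing_seqP => n; rewrite /S big_ord_recr /= gerDl; apply: ln_le0.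
  exact: pois_le1.
(* Nonincreasing, and bounded below by the convergence of its approximation. *)
have Scvg : cvgn S.
  apply: nonincreasing_is_cvgn => //.
  move/cvgrPdist_le : main_cvg => /(_ 1 ltr01)[n0 _ hn0].
  exists (lim_main - 1 - C3 * h) => _ [n _ <-].
  apply: le_trans (Sdec n (maxn n n0) (leq_maxl _ _)).
  have := hn0 (maxn n n0) (leq_maxr _ _); rewrite /= ler_norml => /andP[_ u1].
  have := RS1 (maxn n n0); rewrite -/(S _) ler_norml => /andP[u2 _].
  by clear -u1 u2; lra.
pose lS := limn S.
have lS_main : `|lS - lim_main| <= C3 * h.
  have hc : (fun n => `|S n - ((IF y - IF (y - n%:R * h)) / h + (IC y - IC (y - n%:R * h)))|) @ \oo --> `|lS - lim_main|.
    by apply: cvg_norm; apply: cvgB.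
  by apply: (cvgr_to_le hc); exists 0%N => // n _; exact: RS1.
exists (\sum_(i < N) ln (pois x i.+1) + lS).
  rewrite -(cvg_shiftn N).
  have -> : (fun n => \sum_(i < n + N) ln (pois x i.+1)) = fun n => \sum_(i < N) ln (pois x i.+1) + S n.
    apply/funext => n; rewrite addnC big_split_ord /=; congr (_ + _).
  by apply: cvgD => //; exact: cvg_cst.
have bk := bookkeeping hk h0 hx xN t2 t3 x52 (erefl Y).
(* The grid starts at [Y], which is of order [1/h]: the tails of [IL] and [IQ] beyond
   [Y] are known up to [O(h^2)] and [O(h)]. *)
have Yge : 1 / (4 * h) <= Y.
  rewrite /Y; have -> : 1 / (2 * h) = 1 / (4 * h) + 1 / (4 * h) by field; rewrite gt_eqF.
  have : h / 2 <= 1 / (4 * h) by rewrite ler_pdivlMr ?mulr_gt0 //; clear -l5 h0; nra.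
  by clear; lra.
have i4 : 1 <= 1 / (4 * h) by rewrite ler_pdivlMr ?mulr_gt0 //; clear -l5; lra.
have Y1 : 1 <= Y by exact: le_trans Yge.
have Y0 : 0 < Y by exact: lt_le_trans Y1.
have Yi : Y^-1 <= 4 * h.
  by rewrite -[4 * h]invrK lef_pV2 ?posrE ?invr_gt0 ?mulr_gt0 // -[(4 * h)^-1]mul1r.
have Yi0 : 0 < Y^-1 by rewrite invr_gt0.
have h1 : h <= 1 by clear -l5; lra.
pose e1 := IL Y - (lA - Y * ln Y + Y + 1 / (2 * Y)).
have he1 : `|e1 / h| <= 16 * h.
  have := hA Y Y1; rewrite -normrN (_ : - (lA - _) = e1); last by rewrite /e1; ring.
  move=> b; rewrite normrM (gtr0_norm (_ : 0 < h^-1)) ?invr_gt0 // ler_pdivrMr //.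
  apply: le_trans b _; have -> : 1 / (4 * Y ^+ 3) = Y^-1 ^+ 3 / 4 by field; rewrite gt_eqF.
  have : Y^-1 ^+ 3 <= (4 * h) ^+ 3 by apply: lerXn2r; rewrite ?nnegrE ?(ltW Yi0) ?mulr_ge0 ?(ltW h0).
  have -> : (4 * h) ^+ 3 = 64 * (h * h) * h by ring.
  have : h * h * h <= h * h * 1 by rewrite ler_wpM2l // mulr_ge0 // ltW.
  by clear; lra.
pose e2 := IQ Y - lQ.
have he2 : `|e2| <= 336 * h.
  rewrite /e2 distrC; apply: le_trans (hQ Y Y1) _; clear -Yi; lra.
have he3 : `|IQ y| <= 144 * h.
  have := lipschitz0 (B := 48) y0 dIQ; rewrite Q0 subr0 => hh.
  apply: le_trans (hh _) _; last by clear -y3; lra.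
  move=> u u0 _; apply: le_trans (corrL_bound u0) _.
  have := E_le2 u0; have := E_gt0 u; clear; nra.
have he4 : `|IC y| <= 3 * C4 * h.
  have := lipschitz0 (B := C4) y0 dIC; rewrite C0 subr0 => hh.
  apply: le_trans (hh _) _; last by have := ler_wpM2l C40 y3; clear; lra.
  move=> u u0 uy; have u1 : u <= 1 by clear -uy y12; lra.
  have [_ b _] := RB u u1; apply: le_trans b _; rewrite -[leRHS]mulr1 ler_wpM2l //; exact: D_le1.
(* [ln (erfc / 2) = ln E - y^2 - ln (2 sqrt pi)]: the two leading antiderivatives differ
   by a polynomial, whose linear term enters [bookkeeping] and whose cubic term is
   [O(h)] after division by [h]. *)
have IFE : IF y = IL y - y ^+ 3 / 3 - ln (2 * sp) * y.
  have dT u : dv (fun u => IL u - u ^+ 3 / 3 - ln (2 * sp) * u) u (lnerfc u).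
    apply: dv_eq.
      exact: (dvD (dvD (dIL u) (dvN (dvM (dvX 3 (dvI u)) (dvC u 3^-1)))) (dvN (dvM (dvC u (ln (2 * sp))) (dvI u)))).
    by rewrite lnerfcE /=; field.
  have := dv_unique y0 (fun u _ => dIF u) (fun u _ => dT u).
  by rewrite F0 L0 expr0n /= mul0r mulr0 !subr0.
have he5 : `|y ^+ 3 / 3 / h| <= 9 * h.
  rewrite ger0_norm; last by rewrite !divr_ge0 ?exprn_ge0 ?(ltW h0).
  rewrite ler_pdivrMr //; have : y ^+ 3 <= (3 * h) ^+ 3 by apply: lerXn2r; rewrite ?nnegrE ?mulr_ge0 ?(ltW h0).
  have -> : (3 * h) ^+ 3 = 27 * (h * h) * h by ring.
  have : h * h * h <= h * h * 1 by rewrite ler_wpM2l // mulr_ge0 // ltW.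
  by clear; lra.
have hb : 240 * h ^+ 2 <= 240 * h by clear -h0 h1; rewrite expr2; nra.
move: bk; set B1 := (X in `|X - _|); set B2 := (X in `|_ - X|) => bk.
set SM := \sum_(k < N) ln (mills x h k.+1) in LS1 left_part.
pose d1 := SM - ((IL Y - IL y) / h + (IQ Y - IQ y)).
pose d2 := lS - lim_main.
have -> : x + (\sum_(i < N) ln (pois x i.+1) + lS) - (B2 + (lA - lF) / h + lQ - lC) =
  (B1 - B2) + d1 + d2 + e1 / h + e2 - IQ y + IC y - y ^+ 3 / 3 / h.
  rewrite left_part sum_ln_poisw // /d2 /d1 /lim_main /e1 /e2 /B1 IFE yE.
  by field; rewrite !gt_eqF.
rewrite -/d1 in LS1; rewrite -/d2 in lS_main.
have cN k : k <= c -> k * h <= c * h by move=> kc; rewrite ler_wpM2r // ltW.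
have {}hb := le_trans bk (le_trans hb (cN _ c240)).
have {}he1 := le_trans he1 (cN _ c16).
have {}he2 := le_trans he2 (cN _ c336).
have {}he3 := le_trans he3 (cN _ c144).
have {}he5 := le_trans he5 (cN _ c9).
move: hb LS1 lS_main he1 he2 he3 he4 he5; move: (B1 - B2) d1 d2 (e1 / h) e2 (IQ y) (IC y) (y ^+ 3 / 3 / h).
clear => z1 z2 z3 z4 z5 z6 z7 z8; rewrite !ler_norml.
move=> /andP[? ?] /andP[? ?] /andP[? ?] /andP[? ?] /andP[? ?] /andP[? ?] /andP[? ?] /andP[? ?].
by apply/andP; split; lra.
Qed.

End LogSum.

(** * The expansion of log q *)

Section Assembly.
Variable R : realType.

(** The product starts at [k = 2]; the missing first term of the sum is
[ln (pois x 1) = - x]. *)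
Lemma ln_q (r l : R) : 0 < r -> (fun n => \sum_(i < n) ln (pois (r ^+ 2) i.+1)) @ \oo --> l ->
  ln (q r) = r ^+ 2 + l.
Proof.
move=> r0 hl; set x := r ^+ 2 in hl *; have x0 : 0 < x by exact: exprn_gt0.
have prodE n : \prod_(2 <= k < n.+2) (upper_gamma k x / gamma R k) =
    expR (x + \sum_(i < n.+1) ln (pois x i.+1)).
  elim: n => [|n IH].
    by rewrite big_geq // big_ord_recr big_ord0 /= add0r pois1 expRK subrr expR0.
  rewrite big_nat_recr //= IH [in RHS]big_ord_recr /= [in RHS]addrA [RHS]expRD; congr (_ * _).
  by rewrite gamma_ratio ?(ltW x0) // lnK // posrE pois_gt0.
suff h : (fun n => \prod_(2 <= k < n) (upper_gamma k x / gamma R k)) @ \oo --> expR (x + l).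
  by rewrite /q (cvg_lim (@Rhausdorff R) h) expRK.
rewrite -(cvg_shiftn 2).
have -> : (fun n => \prod_(2 <= k < n + 2) (upper_gamma k x / gamma R k)) =
    fun n => expR (x + \sum_(i < n.+1) ln (pois x i.+1)).
  by apply/funext => n; rewrite addn2 prodE.
apply: (@cvg_comp _ _ _ (fun n : nat => x + \sum_(i < n.+1) ln (pois x i.+1)) (@expR R) _ (nbhs (x + l))).
  apply: cvgD; first exact: cvg_cst.
  by rewrite -(cvg_shiftS (fun n => \sum_(i < n) ln (pois x i.+1))) in hl.
exact: continuous_expR.
Qed.

End Assembly.

Theorem theorem1p2 (R : realType) (zeta : Cplx R -> Cplx R)
    (zetaP : is_riemann_zeta zeta) :
  (fun r : R =>
     ln (q r) -
     (- (r ^+ 4 / 4) - r ^+ 2 * ln r + a2 R * r ^+ 2 + a1 R * r +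
      2 / 3 * ln r + a0 zeta))
  =O_ (pinfty_nbhs R) (fun r : R => r `^ (- 6^-1)).
Proof.
have [kappa hk hkb] := sumilni_cvg R.
have zp := zeta_prime zetaP hk.
have [IL L0 dIL] := @antiderivative R (@lnE R) (fun y => dv_cont (dv_lnE y)).
have [IQ Q0 dIQ] := @antiderivative R (@corrL R) (fun y => dv_cont (dv_corrL y)).
have [IF F0 dIF] := @antiderivative R (@lnerfc R) (fun y => dv_cont (dv_lnerfc y)).
have [IC C0 dIC] := @antiderivative R (@corrR R) (fun y => dv_cont (dv_corrR y)).
have [lF [lC [hF hC intF Jm]]] := neg_constants dIF dIC F0 C0.
have [lA [lQ [intA Jp hA hQ]]] := pos_constants dIL dIQ L0 Q0.
have [C [hs [C_0 hs0 main]]] := log_sum hkb dIL dIQ dIF dIC L0 Q0 F0 C0 hF hC hA hQ.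
apply/eqO_exP; exists (C + 1); first by lra.
exists (Num.max 1 hs^-1); split; first exact: num_real.
move=> r; rewrite gt_max => /andP[r1 rh].
have r0 : 0 < r by lra.
have s20 : 0 < Num.sqrt 2 :> R by rewrite sqrtr_gt0.
have s22 : Num.sqrt 2 ^+ 2 = 2 :> R by rewrite sqr_sqrtr.
have s21 : 1 <= Num.sqrt 2 :> R.
  by rewrite -(@ler_pXn2r _ 2) ?nnegrE ?(ltW s20) // s22 expr1n; lra.
pose h := (Num.sqrt 2 * r)^-1.
have h0 : 0 < h by rewrite invr_gt0 mulr_gt0.
have hr : h <= r^-1.
  rewrite lef_pV2 ?posrE ?mulr_gt0 //; have := ler_wpM2r (ltW r0) s21; lra.
have hhs : h <= hs.
  apply: le_trans hr _; rewrite -[leRHS]invrK lef_pV2 ?posrE ?invr_gt0 //; exact: ltW.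
have hx : 2 * h ^+ 2 * r ^+ 2 = 1.
  by rewrite /h -{1}s22; field; rewrite !gt_eqF.
have [l hl hb] := main (r ^+ 2) h h0 hhs hx.
have lx : ln (r ^+ 2) = 2 * ln r by rewrite lnXn // mulr_natl.
rewrite (ln_q r0 hl).
have -> : r ^+ 2 + l - (- (r ^+ 4 / 4) - r ^+ 2 * ln r + a2 R * r ^+ 2 + a1 R * r +
      2 / 3 * ln r + a0 zeta) =
  r ^+ 2 + l - (- ((r ^+ 2) ^+ 2 / 4) - r ^+ 2 * ln (r ^+ 2) / 2 + (2 - ln (2 * pi) / 2) * r ^+ 2 + ln (r ^+ 2) / 3 + ln (2 * pi) / 4
       + kappa - 1 / 12 + 1 + (lA - lF) / h + lQ - lC).
  rewrite /a2 /a1 /a0 zp intF intA Jm Jp lx /h invrK.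
  by field.
apply: le_trans hb _; rewrite [`|r `^ _|]ger0_norm ?powR_ge0 //.
have hp : h <= r `^ (- 6^-1).
  apply: le_trans hr _; rewrite -(powR_inv1 (ltW r0)) ler_powR ?(ltW r1) //.
  by rewrite lerN2 invf_le1 //; lra.
have p0 := powR_ge0 r (- 6^-1).
have : C * h <= C * r `^ (- 6^-1) by rewrite ler_wpM2l.
lra.
Qed.
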